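(* Let $\mathcal{P}$ be an algebraic polyrectangle translation surface, and let $\mathcal{L}(t)$, $t\ge0$, be a half-infinite $1$-direction geodesic with arc-length parametrization on $\mathcal{P}$ whose slope $\alpha$ is an algebraic number. Let $K$ denote the smallest extension of $\mathbb{Q}$ that contains the coordinates of all the vertices of an algebraic net of $\mathcal{P}$, and suppose that $\alpha\notin K$. Then there are explicitly computable positive constants $c_{15}=c_{15}(\mathcal{P};\alpha)$ and $c_{16}=c_{16}(\mathcal{P};\alpha)$, depending only on $\mathcal{P}$ and $\alpha$, such that, for any integer $n\ge2$ and any aligned square $A$ of side length $1/n$ on the surface $\mathcal{P}$, there exists a real number $t_0$ such that $$0\le t_0\le c_{15}n^{c_{16}}\quad\text{and}\quad\mathcal{L}(t_0)\in A.$$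
   Context: A polyrectangle surface is a (compact, connected) flat surface obtained from a finite collection of rectangles with horizontal and vertical sides, glued along edges, with the remaining boundary edges identified in pairs. It is algebraic if it has a net on the plane such that (i) the net is a rectangular polygon (all sides horizontal or vertical), possibly with holes inside; (ii) the coordinates of all the vertices are algebraic numbers. Such a net is called an algebraic net of the surface. It is a translation surface if all the edge identifications are by translations (parallel horizontal edges with parallel horizontal edges, vertical with vertical), so that a $1$-direction geodesic flow (straight-line flow of constant slope) is defined on it. A half-infinite geodesic is one defined for all $t\ge0$ (it does not hit a vertex singularity). An aligned square is a square with horizontal and vertical sides. *)

(* Defs.v *)
From HB Require Import structures.
From Stdlib Require Import Relation_Operators.
From mathcomp Require Import all_boot all_order all_algebra.
From mathcomp Require Import all_classical all_reals all_analysis.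
From mathcomp Require Import lra.

Set Implicit Arguments.
Unset Strict Implicit.
Unset Printing Implicit Defensive.

Import Order.TTheory GRing.Theory Num.Theory.
Import numFieldNormedType.Exports.

(** * Partial recursive functions *)

Inductive recfun : Type :=
| Zero
| Succ
| Proj of nat
| Comp of recfun & seq recfun
| Prec of recfun & recfun
| Mu of recfun.

Inductive eval : recfun -> seq nat -> nat -> Prop :=
| eval_zero v : eval Zero v 0
| eval_succ x v : eval Succ (x :: v) x.+1
| eval_proj i v : eval (Proj i) v (nth 0%N v i)
| eval_comp f gs v w y :
    evals gs v w -> eval f w y -> eval (Comp f gs) v y
| eval_prec0 f g v y : eval f v y -> eval (Prec f g) (0%N :: v) y
| eval_precS f g k v z y :
    eval (Prec f g) (k :: v) z -> eval g [:: k, z & v] y ->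
    eval (Prec f g) (k.+1 :: v) y
| eval_mu f v k :
    eval f (k :: v) 0 ->
    (forall j, (j < k)%N -> exists m, eval f (j :: v) m.+1) ->
    eval (Mu f) v k
with evals : seq recfun -> seq nat -> seq nat -> Prop :=
| evals_nil v : evals [::] v [::]
| evals_cons g gs v x w :
    eval g v x -> evals gs v w -> evals (g :: gs) v (x :: w).

(* Inputs of a countable type are coded by the library's [pickle]. *)
Definition computable (T : countType) (f : T -> nat) : Prop :=
  exists r, forall x, eval r [:: pickle x] (f x).

Local Open Scope classical_set_scope.
Local Open Scope ring_scope.

(** * Real algebraic numbers *)

Section Numbers.
Variable R : realType.

Definition algebraic (x : R) : Prop := algebraicOver ratr x.

(* The smallest subfield of R containing S; it contains the rationals. *)
Definition field_gen (S : set R) : set R :=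
  [set x | forall F : {pred R}, GRing.divring_closed F ->
             (forall y, S y -> y \in F) -> x \in F].

(* Integer coefficients (constant term first) and an isolating interval. *)
Definition acode : countType := (seq int * (rat * rat))%type.

Definition acode_of (c : acode) (x : R) : Prop :=
  let p : {poly R} := map_poly intr (Poly c.1) in
  [/\ p != 0, root p x, ratr c.2.1 < x < ratr c.2.2 &
      forall y, root p y -> ratr c.2.1 < y < ratr c.2.2 -> y = x].

End Numbers.

(** * Nets and the surfaces they define *)

(* [true] stands for the positive direction: [(true, false)] is the quadrant
   to the right and below. *)
Definition quadrant : Type := (bool * bool)%type.

Definition adjacent (q q' : quadrant) : bool :=
  (q.1 == q'.1) (+) (q.2 == q'.2).

Section Surface.
Variable R : realType.

Definition shift (p : R * R) (q : quadrant) (a b : R) : R * R :=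
  (p.1 + (if q.1 then a else - a), p.2 + (if q.2 then b else - b)).

(* A corner of the net: a point together with one of its four quadrants. A point
   of the surface is a class of corners under the gluing. The cone angle there is
   pi/2 times the size of the class; and where two quadrants of the region meet
   only at a vertex, they may belong to different points of the surface. *)
Definition corner : Type := ((R * R) * quadrant)%type.

Definition is_corner (U : set (R * R)) (c : corner) : Prop :=
  exists2 e, 0 < e &
    forall a b, 0 <= a < e -> 0 <= b < e -> U (shift c.1 c.2 a b).

(* The i-th pair consists of two parallel edges of length [len i], with left (or
   lower) endpoints [origin i b]. Along the edge [(i, false)] the region lies
   below (or to the left), along [(i, true)] it lies above (or to the right);
   the translation from one to the other is the identification. *)
Record net : Type := Net {
  region : set (R * R);
  npairs : nat;
  horizontal : 'I_npairs -> bool;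
  origin : 'I_npairs -> bool -> R * R;
  len : 'I_npairs -> R }.

Definition edge (P : net) (i : 'I_(npairs P)) (b : bool) (s : R) : R * R :=
  if horizontal i then ((origin i b).1 + s, (origin i b).2)
  else ((origin i b).1, (origin i b).2 + s).

(* The quadrant in direction [d] along the i-th edges, on the side [b]. *)
Definition side (P : net) (i : 'I_(npairs P)) (d b : bool) : quadrant :=
  if horizontal i then (d, b) else (b, d).

Definition rectangle (r : (R * R) * (R * R)) : set (R * R) :=
  [set p | (r.1.1 <= p.1 <= r.2.1) /\ (r.1.2 <= p.2 <= r.2.2)].

Definition rectangular_polygon (U : set (R * R)) : Prop :=
  (exists (m : nat) (r : 'I_m.+1 -> (R * R) * (R * R)),
     [/\ forall k, (r k).1.1 < (r k).2.1 /\ (r k).1.2 < (r k).2.2,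
         trivIset setT (fun k => (rectangle (r k))°) &
         U = \bigcup_k rectangle (r k)]) /\
  connected U°.

Definition polyrectangle_translation_surface (P : net) : Prop :=
  [/\ rectangular_polygon (region P),
      forall i, 0 < @len P i,
      forall i b d s, 0 < s < len i ->
        is_corner (region P) (@edge P i b s, side i d b) /\
        ~ is_corner (region P) (@edge P i b s, side i d (~~ b)),
      trivIset setT (fun ib : 'I_(npairs P) * bool =>
        [set edge ib.1 ib.2 s | s in [set s | 0 < s < len ib.1]]) &
      region P `\` (region P)° `<=`
        [set p | exists i b s, 0 <= s <= len i /\ p = @edge P i b s]].

Definition vertex (P : net) : set (R * R) :=
  [set p | exists i b, p = @edge P i b 0 \/ p = @edge P i b (len i)].

Definition coordinate (P : net) : set R :=
  [set x | exists2 p, vertex P p & x = p.1 \/ x = p.2].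

Definition algebraic_net (P : net) : Prop :=
  forall x, coordinate P x -> algebraic x.

(* Two adjacent quadrants in the closed region have their common ray in its
   interior, so no edge separates them. *)
Inductive glue (P : net) : corner -> corner -> Prop :=
| glue_inside p q q' :
    is_corner (region P) (p, q) -> is_corner (region P) (p, q') ->
    adjacent q q' -> glue P (p, q) (p, q')
| glue_edges i d s :
    0 <= s <= len i -> (if d then s < len i else 0 < s) ->
    glue P (@edge P i false s, side i d false) (@edge P i true s, side i d true).

Definition surface_point (P : net) (c : corner) : set corner :=
  [set c' | clos_refl_sym_trans corner (glue P) c c'].

Definition flow (p u : R * R) (s : R) : R * R :=
  (p.1 + s * u.1, p.2 + s * u.2).

Definition singular (x : set corner) : Prop := ~ (x #= `I_4)%card.

(* [L] moves with unit speed in the direction of slope [alpha], in either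
   orientation, and meets no singularity at positive times. The forward and
   backward quadrants are those containing [u] and [- u], which presupposes
   [alpha != 0]. *)
Definition half_infinite_geodesic (P : net) (alpha : R) (L : R -> set corner) :
    Prop :=
  exists u : R * R,
    [/\ u.1 ^+ 2 + u.2 ^+ 2 = 1, u.2 = alpha * u.1 &
      forall t, 0 <= t ->
        (exists p e, [/\ 0 < e,
           is_corner (region P) (p, (0 < u.1, 0 < u.2)) &
           forall s, 0 <= s < e ->
             L (t + s) = surface_point P (flow p u s, (0 < u.1, 0 < u.2))]) /\
        (0 < t ->
           ~ singular (L t) /\
           exists p e, [/\ 0 < e,
             is_corner (region P) (p, (u.1 < 0, u.2 < 0)) &
             forall s, 0 <= s < e ->
               L (t - s) = surface_point P (flow p u (- s), (u.1 < 0, u.2 < 0))])].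

(* [A] is the image of the closed square of side [l] under a map which is a
   translation in the charts of the surface; the square may cross the edges of
   the net, and its boundary, but not its interior, may contain singularities. *)
Definition aligned_square (P : net) (l : R) (A : set (set corner)) : Prop :=
  exists phi : R * R -> set corner,
    (forall z q, rectangle ((0, 0), (l, l)) z ->
       (if q.1 then z.1 < l else 0 < z.1) ->
       (if q.2 then z.2 < l else 0 < z.2) ->
       exists p e, [/\ 0 < e, is_corner (region P) (p, q) &
         forall a b, 0 <= a < e -> 0 <= b < e ->
           phi (shift z q a b) = surface_point P (shift p q a b, q)]) /\
    A = phi @` rectangle ((0, 0), (l, l)).

End Surface.

(** * Finite descriptions of a net and a slope *)

(* For each pair of edges: whether they are horizontal, and the coordinates of
   their four endpoints. The edges and their sides determine the region. *)
Definition net_code : countType := (seq (bool * seq acode) * acode)%type.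

Definition endpoint_coordinates (R : realType) (P : net R)
    (i : 'I_(npairs P)) : seq R :=
  flatten [seq [:: p.1; p.2] | p <- [:: edge i false 0; edge i false (len i);
                                        edge i true 0; edge i true (len i)]].

Definition net_code_of (R : realType) (c : net_code) (P : net R) (alpha : R) :
    Prop :=
  [/\ size c.1 = npairs P,
      forall i : 'I_(npairs P),
        let ci := nth (false, [::]) c.1 i in
        [/\ ci.1 = horizontal i,
            size ci.2 = size (endpoint_coordinates i) &
            forall j, (j < size ci.2)%N ->
              acode_of (nth ([::], (0, 0)) ci.2 j)
                       (nth 0 (endpoint_coordinates i) j)] &
      acode_of c.2 alpha].

Section Codes.
Variable R : realType.

Lemma acode_exists (x : R) : algebraic x -> exists c, acode_of c x.
Proof.
move=> [p p0 px].
have [q [a a0 pE]] := rat_poly_scale p.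
pose Q : {poly R} := map_poly intr q.
have QE : map_poly (ratr : rat -> R) (map_poly intr q) = Q.
  by rewrite -map_poly_comp; apply: eq_map_poly => z /=; rewrite ratr_int.
have q0 : Q != 0.
  rewrite -QE map_poly_eq0; apply: contra_neq p0 => q0.
  by rewrite pE q0 scaler0.
have Qx : root Q x.
  move: px; rewrite pE map_polyZ /= QE rootZ // fmorph_eq0 invr_eq0.
  by rewrite intr_eq0.
have [m [g]] := multiplicity_XsubC Q x.
rewrite q0 /= => gx QgE.
have /cvgrPdist_lt/(_ `|g.[x]|) : {for x, continuous (fun y => g.[y])}.
  exact: continuous_horner.
rewrite normr_gt0 => /(_ gx) /nbhs_ballP [e /= e0 ge].
have [u] : exists u, ratr u \in `]x - e, x[ by apply: rat_in_itvoo; rewrite ltrBlDr ltrDl.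
have [v] : exists v, ratr v \in `]x, x + e[ by apply: rat_in_itvoo; rewrite ltrDl.
rewrite !in_itv /= => /andP[xv ve] /andP[eu ux].
exists (polyseq q, (u, v)); rewrite /acode_of /= polyseqK; split => //.
  by rewrite ux xv.
move=> y; rewrite -/Q QgE rootM => /orP[gy /andP[uy yv]|].
  suff /ge : ball x e y by rewrite /= (rootP gy) subr0 ltxx.
  by rewrite /ball /= ltr_norml; apply/andP; split; lra.
case: m {QgE} => [|m]; first by rewrite expr0 /root hornerC oner_eq0.
by rewrite root_exp_XsubC => /eqP ->.
Qed.

Lemma net_code_exists (P : net R) (alpha : R) :
  algebraic_net P -> algebraic alpha -> exists c, net_code_of c P alpha.
Proof.
move=> algP /acode_exists [ca caP].
have vtx (i : 'I_(npairs P)) b :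
    vertex P (edge i b 0) /\ vertex P (edge i b (len i)).
  by split; exists i, b; [left|right].
have alg (i : 'I_(npairs P)) x : x \in endpoint_coordinates i -> algebraic x.
  rewrite /endpoint_coordinates /= !inE => xi; apply: algP.
  have [[v1 v2] [v3 v4]] := (vtx i false, vtx i true).
  move: xi; do ![case/orP] => /eqP ->;
    by [eexists; [exact: v1|auto] | eexists; [exact: v2|auto]
       |eexists; [exact: v3|auto] | eexists; [exact: v4|auto]].
pose f (x : R) : acode :=
  if pselect (algebraic x) is left h then projT1 (cid (acode_exists h))
  else ([::], (0, 0)).
have fP x : algebraic x -> acode_of (f x) x.
  by rewrite /f; case: pselect => // h _; case: cid.
exists ([seq (horizontal i, map f (endpoint_coordinates i))
        | i <- enum 'I_(npairs P)], ca).
split=> [|i|]; [by rewrite size_map size_enum_ord| |exact: caP].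
rewrite (nth_map i) ?size_enum_ord ?ltn_ord // nth_ord_enum.
split=> [||j]; [by []|exact: size_map|rewrite size_map => jlt].
by rewrite (nth_map 0) //; apply: fP; apply: (alg i); exact: mem_nth.
Qed.

End Codes.

(* Main.v *)
Require Import Defs.
From Stdlib Require Import Relation_Operators.
From mathcomp Require Import all_boot all_order all_algebra.
From mathcomp Require Import all_classical all_reals all_analysis.
From mathcomp Require Import perm.
From mathcomp Require Import ring lra zify.
Set Implicit Arguments.
Unset Strict Implicit.
Unset Printing Implicit Defensive.
Import Order.TTheory GRing.Theory Num.Theory.
Import numFieldNormedType.Exports.
Local Open Scope classical_set_scope.
Local Open Scope ring_scope.

(** Along a line of slope [alpha] the transverse coordinate [om p = p.2 - alpha *
    p.1] is constant, and an identification of two edges changes it by a constant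
    [tr]. The flow therefore acts on the edges as an interval exchange whose
    translations are combinations of the coordinates of the vertices and of the
    slope. This is an arithmetic object: a nonzero combination of height [H] is at
    least a fixed power of [1 / H] in absolute value, because it is an eigenvalue of
    an integer matrix with entries [O(H)] ([liouville]).

    An aligned square contains the image of a vertical segment drawn in the net
    ([square_segment]), and tracing the flow back from a part of the segment that no
    line through a vertex meets leads to one edge. The square thus gives a target:
    an interval on an edge, with rational ends of denominator [O(n)], such that an
    orbit passing through it enters the square before it meets the next edge
    ([square_target]).

    The first step is that the orbits from the target return to it in a time
    polynomial in [n]. The exchange is discontinuous at finitely many states only,
    and each of these, and each end of the target, is reached from the target at one
    time at most before the first return. Among sufficiently many consecutive time
    windows, each ending at a power of the end of the preceding one, there is one in
    which none of them is reached. The starting points that meet one of them before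
    this window are separated by the Liouville bound; the strip between two
    neighbouring ones moves as a whole, its translates are disjoint until it returns,
    and there is no room for as many of them as the window is long
    ([strip_return], [returns_bound]).

    The second step is that every orbit visits the target ([all_hit]). The slope is
    not in the field of the coordinates, so no segment of slope [alpha] joins two
    vertices and no orbit is closed ([no_displacement]). Call a point settled if all
    nearby points agree on whether their orbits visit the target. The orbit of a
    point that is not settled can only run into a vertex or into an end of the
    target, and into the same end once at most; so it runs into a vertex. Recurrence
    makes the future and the past equivalent, so this happens in both directions,
    which is impossible: all points are settled ([settled_everywhere]), and the
    interior of the region is connected. By recurrence for the reversed flow a first
    visit cannot come late ([hit_bound]): the bound for returns is a bound for first
    visits.

    The edge that the flow hits first is constant between lines through vertices and
    stable near a line on which it is hit in its interior ([hits_uniform],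
    [hits_locally]). This gives the bound for generic orbits first, and for an
    arbitrary orbit up to its first vertex, since it runs parallel to generic ones. A
    geodesic follows the planar flow in its charts ([develop]); it may pass through
    one vertex whose cone angle is [2 pi], but not through two, so that two runs of
    the bounded length suffice ([run_geodesic]).

    The constants depend on the degrees and heights of the coordinates, on their size
    and on the number of edges. The number that codes the net bounds all of these, and
    the constants are built from it by sums, products and powers, so they are
    computable. *)

Local Notation shift := Defs.shift.
Local Notation glue := Defs.glue.
Local Notation adjacent := Defs.adjacent.

(* [lra] for chains of inequalities. *)
Local Ltac lras :=
  repeat match goal with
  | H : is_true (_ && _) |- _ => let h1 := fresh in let h2 := fresh in
      case/andP: H => h1 h2
  end;
  repeat match goal with
  | H : @eq (set _) _ _ |- _ => clear H
  | H : @eq (prod _ _) _ _ |- _ => clear H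
  | H : forall _, _ |- _ => clear H
  | H : ex _ |- _ => clear H
  end;
  try (apply/andP; split); first [done | lra].

(** * Recursive functions of a code *)

Section Computability.
Local Open Scope nat_scope.

Definition computable1 (f : nat -> nat) := exists r, forall x, Defs.eval r [:: x] (f x).
Definition computable2 (f : nat -> nat -> nat) :=
  exists r, forall x y, Defs.eval r [:: x; y] (f x y).

Lemma computable1_id : computable1 id.
Proof. by exists (Proj 0) => x; exact: (eval_proj 0 [:: x]). Qed.

Lemma computable1_const k : computable1 (fun=> k).
Proof.
elim: k => [|k [r rP]]; first by exists Zero => x; exact: eval_zero.
exists (Comp Succ [:: r]) => x; apply: (eval_comp (w := [:: k])).
  by apply: evals_cons; [exact: rP | exact: evals_nil].
exact: eval_succ.
Qed.

Lemma computable1_comp2 g f1 f2 : computable2 g -> computable1 f1 ->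
  computable1 f2 -> computable1 (fun x => g (f1 x) (f2 x)).
Proof.
move=> [g' gP] [r1 r1P] [r2 r2P]; exists (Comp g' [:: r1; r2]) => x.
apply: (eval_comp (w := [:: f1 x; f2 x])) => //.
by apply: evals_cons => //; apply: evals_cons => //; exact: evals_nil.
Qed.

(** All the recursion that sums, products and powers need: the step ignores
    the counter. *)
Lemma computable2_rec g h : computable1 g -> computable2 h ->
  computable2 (fun x y => iter x (h^~ y) (g y)).
Proof.
move=> [rg gP] [rh hP]; exists (Prec rg (Comp rh [:: Proj 1; Proj 2])) => x y.
elim: x => [|x IH] /=; first exact/eval_prec0/gP.
apply: (eval_precS IH); apply: (eval_comp (w := [:: iter x (h^~ y) (g y); y])) => //.
apply: evals_cons; first exact: (eval_proj 1 [:: x, _ & [:: y]]).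
apply: evals_cons; last exact: evals_nil.
exact: (eval_proj 2 [:: x, iter x (h^~ y) (g y) & [:: y]]).
Qed.

Lemma computable2_ext g h : g =2 h -> computable2 g -> computable2 h.
Proof. by move=> gh [r rP]; exists r => x y; rewrite -gh. Qed.

Lemma computable2_add : computable2 addn.
Proof.
apply: (@computable2_ext (fun x y => iter x (fun z => z.+1) y)).
  by move=> x y; elim: x => //= x ->.
apply: (@computable2_rec id (fun z _ => z.+1)); first exact: computable1_id.
exists (Comp Succ [:: Proj 0]) => z y; apply: (eval_comp (w := [:: z])).
  by apply: evals_cons; [exact: (eval_proj 0 [:: z; y]) | exact: evals_nil].
exact: eval_succ.
Qed.

Lemma computable2_mul : computable2 muln.
Proof.
apply: (@computable2_ext (fun x y => iter x (fun z => z + y) 0)).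
  by move=> x y; elim: x => //= x ->; rewrite mulSn addnC.
exact: (computable2_rec (computable1_const 0) computable2_add).
Qed.

Lemma computable1_add f g : computable1 f -> computable1 g ->
  computable1 (fun x => f x + g x).
Proof. exact: computable1_comp2 computable2_add. Qed.

Lemma computable1_mul f g : computable1 f -> computable1 g ->
  computable1 (fun x => f x * g x).
Proof. exact: computable1_comp2 computable2_mul. Qed.

Lemma computable1_succ f : computable1 f -> computable1 (fun x => (f x).+1).
Proof.
move=> cf; have := computable1_add (computable1_const 1) cf.
by rewrite (_ : (fun x => 1 + f x) = fun x => (f x).+1).
Qed.

Lemma computable1_exp f g : computable1 f -> computable1 g ->
  computable1 (fun x => f x ^ g x).
Proof.
move=> cf cg; have pow : computable2 (fun y x => x ^ y).
  apply: (@computable2_ext (fun y x => iter y (fun z => z * x) 1)).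
    by move=> y x; elim: y => //= y ->; rewrite expnSr.
  exact: (computable2_rec (computable1_const 1) computable2_mul).
exact: (computable1_comp2 pow cg cf).
Qed.

Lemma computable_pickle (T : countType) f : computable1 f ->
  computable (fun x : T => f (pickle x)).
Proof. by move=> [r rP]; exists r => x; exact: rP. Qed.

End Computability.

(** * A code bounds its contents *)

Section PickleBounds.
Local Open Scope nat_scope.

Lemma leq_pickle_mem (T : countType) (s : seq T) x :
  x \in s -> pickle x < pickle s.
Proof.
move=> xs; have /allP := CodeSeq.ltn_code [seq pickle y | y <- s].
by apply; exact: map_f.
Qed.

Lemma leq_pickle_size (T : countType) (s : seq T) : size s <= pickle s.
Proof.
rewrite -(size_map pickle); change (pickle s) with (CodeSeq.code (map pickle s)).
elim: (map _ _) => //= n t IH; apply: (leq_ltn_trans IH).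
apply: leq_trans (leq_pmull _ (expn_gt0 2 n)).
by rewrite ltnS -addnn leq_addr.
Qed.

Lemma leq_pickle_fst (S T : countType) (x : S * T) : pickle x.1 < pickle x.
Proof.
case: x => x y /=.
have /allP := CodeSeq.ltn_code [:: pickle x; pickle y].
by apply; rewrite inE eqxx.
Qed.

Lemma leq_pickle_snd (S T : countType) (x : S * T) : pickle x.2 < pickle x.
Proof.
case: x => x y /=.
have /allP := CodeSeq.ltn_code [:: pickle x; pickle y].
by apply; rewrite !inE eqxx orbT.
Qed.

(* Integers are coded by way of [nat + nat], hence of pairs of options. *)
Lemma leq_pickle_int (z : int) : absz z <= pickle z.
Proof.
have lt1 n : n < CodeSeq.code [:: n].
  by have /allP := CodeSeq.ltn_code [:: n]; apply; rewrite inE eqxx.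
have lt2 n s k : n \in s -> n = CodeSeq.code [:: k] -> k < CodeSeq.code s.
  move=> ns nk; apply: (ltn_trans (lt1 k)); rewrite -nk.
  by have /allP := CodeSeq.ltn_code s; apply.
case: z => n /=.
  by apply/ltnW/(lt2 (CodeSeq.code [:: n]) [:: CodeSeq.code [:: n]; 0]); [rewrite inE eqxx|].
by apply: (lt2 (CodeSeq.code [:: n]) [:: 0; CodeSeq.code [:: n]]); [rewrite !inE eqxx orbT|].
Qed.

End PickleBounds.

(** * The sum of the absolute values of the coefficients *)

Section PolyNorm.

Definition l1norm (p : {poly int}) : int := \sum_(i < size p) `|p`_i|.

Lemma l1norm_wide n (p : {poly int}) :
  (size p <= n)%N -> l1norm p = \sum_(i < n) `|p`_i|.
Proof.
move=> pn; rewrite /l1norm (big_ord_widen n (fun i => `|p`_i|)) // big_mkcond /=.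
by apply: eq_bigr => i _; case: ltnP => // ip; rewrite nth_default ?normr0.
Qed.

Lemma l1norm_ge0 p : 0 <= l1norm p.
Proof. exact: sumr_ge0. Qed.

Lemma l1normD p q : l1norm (p + q) <= l1norm p + l1norm q.
Proof.
pose n := maxn (size p) (size q).
rewrite (@l1norm_wide n) ?size_polyD // (@l1norm_wide n p) ?leq_maxl //.
rewrite (@l1norm_wide n q) ?leq_maxr // -big_split /=.
by apply: ler_sum => i _; rewrite coefD ler_normD.
Qed.

Lemma l1norm_cons p c : l1norm (p * 'X + c%:P) = l1norm p + `|c|.
Proof.
rewrite (@l1norm_wide (size p).+1); last first.
  by rewrite size_MXaddC; case: ifP => // /andP[/eqP-> _].
rewrite big_ord_recl coefD coefMX coefC eqxx add0r addrC; congr (_ + _).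
by apply: eq_bigr => i _; rewrite coefD coefMX coefC /= addr0.
Qed.

Lemma l1normMX p : l1norm (p * 'X) = l1norm p.
Proof. by rewrite -[p * 'X]addr0 -(polyC0) l1norm_cons normr0 addr0. Qed.

Lemma l1normC c : l1norm c%:P = `|c|.
Proof.
by rewrite -[c%:P]add0r -(mul0r 'X) l1norm_cons /l1norm size_poly0 big_ord0 add0r.
Qed.

Lemma l1normZ c p : l1norm (c%:P * p) = `|c| * l1norm p.
Proof.
rewrite (@l1norm_wide (size p)); last first.
  by rewrite mul_polyC; exact: size_scale_leq.
by rewrite mulr_sumr; apply: eq_bigr => i _; rewrite coefCM normrM.
Qed.

Lemma l1normM p q : l1norm (p * q) <= l1norm p * l1norm q.
Proof.
elim/poly_ind: p => [|p c IH].
  by rewrite !mul0r /l1norm size_poly0 big_ord0 mul0r.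
rewrite mulrDl -mulrA ['X * q]mulrC mulrA (le_trans (l1normD _ _)) //.
by rewrite l1normMX l1normZ l1norm_cons mulrDl lerD2r.
Qed.

Lemma l1normX : l1norm 'X = 1.
Proof. by rewrite -['X]mul1r l1normMX l1normC. Qed.

Lemma l1norm_prod (I : Type) (r : seq I) (F : I -> {poly int}) b :
  0 <= b -> (forall i, l1norm (F i) <= b) ->
  l1norm (\prod_(i <- r) F i) <= b ^+ size r.
Proof.
move=> b0 Fb; elim: r => [|i r IH]; first by rewrite big_nil l1normC normr1.
rewrite big_cons exprS (le_trans (l1normM _ _)) // ler_pM ?l1norm_ge0 //.
Qed.

Lemma l1norm_sum (I : Type) (r : seq I) (P : pred I) (F : I -> {poly int}) :
  l1norm (\sum_(i <- r | P i) F i) <= \sum_(i <- r | P i) l1norm (F i).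
Proof.
elim/big_ind2: _ => [|x1 x2 y1 y2 h1 h2|//].
  by rewrite /l1norm size_poly0 big_ord0.
exact: le_trans (l1normD _ _) (lerD h1 h2).
Qed.

(** The norm is submultiplicative, and the determinant is a sum of products of
    entries of norm at most [b + 1]. *)
Lemma l1norm_char_poly n (A : 'M[int]_n) b :
  (forall i j, `|A i j| <= b) -> l1norm (char_poly A) <= n`!%:R * (b + 1) ^+ n.
Proof.
move=> Ab; rewrite /char_poly /determinant.
have cS k : #|[pred s : 'S_k | true]| = k`! by rewrite -card_Sn; apply: eq_card.
apply: le_trans (l1norm_sum _ _ _) _.
case: n A Ab => [|n] A Ab.
  rewrite (eq_bigr (fun=> 1)) ?sumr_const ?cS ?fact0 ?mulr1 //.
  by move=> s _; rewrite big_ord0 mulr1 -(rmorph_sign polyC) l1normC normrX normrN1 expr1n.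
have b0 : 0 <= b := le_trans (normr_ge0 _) (Ab ord0 ord0).
have -> : n.+1`!%:R * (b + 1) ^+ n.+1 = \sum_(s : 'S_n.+1) (b + 1) ^+ n.+1 :> int.
  by rewrite sumr_const cS mulr_natl.
apply: ler_sum => s _; rewrite -(rmorph_sign polyC) l1normZ normrX normrN1.
rewrite expr1n mul1r.
have -> : (b + 1) ^+ n.+1 = (b + 1) ^+ size (index_enum 'I_n.+1).
  by rewrite /index_enum -enumT size_enum_ord.
apply: l1norm_prod => [|i]; first exact: addr_ge0.
rewrite !mxE; apply: le_trans (l1normD _ _) _; rewrite -polyCN l1normC normrN addrC.
apply: lerD; first exact: Ab.
case: eqP => _; first by rewrite mulr1n l1normX.
by rewrite mulr0n /l1norm size_poly0 big_ord0.
Qed.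

End PolyNorm.

(** * Eigenvalues of integer matrices are not small *)

Section IntegerEigenvalue.
Variable R : realType.

Lemma horner_le_l1norm (p : {poly int}) (z : R) : `|z| <= 1 ->
  `|(map_poly intr p).[z]| <= (l1norm p)%:~R.
Proof.
move=> z1; elim/poly_ind: p => [|p c IH].
  by rewrite rmorph0 horner0 normr0 /l1norm size_poly0 big_ord0.
rewrite rmorphD rmorphM /= map_polyX map_polyC !hornerE l1norm_cons rmorphD /=.
rewrite (le_trans (ler_normD _ _)) // normrM intr_norm lerD2r.
by rewrite (le_trans _ IH) // ler_piMr.
Qed.

(** After division by a power of [X] the constant term of [p] is a nonzero
    integer, and [p.[z] = 0] makes it [z] times a number at most [l1norm p]. *)
Lemma root_lower_bound (p : {poly int}) (z : R) : p != 0 -> z != 0 ->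
  root (map_poly intr p) z -> 1 <= (l1norm p)%:~R * `|z| \/ 1 < `|z|.
Proof.
move=> p0 z0; case: (leP `|z| 1) => [z1|]; last by right.
move=> pz; left; elim/poly_ind: p p0 pz => [|p c IH]; first by rewrite eqxx.
have [-> |c0] := eqVneq c 0.
  rewrite addr0 mulf_eq0 negb_or => /andP[p0 _].
  rewrite rmorphM /= map_polyX rootM => /orP[pz|]; last first.
    by rewrite rootX => /eqP zz; rewrite zz eqxx in z0.
  by rewrite l1normMX; exact: IH.
move=> _; rewrite rmorphD rmorphM /= map_polyX map_polyC /root !hornerE.
rewrite addr_eq0 => /eqP E; rewrite l1norm_cons.
have c1 : 1 <= `|c%:~R| :> R.
  by rewrite -intr_norm -[1]/(1%:~R) ler_int -gtz0_ge1 normr_gt0.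
have : 1 <= (l1norm p)%:~R * `|z|.
  rewrite (le_trans c1) // -normrN -E normrM ler_wpM2r //.
  exact: horner_le_l1norm.
move=> /le_trans; apply; rewrite ler_wpM2r // ler_int lerDl //.
Qed.

Lemma eigenvalue_lower_bound (I : finType) (M : I -> I -> int) (v : I -> R)
    (z : R) (b : nat) e0 :
  v e0 != 0 -> z != 0 -> (forall e e', `|M e e'| <= b%:R) ->
  (forall e, \sum_e' (M e e')%:~R * v e' = z * v e) ->
  1 <= `|z| * ((#|I|)`! * b.+1 ^ #|I|)%:R.
Proof.
move=> v0 z0 Mb Mv; pose A : 'M[int]_#|I| := \matrix_(i, j) M (enum_val j) (enum_val i).
have Ab i j : `|A i j| <= b%:R by rewrite mxE.
have rz : root (map_poly intr (char_poly A)) z.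
  rewrite map_char_poly -eigenvalue_root_char; apply/eigenvalueP.
  exists (\row_i v (enum_val i)); last first.
    apply/eqP => /rowP/(_ (enum_rank e0)); rewrite !mxE enum_rankK => v00.
    by rewrite v00 eqxx in v0.
  apply/rowP => j; rewrite !mxE -Mv (reindex (@enum_val I I)) /=; last first.
    by apply: onW_bij; exact: enum_val_bij.
  by apply: eq_bigr => i _; rewrite !mxE mulrC.
have c0 : char_poly A != 0 by rewrite monic_neq0 ?char_poly_monic.
have := l1norm_char_poly Ab.
have -> : (#|I|)`!%:R * (b%:R + 1) ^+ #|I| = ((#|I|)`! * b.+1 ^ #|I|)%:R :> int.
  by rewrite natrM natrX -[b.+1]addn1 natrD.
set B := (_ * _)%N => lB; have lB' : (l1norm (char_poly A))%:~R <= B%:R :> R.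
  by rewrite pmulrn -natz ler_int.
have [h|h] := root_lower_bound c0 z0 rz.
  by rewrite (le_trans h) // mulrC ler_wpM2l.
rewrite (le_trans (ltW h)) // ler_peMr // ler1n muln_gt0 fact_gt0 /=.
by rewrite expn_gt0.
Qed.

End IntegerEigenvalue.

(** * A Liouville bound *)

(** For [c] generators that are roots of integer polynomials of degree at most
    [d] and height at most [h]: the entries of the matrix of a combination of
    height 1, and the resulting factor in the lower bound. The three summands
    belong to the constant, linear and quadratic terms. *)
Definition liouville_entry (c d h : nat) : nat :=
  (h ^ c * h ^ c + c * (h ^ c * (d.+1 * (h ^ c * h)))
  + c * (d.+1 ^ c * (d.+1 * (h ^ c * h) * (d.+1 * (h ^ c * h)))))%N.
Definition liouville_const (c d h : nat) : nat :=
  (h ^ c * h ^ c * ((d.+1 ^ c)`! * (liouville_entry c d h).+1 ^ (d.+1 ^ c)))%N.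

Section Monomials.
Variables (R : realType) (G : finType) (x : G -> R) (q : G -> {poly int}).
Variables (d h : nat).
Hypothesis q_neq0 : forall g, q g != 0.
Hypothesis q_root : forall g, root (map_poly intr (q g)) (x g).
Hypothesis q_size : forall g, (size (q g) <= d.+1)%N.
Hypothesis q_coef : forall g i, `|(q g)`_i| <= h%:R.

Definition lead_prod : int := \prod_g lead_coef (q g).

Lemma lead_prod_neq0 : lead_prod != 0.
Proof. by apply/prodf_neq0 => g _; rewrite lead_coef_eq0. Qed.

Lemma prod_lead_le (P : pred G) :
  (forall g : G, (0 < h)%N) ->
  `|\prod_(g | P g) lead_coef (q g)| <= (h ^ #|G|)%:R :> int.
Proof.
move=> h0; rewrite normr_prod (@le_trans _ _ (\prod_(g | P g) h%:R)) //.
  by apply: ler_prod => g _; rewrite normr_ge0 q_coef.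
rewrite prodr_const -natrX ler_nat.
case: (pickP (mem G)) => [g _|G0]; last first.
  by rewrite (eq_card0 (A := P)) ?eq_card0 // => g; have := G0 g.
by rewrite leq_pexp2l ?h0 ?max_card.
Qed.

Lemma height_gt0 (g : G) : (0 < h)%N.
Proof.
have := q_coef g (size (q g)).-1; rewrite -lead_coefE.
case: h => // /(le_trans _) H; have := lead_coef_eq0 (q g).
by rewrite (negPf (q_neq0 g)) -normr_le0 => /negbT/negP[]; exact: H.
Qed.

(** Only the top power is reduced, by the equation of [x g]. The leading
    coefficients of all generators serve as a common denominator, so that one
    factor makes every coefficient an integer. *)
Lemma power_reduction g (k : 'I_d.+1) : exists a : 'I_d.+1 -> int,
  (forall j, `|a j| <= (h ^ #|G| * h)%:R) /\
  lead_prod%:~R * x g ^+ k.+1 = \sum_j (a j)%:~R * x g ^+ j.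
Proof.
have h0 := height_gt0.
have [kd|kd] := ltnP k d.
  have kd' : (k.+1 < d.+1)%N by [].
  exists (fun j => if j == Ordinal kd' then lead_prod else 0); split.
    move=> j; case: ifP => _; last by rewrite normr0 ler0n.
    rewrite (le_trans (prod_lead_le _ h0)) // ler_nat leq_pmulr //; exact: h0.
  rewrite (bigD1 (Ordinal kd')) //= eqxx big1 ?addr0 // => j /negPf ->.
  by rewrite mul0r.
have {}kd : k = d :> nat by apply/eqP; rewrite eqn_leq kd -ltnS ltn_ord.
(* The power of the variable that raises the degree to [d + 1]. *)
pose n := (d.+2 - size (q g))%N; pose r := 'X^n * q g.
have nE : (d.+1 = n + (size (q g)).-1)%N.
  have := q_size g; have := q_neq0 g; rewrite -size_poly_gt0 /n; lia.
have rx : \sum_(i < d.+2) (r`_i)%:~R * x g ^+ i = 0.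
  have /rootP : root (map_poly intr r) (x g).
    by rewrite rmorphM rootM q_root orbT.
  rewrite (@horner_coef_wide _ d.+2); last first.
    apply: leq_trans (size_poly _ _) _.
    apply: leq_trans (size_polyMleq _ _) _; rewrite size_polyXn nE /=.
    by rewrite -addnS prednK ?size_poly_gt0.
  by move=> E; rewrite -[RHS]E; apply: eq_bigr => i _; rewrite coef_map_id0.
have rd : r`_d.+1 = lead_coef (q g).
  by rewrite coefXnM nE ltnNge leq_addr /= addKn lead_coefE.
pose D := \prod_(g' | g' != g) lead_coef (q g').
have DE : lead_prod = D * lead_coef (q g) by rewrite mulrC /lead_prod (bigD1 g).
exists (fun j => - (D * r`_j)); split.
  move=> j; rewrite normrN normrM natrM ler_pM ?prod_lead_le //.
  by rewrite coefXnM; case: ifP => _; rewrite ?normr0 ?ler0n ?q_coef.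
move/eqP: rx; rewrite big_ord_recr /= rd addrC addr_eq0 kd => /eqP E.
rewrite DE rmorphM -mulrA E mulrN mulr_sumr -sumrN; apply: eq_bigr => j _.
by rewrite rmorphN rmorphM !mulrA mulNr.
Qed.

Definition exponents := {ffun G -> 'I_d.+1}.
Definition monomial (e : exponents) : R := \prod_g x g ^+ e g.

(** [z] is an eigenvalue of an integer matrix, with the vector of all
    monomials, independent of [z], as the eigenvector: such numbers can be
    added and multiplied. *)
Definition acts (S : nat) (z : R) := exists M : exponents -> exponents -> int,
  (forall e e', `|M e e'| <= S%:R) /\
  forall e, \sum_e' (M e e')%:~R * monomial e' = z * monomial e.

Lemma actsD S S' z z' : acts S z -> acts S' z' -> acts (S + S') (z + z').
Proof.
move=> [M [Ms MP]] [M' [Ms' MP']]; exists (fun e e' => M e e' + M' e e'); split.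
  by move=> e e'; rewrite natrD (le_trans (ler_normD _ _)) // lerD.
move=> e; rewrite mulrDl -MP -MP' -big_split /=; apply: eq_bigr => e' _.
by rewrite rmorphD mulrDl.
Qed.

Lemma actsM S S' z z' : acts S z -> acts S' z' ->
  acts (#|{: exponents}| * (S * S')) (z * z').
Proof.
move=> [M [Ms MP]] [M' [Ms' MP']].
exists (fun e e' => \sum_f M e f * M' f e'); split.
  move=> e e'; rewrite (le_trans (ler_norm_sum _ _ _)) //.
  rewrite [(_ * (S * S'))%:R]natrM mulr_natl -sumr_const.
  apply: ler_sum => f _.
  by rewrite normrM natrM ler_pM.
move=> e; under eq_bigr => e' _ do rewrite rmorph_sum mulr_suml.
rewrite exchange_big /= [z * z']mulrC -mulrA -MP mulr_sumr; apply: eq_bigr => f _.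
rewrite mulrCA -MP' mulr_sumr; apply: eq_bigr => e' _.
by rewrite rmorphM mulrA.
Qed.

Lemma acts_int (k : int) (S : nat) : `|k| <= S%:R -> acts S k%:~R.
Proof.
move=> kS; exists (fun e e' => if e' == e then k else 0); split.
  by move=> e e'; case: ifP => _ //; rewrite normr0 ler0n.
move=> e; rewrite (bigD1 e) //= eqxx big1 ?addr0 // => e' /negPf ->.
by rewrite mul0r.
Qed.

Lemma actsZ (k : int) (N S : nat) z : `|k| <= N%:R -> acts S z ->
  acts (N * S) (k%:~R * z).
Proof.
move=> kN [M [Ms MP]]; exists (fun e e' => k * M e e'); split.
  by move=> e e'; rewrite normrM natrM ler_pM.
move=> e; rewrite -mulrA -MP mulr_sumr; apply: eq_bigr => e' _.
by rewrite rmorphM mulrA.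
Qed.

Lemma acts_sum (I : finType) (F : I -> R) S :
  (forall i, acts S (F i)) -> acts (#|I| * S) (\sum_i F i).
Proof.
move=> FS; suff H (r : seq I) : acts (size r * S) (\sum_(i <- r) F i).
  by have := H (index_enum I); rewrite /index_enum -enumT -cardE.
elim: r => [|i r IH]; first by rewrite big_nil; apply: (@acts_int 0); rewrite normr0.
by rewrite big_cons mulSn; apply: actsD.
Qed.

Lemma acts_generator g : acts (d.+1 * (h ^ #|G| * h)) (lead_prod%:~R * x g).
Proof.
have /choice [a aP] := @power_reduction g.
(* Multiplication by [x g] touches the exponent of [g] only. *)
pose upd (e : exponents) j : exponents := [ffun g' => if g' == g then j else e g'].
exists (fun e e' => \sum_j (if e' == upd e j then a (e g) j else 0)); split.
  move=> e e'; rewrite (le_trans (ler_norm_sum _ _ _)) // natrM.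
  rewrite mulr_natl -[X in _ *+ X]card_ord -sumr_const; apply: ler_sum => j _.
  by case: ifP => _; rewrite ?normr0 ?ler0n //; have [] := aP (e g).
move=> e; under eq_bigr => e' _ do rewrite rmorph_sum mulr_suml.
rewrite exchange_big /=.
have mE f : monomial f = x g ^+ f g * \prod_(g' | g' != g) x g' ^+ f g'.
  by rewrite /monomial (bigD1 g).
rewrite mE mulrA -[_ * _ * x g ^+ _]mulrA -exprS; have [_ ->] := aP (e g).
rewrite mulr_suml; apply: eq_bigr => j _.
rewrite (bigD1 (upd e j)) //= eqxx big1 ?addr0; last first.
  by move=> e' /negPf ->; rewrite mul0r.
rewrite mE ffunE eqxx mulrA; congr (_ * _); apply: eq_bigr => g' /negPf g'g.
by rewrite ffunE g'g.
Qed.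

Variable a : G.

(** The form of every transverse coordinate below: [a] stands for the slope,
    which multiplies abscissas, so that terms of degree 2 suffice. [H] is the
    height, and [N] a common denominator. *)
Definition bounded_comb (N H : nat) (z : R) := exists (k : int) (n m : G -> int),
  [/\ `|k| <= H%:R, (forall g, `|n g| <= H%:R), (forall g, `|m g| <= H%:R) &
     N%:R * z = k%:~R + \sum_g (n g)%:~R * x g + x a * \sum_g (m g)%:~R * x g].

(** Each generator carries the factor [lead_prod]; the quadratic terms need
    two. *)
Lemma acts_comb N H z : bounded_comb N H z ->
  acts (H * liouville_entry #|G| d h) (lead_prod%:~R ^+ 2 * (N%:R * z)).
Proof.
move=> [k [n [m [kH nH mH ->]]]].
have denB : `|lead_prod| <= (h ^ #|G|)%:R.
  by apply: prod_lead_le; exact: height_gt0.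
set B := (h ^ #|G|)%N in denB.
rewrite !mulrDr /liouville_entry 2!mulnDr; apply: actsD; first apply: actsD.
- rewrite -[_ ^+ 2]rmorphXn -rmorphM /=; apply: acts_int.
  rewrite normrM normrX mulrC [(H * _)%:R]natrM ler_pM ?exprn_ge0 //.
  by rewrite expr2 natrM ler_pM.
- rewrite expr2 -mulrA mulr_sumr mulr_sumr mulnCA; apply: acts_sum => g.
  rewrite -[_ * (_ * (_ * _))](_ : (n g * lead_prod)%:~R * (lead_prod%:~R * x g) = _).
    rewrite mulnA; apply: actsZ; last exact: acts_generator.
    by rewrite normrM natrM ler_pM.
  by rewrite rmorphM /=; ring.
- rewrite mulrA mulr_sumr mulnCA; apply: acts_sum => g.
  rewrite -[_ * (_ * _)](_ : (m g)%:~R *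
      ((lead_prod%:~R * x a) * (lead_prod%:~R * x g)) = _); last by ring.
  apply: actsZ; first exact: mH.
  have -> : (d.+1 ^ #|G|)%N = #|{: exponents}| by rewrite card_ffun card_ord.
  by apply: actsM; exact: acts_generator.
Qed.

(** The numbers of height [H] are eigenvalues of integer matrices of fixed
    size with entries [O(H)], and the lowest nonzero coefficient of the
    characteristic polynomial is an integer. *)
Lemma liouville N H z : (0 < N)%N -> (0 < H)%N -> bounded_comb N H z -> z != 0 ->
  1 <= `|z| * (N * liouville_const #|G| d h * H ^ (d.+1 ^ #|G|))%:R.
Proof.
move=> N0 H0 /acts_comb [M [Mb MP]] z0.
pose e0 : exponents := [ffun=> ord0].
have v0 : monomial e0 != 0.
  by rewrite /monomial big1 ?oner_eq0 // => g _; rewrite ffunE expr0.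
have den0 := lead_prod_neq0.
have denB : `|lead_prod| <= (h ^ #|G|)%:R.
  by apply: prod_lead_le; exact: height_gt0.
have t0 : lead_prod%:~R ^+ 2 * (N%:R * z) != 0.
  by rewrite !mulf_neq0 ?expf_neq0 ?intr_eq0 ?pnatr_eq0 -?lt0n.
have := eigenvalue_lower_bound v0 t0 Mb MP.
move=> /le_trans; apply.
have -> : #|{: exponents}| = (d.+1 ^ #|G|)%N by rewrite card_ffun card_ord.
rewrite /liouville_const.
set D := (d.+1 ^ #|G|)%N; set B := (h ^ #|G|)%N in denB *.
set e := liouville_entry _ _ _.
have denB1 : `|lead_prod|%:~R <= B%:R :> R by rewrite pmulrn -natz ler_int.
have denB2 : `|lead_prod%:~R ^+ 2| <= (B * B)%:R :> R.
  by rewrite normrX expr2 natrM -intr_norm ler_pM ?ler0z.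
have HeD : (D`! * (H * e).+1 ^ D <= D`! * e.+1 ^ D * H ^ D)%N.
  rewrite -mulnA leq_mul2l -expnMn leq_exp2r ?expn_gt0 //; apply/orP; right.
  by rewrite mulSn mulnC -add1n leq_add2r.
rewrite (normrM (_ ^+ 2)) (normrM N%:R) normr_nat.
rewrite (_ : (N * _ * _)%:R = N%:R * (B * B)%:R * (D`! * e.+1 ^ D * H ^ D)%:R); last first.
  by rewrite -!natrM; congr (_%:R); rewrite !mulnA.
have : `|lead_prod%:~R ^+ 2| * (D`! * (H * e).+1 ^ D)%:R <=
    (B * B)%:R * (D`! * e.+1 ^ D * H ^ D)%:R :> R by rewrite ler_pM // ler_nat.
move: (D`! * (H * e).+1 ^ D)%N (D`! * e.+1 ^ D * H ^ D)%N => F1 F2 le12; rewrite mulrAC [leLHS]mulrC.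
rewrite (_ : `|z| * _ = N%:R * `|z| * ((B * B)%:R * F2%:R)); last by ring.
by rewrite ler_wpM2l ?mulr_ge0.
Qed.

End Monomials.

(** * Extreme points of separated sets *)

Section SeparatedSets.
Variable R : realType.

Lemma separated_max (S : set R) (k y x0 : R) : 0 < k -> S x0 ->
  (forall x, S x -> x <= y) ->
  (forall x x', S x -> S x' -> x != x' -> k <= `|x - x'|) ->
  exists2 m, S m & forall x, S x -> x <= m.
Proof.
move=> k0 Sx0 Sy Sk; have Ssup : has_sup S by split; [exists x0|exists y].
have [m Sm msup] := sup_adherent k0 Ssup; exists m => // x Sx.
rewrite leNgt; apply/negP => mx.
have := Sk _ _ Sx Sm; rewrite gt_eqF // gtr0_norm ?subr_gt0 // => /(_ isT).
have := ub_le_sup (proj2 Ssup) Sx; lra.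
Qed.

Lemma separated_min (S : set R) (k y x0 : R) : 0 < k -> S x0 ->
  (forall x, S x -> y <= x) ->
  (forall x x', S x -> S x' -> x != x' -> k <= `|x - x'|) ->
  exists2 m, S m & forall x, S x -> m <= x.
Proof.
move=> k0 Sx0 Sy Sk.
have [|x /= /Sy|x x' /= Sx Sx' xx'|m /= Sm mS] :=
    @separated_max [set x | S (- x)] k (- y) (- x0) k0.
- by rewrite /= opprK.
- by rewrite lerNr.
- by have := Sk _ _ Sx Sx'; rewrite eqr_opp xx' -opprD normrN; apply.
- by exists (- m) => // x Sx; rewrite lerNl; apply: mS; rewrite /= opprK.
Qed.

End SeparatedSets.

(** * Return times of an interval exchange *)

Section Strips.
Variables (R : realType) (I : finType).
Variables (dom : I -> R -> Prop) (conn : I -> I -> R -> Prop).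
Variables (d : I -> I -> R) (C : seq R) (X : R).

(** [conn i j w] means that the point [w] of the interval [i] moves to the
    interval [j], by the translation [d i j]; the discontinuities have
    coordinates in [C]. The map may be undefined at these points. *)
Hypothesis conn_uniform : forall i a b w0, a < w0 < b ->
  (forall w, a < w < b -> w \notin C) -> dom i w0 ->
  exists j, forall w, a < w < b -> conn i j w.
Hypothesis conn_dom : forall i j w, conn i j w -> dom j (w + d i j).
Hypothesis conn_inj : forall i i' j w w', conn i j w -> conn i' j w' ->
  w + d i j = w' + d i' j -> i = i' /\ w = w'.
Hypothesis dom_bound : forall i w, dom i w -> `|w| <= X.

Variables (i0 : I) (a b : R).
Hypothesis ab : a < b.
Hypothesis J_dom : forall w, a < w < b -> dom i0 w.

Definition inJ (j : I) (w : R) := j = i0 /\ a < w < b.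

(** Walks start at [w] in [J] and do not come back to [J]; [t] is the sum of
    the translations so far. *)
Fixpoint walk (k : nat) (w : R) (j : I) (t : R) : Prop :=
  if k is k'.+1 then exists j' t', [/\ walk k' w j' t', conn j' j (w + t'),
    t = t' + d j' j & ~ inJ j (w + t)]
  else j = i0 /\ t = 0.

Definition returns (k : nat) (w : R) := exists j t, [/\ walk k w j t,
  conn j i0 (w + t) & a < w + t + d j i0 < b].

(** Contains the translation parts of all walks, and is defined without the
    dynamics: the heights of its members are bounded by arithmetic alone. *)
Fixpoint displacement (k : nat) (t : R) : Prop :=
  if k is k'.+1 then exists t' i j, displacement k' t' /\ t = t' + d i j
  else t = 0.

Lemma walk_displacement k w j t : walk k w j t -> displacement k t.
Proof.
elim: k j t => [|k IH] j t /=; first by case.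
by move=> [j' [t' [/IH dt' _ -> _]]]; exists t', j', j.
Qed.

(** The states at which the orbits of neighbouring points part: at a
    discontinuity, or at an end of [J], where some return and others do not. *)
Definition special (j : I) (e : R) := e \in C \/ (j = i0 /\ (e = a \/ e = b)).
Definition mark k w j t := walk k w j t /\ special j (w + t).
(** The starting points that can be marked within [T] steps, again without the
    dynamics; the ends of [J] are added so that the marks next to a point of
    [J] bound a strip in [J]. *)
Definition mark_place (T : nat) : set R := [set x | x = a \/ x = b \/
  exists k t e, [/\ (k <= T)%N, displacement k t,
    e \in C \/ e = a \/ e = b & x = e - t]].

Lemma mark_mark_place k T w j t : (k <= T)%N -> mark k w j t -> mark_place T w.
Proof.
move=> kT [wk sp]; right; right; exists k, t, (w + t); split => //.
- exact: walk_displacement wk.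
- by case: sp => [|[_]]; tauto.
- by rewrite addrK.
Qed.

Lemma walk_back r k w w' j t t' : walk k w j t -> walk (r + k) w' j t' ->
  w + t = w' + t' -> walk r w' i0 (w - w').
Proof.
elim: k j t t' => [|k IH] j t t' /=.
  move=> [-> ->]; rewrite addn0 => H; rewrite addr0 => E.
  by rewrite (_ : w - w' = t') // E addrC addKr.
rewrite addnS /= => -[j1 [t1 [wk1 cn1 -> _]]] [j2 [t2 [wk2 cn2 -> _]]] E.
have [ej ew] : j1 = j2 /\ w + t1 = w' + t2.
  by apply: (conn_inj cn1 cn2); rewrite -!addrA.
by rewrite -ej in wk2; exact: IH wk1 wk2 ew.
Qed.

(** If walks of different lengths met, the longer one, traced back from the
    meeting point along the shorter one, would have been in [J] after its
    start. *)
Lemma walk_time k k' w w' j t t' : a < w < b -> a < w' < b ->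
  walk k w j t -> walk k' w' j t' -> w + t = w' + t' -> k = k'.
Proof.
wlog kk' : k k' w w' t t' / (k <= k')%N => [H|].
  move=> wJ w'J wk wk' E; have [kk'|/ltnW k'k] := leqP k k'.
    exact: (H k k' w w' t t').
  by apply/esym; exact: (H k' k w' w t' t).
move=> wJ w'J wk; rewrite -(subnK kk') => wk' E.
have := walk_back wk wk' E; case: (k' - k)%N => [|r] //=.
by move=> [j' [t'' [_ _ _]]] []; split => //; rewrite addrC subrK.
Qed.

Lemma walk_strip k l r j t : (forall w, l < w < r -> walk k w j t) ->
  l < r -> (forall w, l < w < r -> dom i0 w) -> forall w, l < w < r -> dom j (w + t).
Proof.
move=> wk lr li w wlr; case: k wk => [|k] wk.
  by have [-> ->] := wk w wlr; rewrite addr0; exact: li.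
by have [j' [t' [_ /conn_dom H -> _]]] := wk w wlr; rewrite addrA.
Qed.

(** The marks next to [y] bound a strip of width at least [kappa], which moves
    as a whole until it returns: marks up to the time [T] are outside it,
    later ones are excluded by assumption. By [walk_time] its translates at
    different times are disjoint, and [|I|] intervals of length [2 * X] have
    no room for [T' + 1] of them. When the strip first meets [J] it lies in
    [J], since no point of it is mapped to an end of [J]. *)
Lemma strip_return T T' K kappa y : (T <= T')%N -> 0 < kappa ->
  (forall x x', mark_place T x -> mark_place T x' -> x != x' -> kappa <= `|x - x'|) ->
  (forall k w j t, a < w < b -> (T < k <= T')%N -> ~ mark k w j t) ->
  2 * X < K%:R * kappa -> (#|I| * K < T'.+1)%N ->
  a < y < b -> ~ mark_place T y -> exists2 k, (k < T')%N & returns k y.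
Proof.
move=> TT' kappa0 sep nomark XK IK yJ ny.
have [l [Ml ly lmax]] : exists l, [/\ mark_place T l, l < y &
    forall x, mark_place T x -> x < y -> x <= l].
  have [||x [_ /ltW]|x x' [mx _] [mx' _]|l [Ml ly] lmax] :=
    @separated_max R [set x | mark_place T x /\ x < y] kappa y a => //.
  - by split; [left|case/andP: yJ].
  - exact: sep.
  - by exists l; split => // x mx xy; apply: lmax.
have [r [Mr yr rmin]] : exists r, [/\ mark_place T r, y < r &
    forall x, mark_place T x -> y < x -> r <= x].
  have [||x [_ /ltW]|x x' [mx _] [mx' _]|l' [Ml' yl'] lmin] :=
    @separated_min R [set x | mark_place T x /\ y < x] kappa y b => //.
  - by split; [right; left|case/andP: yJ].
  - exact: sep.
  - by exists l'; split => // x mx xy; apply: lmin.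
have al : a <= l by apply: lmax; [left|case/andP: yJ].
have rb : r <= b by apply: rmin; [right; left|case/andP: yJ].
have lr : l < r := lt_trans ly yr.
have wide : kappa <= r - l.
  have := sep r l Mr Ml; rewrite gt_eqF // gtr0_norm ?subr_gt0 //; exact.
have lrJ w : l < w < r -> a < w < b.
  by move=> /andP[lw wr]; rewrite (le_lt_trans al lw) (lt_le_trans wr rb).
have ylr : l < y < r by rewrite ly yr.
have free k w j t : (k <= T')%N -> l < w < r -> ~ mark k w j t.
  move=> kT' wlr mk; have [kT|Tk] := leqP k T; last first.
    by apply: (nomark k w j t (lrJ _ wlr)) => //; rewrite Tk.
  have Mw := mark_mark_place kT mk; case: (ltgtP w y) => [wy|yw|wy].
  - by have := lmax _ Mw wy; case/andP: wlr; lra.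
  - by have := rmin _ Mw yw; case/andP: wlr; lra.
  - by rewrite -wy in ny.
have lrdom w : l < w < r -> dom i0 w by move=> /lrJ; exact: J_dom.
suff H k : (k <= T')%N -> (exists2 k', (k' < k)%N & returns k' y) \/
    exists j t, forall w, l < w < r -> walk k w j t.
  case: (pselect (exists2 k, (k < T')%N & returns k y)) => // nret; exfalso.
  have {}H (k : 'I_T'.+1) : {jt : I * R | forall w, l < w < r -> walk k w jt.1 jt.2}.
    apply: cid; case: (H k); first by rewrite -ltnS ltn_ord.
      move=> [k' k'k ret]; case: nret; exists k' => //.
      by rewrite (leq_trans k'k) // -ltnS ltn_ord.
    by move=> [j [t wk]]; exists (j, t).
  have midlr : l < (l + r) / 2 < r by apply/andP; split; lra.
  pose pos k := (l + r) / 2 + (projT1 (H k)).2.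
  have posX k : `|pos k| <= X.
    by apply: dom_bound; exact: walk_strip (projT2 (H k)) lr lrdom _ midlr.
  have pos0 k : 0 <= (pos k + X) / kappa.
    apply: divr_ge0; last exact: ltW.
    by have := posX k; rewrite ler_norml => H'; lras.
  (* Two translates whose midpoints share an interval and a cell of length
     [kappa] overlap. *)
  pose cell k : nat := Num.truncn ((pos k + X) / kappa).
  have cellK k : (cell k < K)%N.
    rewrite -(ltr_nat R); have /truncn_itv/andP[cle _] := pos0 k.
    rewrite (le_lt_trans cle) // ltr_pdivrMr //.
    by apply: le_lt_trans XK; have := posX k; rewrite ler_norml => H'; lras.
  pose f (k : 'I_T'.+1) : I * 'I_K := ((projT1 (H k)).1, Ordinal (cellK k)).
  have f_inj : injective f.
    move=> k k' [ej ecell]; apply: val_inj => /=.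
    pose t := (projT1 (H k)).2; pose t' := (projT1 (H k')).2.
    have near_t : `|t' - t| < r - l.
      apply: lt_le_trans wide.
      have /truncn_itv/andP[c1 c2] := pos0 k.
      have /truncn_itv/andP[c1' c2'] := pos0 k'.
      move: c1 c2 c1' c2'; rewrite -/(cell k) -/(cell k') ecell -natr1.
      rewrite ler_pdivlMr // ltr_pdivrMr // ler_pdivlMr // ltr_pdivrMr //.
      by rewrite /pos -/t -/t' !mulrDl mul1r ltr_norml => *; lras.
    move: near_t; rewrite ltr_norml => near_t.
    (* Two starting points whose translates coincide. *)
    pose w := (l + r) / 2 + (t' - t) / 2; pose w' := (l + r) / 2 - (t' - t) / 2.
    have wlr : l < w < r by rewrite /w; lras.
    have wlr' : l < w' < r by rewrite /w'; lras.
    have wk := projT2 (H k) w wlr; have wk' := projT2 (H k') w' wlr'.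
    move: wk; rewrite ej => wk.
    apply: (walk_time (lrJ _ wlr) (lrJ _ wlr') wk wk').
    by rewrite -/t -/t' /w /w'; field.
  have := leq_card f f_inj.
  by rewrite card_ord card_prod card_ord leqNgt IK.
elim: k => [|k IH] kT; first by right; exists i0, 0 => w _ /=.
case: IH => [|[k' k'k ret]|[j [t wk]]]; first exact: ltnW.
  by left; exists k' => //; exact: ltn_trans k'k _.
have jt w : l + t < w < r + t -> l < w - t < r by move=> ?; lras.
have [|||j' cn] := @conn_uniform j (l + t) (r + t) (y + t).
- by rewrite !ltrD2r.
- move=> w wlr; apply/negP => wC; apply: (free k (w - t) j t (ltnW kT)).
    exact: jt.
  by split; [exact/wk/jt|left; rewrite subrK].
- exact: walk_strip wk lr lrdom _ ylr.
have cn' w : l < w < r -> conn j j' (w + t) by move=> wlr; apply: cn; rewrite !ltrD2r.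
case: (pselect (exists2 w, l < w < r & inJ j' (w + (t + d j j')))).
  move=> [w wlr [ej' wJ]]; left; exists k => //; exists j, t; split.
  - exact: wk.
  - by rewrite -ej'; exact: cn'.
  - rewrite -ej' -addrA; set s := t + d j j' in wJ *.
    have noend e : e = a \/ e = b -> ~ (l < e - s < r).
      move=> eab elr; apply: (free k.+1 (e - s) j' s kT elr); split.
        exists j, t; split => //; [exact: wk|exact: cn'|].
        by rewrite subrK => -[_]; case: eab => ->; rewrite ltxx ?andbF.
      by right; split => //; rewrite subrK.
    have na := noend a (or_introl erefl); have nb := noend b (or_intror erefl).
    apply/andP; split.
      by rewrite ltNge; apply/negP => h; apply: na; lras.
    by rewrite ltNge; apply/negP => h; apply: nb; lras.
move=> nJ; right; exists j', (t + d j j') => w wlr; exists j, t; split => //.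
- exact: wk.
- exact: cn'.
- by move=> h; apply: nJ; exists w.
Qed.

(** By [walk_time] each of the [|I| * |C| + 2] special states is reached at
    one time at most, whatever the starting point; so one of the [Q + 1]
    consecutive time windows sees no mark, and the strip argument applies to
    it. *)
Lemma returns_bound (T : nat -> nat) (kappa : nat -> R) (K : nat -> nat) y :
  let Q := (#|I| * size C + 2)%N in
  (forall l, (T l < T l.+1)%N) -> (forall l, 0 < kappa l) ->
  (forall l x x', mark_place (T l) x -> mark_place (T l) x' -> x != x' ->
     kappa l <= `|x - x'|) ->
  (forall l, 2 * X < (K l)%:R * kappa l) -> (forall l, (#|I| * K l < (T l.+1).+1)%N) ->
  a < y < b -> (forall l, ~ mark_place (T l) y) ->
  exists2 k, (k < T Q.+1)%N & returns k y.
Proof.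
move=> Q Tlt kappa0 sep XK IK yJ ny.
have Tmono : {homo T : m n / (m <= n)%N}.
  by apply: (@homo_leq _ T leq) => [//|m n p|i]; [exact: leq_trans|exact: ltnW].
pose window l k := (T l < k <= T l.+1)%N.
case: (pselect (exists2 l, (l <= Q)%N & forall k w j t, a < w < b ->
    window l k -> ~ mark k w j t)).
  move=> [l lQ nomark].
  have [k kT ret] := strip_return (ltnW (Tlt l)) (kappa0 l) (sep l) nomark (XK l)
    (IK l) yJ (ny l).
  by exists k => //; apply: leq_trans kT (Tmono _ _ _).
move=> nl; exfalso.
pose Z := [seq (j, e) | j <- enum I, e <- C] ++ [:: (i0, a); (i0, b)].
have sZ : size Z = Q.
  by rewrite size_cat size_allpairs -cardE.
have ZP j e : special j e -> (j, e) \in Z.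
  rewrite mem_cat; case=> [eC|[-> [|] ->]]; last 2 first.
  - by rewrite !inE eqxx orbT.
  - by rewrite !inE eqxx !orbT.
  by apply/orP; left; apply/allpairsP; exists (j, e); rewrite mem_enum.
have {nl} H (l : 'I_Q.+1) : {x : nat * R * (I * R) |
    [/\ a < x.1.2 < b, window l x.1.1 & mark x.1.1 x.1.2 x.2.1 x.2.2]}.
  apply: cid; apply: contrapT => nx; apply: nl; exists l.
    by rewrite -ltnS ltn_ord.
  by move=> k w j t wJ win mk; apply: nx; exists ((k, w), (j, t)).
pose g (l : 'I_Q.+1) : I * R := let x := projT1 (H l) in (x.2.1, x.1.2 + x.2.2).
have gZ l : g l \in Z.
  by rewrite /g; case: (H l) => /= -[[k w] [j t]] /= [_ _ [_ /ZP]].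
have gi : injective (fun l => index (g l) Z).
  move=> l l' /(congr1 (nth (i0, a) Z)); rewrite !nth_index //.
  rewrite /g; case: (H l) => /= -[[k w] [j t]] /= [wJ win [wk _]].
  case: (H l') => /= -[[k' w'] [j' t']] /= [wJ' win' [wk' _]] [ej E].
  rewrite -ej in wk'; have ek := walk_time wJ wJ' wk wk' E.
  move: win win'; rewrite /window -ek => /andP[h1 h2] /andP[h3 h4].
  apply: val_inj => /=; apply/eqP; rewrite eqn_leq.
  by apply/andP; split; rewrite leqNgt; apply/negP => /Tmono; lia.
have gQ l : (index (g l) Z < Q)%N by rewrite -sZ index_mem.
have gi' : injective (fun l => Ordinal (gQ l)).
  by move=> l l' [] /gi.
by have := leq_card _ gi'; rewrite !card_ord ltnn.
Qed.

End Strips.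

(** * Boxes and small numbers *)

Section Plane.
Variable R : realType.
Implicit Types (p z : R * R) (A : set (R * R)).

Lemma interior_box A p : A° p <->
  exists2 e, 0 < e & forall z, `|z.1 - p.1| < e -> `|z.2 - p.2| < e -> A z.
Proof.
split=> [/nbhs_ballP [e /= e0 H]|[e e0 H]].
  by exists e => // z h1 h2; apply: H; split; rewrite /ball /= distrC.
by apply/nbhs_ballP; exists e => // z [/= h1 h2]; apply: H; rewrite distrC.
Qed.

Lemma interior_box_open A p : A° p ->
  exists2 e, 0 < e & forall z, `|z.1 - p.1| < e -> `|z.2 - p.2| < e -> A° z.
Proof.
move=> /interior_box [e e0 H]; exists (e / 2); first by lra.
move=> z h1 h2; apply/interior_box; exists (e / 2); first by lra.
move=> z' h1' h2'; apply: H.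
  by move: h1 h1'; rewrite !ltr_norml => *; lras.
by move: h2 h2'; rewrite !ltr_norml => *; lras.
Qed.

Lemma below2 (x y : R) : 0 < x -> 0 < y -> exists e, [/\ 0 < e, e <= x & e <= y].
Proof.
by move=> x0 y0; exists (Num.min x y); rewrite lt_min x0 y0 !ge_min !lexx orbT.
Qed.

Lemma below3 (x y z : R) : 0 < x -> 0 < y -> 0 < z ->
  exists e, [/\ 0 < e, e <= x, e <= y & e <= z].
Proof.
move=> x0 y0 z0; have [e [e0 ex ey]] := below2 x0 y0.
have [f [f0 fe fz]] := below2 e0 z0.
by exists f; split => //; exact: le_trans fe _.
Qed.

Lemma below4 (x y z t : R) : 0 < x -> 0 < y -> 0 < z -> 0 < t ->
  exists e, [/\ 0 < e, e <= x, e <= y, e <= z & e <= t].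
Proof.
move=> x0 y0 z0 t0; have [e [e0 ex ey ez]] := below3 x0 y0 z0.
have [f [f0 fe ft]] := below2 e0 t0.
by exists f; split => //; exact: le_trans fe _.
Qed.

Lemma finite_eps (I : finType) (Q : I -> R -> Prop) :
  (forall i, exists2 e, 0 < e & Q i e) ->
  (forall i e e', 0 < e' <= e -> Q i e -> Q i e') ->
  exists2 e, 0 < e & forall i, Q i e.
Proof.
move=> H Qmono; have /choice [f fP] : forall i, exists e, 0 < e /\ Q i e.
  by move=> i; have [e e0 Qe] := H i; exists e.
have f0 i : 0 < f i by case: (fP i).
pose e := \big[Num.min/1]_i f i.
have e0 : 0 < e by rewrite /e; elim/big_ind: _ => // x y x0 y0; rewrite lt_min x0.
by exists e => // i; apply: Qmono (proj2 (fP i)); rewrite e0 /e bigmin_le_cond.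
Qed.

Definition sg (b : bool) (x : R) := if b then x else - x.

Lemma sgK b (x : R) : sg b (sg b x) = x.
Proof. by case: b; rewrite /= ?opprK. Qed.

Lemma shiftE p q x y : shift p q x y = (p.1 + sg q.1 x, p.2 + sg q.2 y).
Proof. by []. Qed.

Lemma side_dichotomy (lo hi x : R) b : exists2 e, 0 < e &
  (forall r, 0 < r < e -> lo <= x + sg b r <= hi) \/
  (forall r, 0 < r < e -> ~ (lo <= x + sg b r <= hi)).
Proof.
case: b => /=.
  have [h|h] := ltP x lo.
    by exists (lo - x); [lra|right=> r r0 H; lras].
  have [h'|h'] := ltP x hi; first by exists (hi - x); [lra|left=> r r0; lras].
  by exists 1; [lra|right=> r r0 H; lras].
have [h|h] := ltP hi x.
  by exists (x - hi); [lra|right=> r r0 H; lras].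
have [h'|h'] := ltP lo x; first by exists (x - lo); [lra|left=> r r0; lras].
by exists 1; [lra|right=> r r0 H; lras].
Qed.

End Plane.

(** * Edges and corners of a polyrectangle *)

Section Region.
Variables (R : realType) (P : net R).
Hypothesis HP : polyrectangle_translation_surface P.
Let U := region P.
Implicit Types (p z u : R * R) (i j : 'I_(npairs P)).

Lemma region_rectangles : exists (m : nat) (r : 'I_m.+1 -> (R * R) * (R * R)),
  U = \bigcup_k rectangle (r k).
Proof. by case: HP => -[[m [r [_ _ UE]]] _] _ _ _ _; exists m, r. Qed.

(** Each of the finitely many rectangles contains the quadrant near [p] or
    misses it. *)
Lemma quadrant_dichotomy p q : exists2 e, 0 < e &
  (forall x y, 0 < x < e -> 0 < y < e -> U (shift p q x y)) \/
  (forall x y, 0 < x < e -> 0 < y < e -> ~ U (shift p q x y)).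
Proof.
have [m [r UE]] := region_rectangles.
pose Q k e := (forall x y, 0 < x < e -> 0 < y < e -> rectangle (r k) (shift p q x y)) \/
  (forall x y, 0 < x < e -> 0 < y < e -> ~ rectangle (r k) (shift p q x y)).
have [||e e0 He] := @finite_eps R _ Q.
- move=> k.
  have [e1 e10 H1] := side_dichotomy (r k).1.1 (r k).2.1 p.1 q.1.
  have [e2 e20 H2] := side_dichotomy (r k).1.2 (r k).2.2 p.2 q.2.
  have [e [e0 ee1 ee2]] := below2 e10 e20.
  have lt1 x : 0 < x < e -> 0 < x < e1 by move=> ?; lras.
  have lt2 x : 0 < x < e -> 0 < x < e2 by move=> ?; lras.
  exists e => //.
  rewrite /Q /rectangle /=.
  case: H1 => H1; last by right=> x y /lt1/H1 h _ [].
  case: H2 => H2; last by right=> x y _ /lt2/H2 h [].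
  by left=> x y /lt1/H1 h1 /lt2/H2 h2.
- move=> k e e' /andP[e'0 e'e].
  have lt x : 0 < x < e' -> 0 < x < e.
    by move=> /andP[-> /lt_le_trans]; apply.
  by case=> H; [left|right] => x y /lt hx /lt hy; exact: H.
exists e => //; rewrite UE.
case: (pselect (exists k, forall x y, 0 < x < e -> 0 < y < e ->
    rectangle (r k) (shift p q x y))) => [[k H]|H].
  by left=> x y hx hy; exists k => //; exact: H.
right=> x y hx hy [k _ Uk]; case: (He k) => [h|h]; last exact: h Uk.
by apply: H; exists k.
Qed.

Lemma region_closed p :
  (forall e, 0 < e -> exists z, [/\ `|z.1 - p.1| < e, `|z.2 - p.2| < e & U z]) -> U p.
Proof.
move=> H; have [m [r UE]] := region_rectangles; rewrite UE.
apply: contrapT => nU.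
pose Q k e := forall z, `|z.1 - p.1| < e -> `|z.2 - p.2| < e -> ~ rectangle (r k) z.
have [||e e0 He] := @finite_eps R _ Q.
- move=> k; have nk : ~ rectangle (r k) p by move=> h; apply: nU; exists k.
  have away (x : R) lo hi : ~ (lo <= x <= hi) ->
      exists2 e, 0 < e & forall x', `|x' - x| < e -> ~ (lo <= x' <= hi).
    move=> nx; have [h|h] := ltP x lo.
      by exists (lo - x); [lra|move=> x'; rewrite ltr_norml => *; lras].
    exists (x - hi); last by move=> x'; rewrite ltr_norml => ? ?; lras.
    by rewrite subr_gt0 ltNge; apply/negP => h'; apply: nx; rewrite h h'.
  case: (pselect ((r k).1.1 <= p.1 <= (r k).2.1)) => h1.
    have [e e0 He] : exists2 e, 0 < e & forall x', `|x' - p.2| < e ->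
        ~ ((r k).1.2 <= x' <= (r k).2.2).
      by apply: away => h2; apply: nk.
    by exists e => // z _ /He h [].
  have [e e0 He] := away _ _ _ h1.
  by exists e => // z /He h _ [].
- move=> k e e' /andP[e'0 e'e] h z h1 h2; apply: h; exact: lt_le_trans e'e.
have [z [h1 h2]] := H e e0; rewrite UE => -[k _]; exact: He.
Qed.

Lemma region_bounded : exists B : R, forall p, U p -> `|p.1| <= B /\ `|p.2| <= B.
Proof.
have [m [r UE]] := region_rectangles.
pose g k := `|(r k).1.1| + `|(r k).1.2| + (`|(r k).2.1| + `|(r k).2.2|).
exists (\sum_k g k) => p; rewrite UE => -[k _ [/= h1 h2]].
have gk : g k <= \sum_k g k.
  rewrite (bigD1 k) //= lerDl sumr_ge0 // => j _.
  by rewrite !addr_ge0.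
have n (x : R) : x <= `|x| /\ - x <= `|x| by rewrite ler_norm -normrN ler_norm.
have [a1 a2] := n (r k).1.1; have [a3 a4] := n (r k).1.2.
have [a5 a6] := n (r k).2.1; have [a7 a8] := n (r k).2.2.
have b1 := normr_ge0 (r k).1.1; have b2 := normr_ge0 (r k).1.2.
have b3 := normr_ge0 (r k).2.1; have b4 := normr_ge0 (r k).2.2.
have gE : g k = `|(r k).1.1| + `|(r k).1.2| + (`|(r k).2.1| + `|(r k).2.2|) by [].
by split; apply: (le_trans _ gk); rewrite ler_norml gE; lras.
Qed.

(** By the dichotomy the region contains the open quadrant near [p], and it is
    closed. *)
Lemma corner_limit p q :
  (forall e, 0 < e -> exists x y, [/\ 0 < x < e, 0 < y < e & U (shift p q x y)]) ->
  is_corner U (p, q).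
Proof.
move=> H; have [e e0 [He|He]] := quadrant_dichotomy p q; last first.
  by have [x [y [hx hy /He]]] := H e e0; case.
exists e => // x y hx hy; apply: region_closed => e' e'0 /=.
have nudge t : 0 <= t < e -> exists d, [/\ 0 < t + d < e, 0 < d & d < e'].
  move=> ht; have te : 0 < e - t by lras.
  have [d [d0 d1 d2]] := below2 e'0 te.
  by exists (d / 2); split; lras.
have [dx [hx1 hx2 hx3]] := nudge _ hx; have [dy [hy1 hy2 hy3]] := nudge _ hy.
exists (shift p q (x + dx) (y + dy)); split; last exact: He.
  rewrite /= (_ : _ - _ = sg q.1 dx); last by rewrite /sg; case: q.1; ring.
  by rewrite /sg; case: q.1; rewrite ?normrN gtr0_norm.
rewrite /= (_ : _ - _ = sg q.2 dy); last by rewrite /sg; case: q.2; ring.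
by rewrite /sg; case: q.2; rewrite ?normrN gtr0_norm.
Qed.

Lemma corner_interior p q : is_corner U (p, q) -> exists2 e, 0 < e &
  forall x y, 0 < x < e -> 0 < y < e -> U° (shift p q x y).
Proof.
move=> [e e0 H]; exists e => // x y hx hy; apply/interior_box.
have [|||| f [f0 f1 f2 f3 f4]] := @below4 _ x (e - x) y (e - y); try by lras.
exists f => // z /= h1 h2.
have -> : z = shift p q (sg q.1 (z.1 - p.1)) (sg q.2 (z.2 - p.2)).
  by rewrite shiftE /sg; case: q.1; case: q.2; rewrite ?opprK !subrKC -surjective_pairing.
move: h1 h2; rewrite -/(sg q.1 x) -/(sg q.2 y) !ltr_norml /sg => h1 h2.
by apply: H; [case: q.1 h1 => ?|case: q.2 h2 => ?]; lras.
Qed.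

(** Displacement by [x] along the i-th edges and by [y] across them. *)
Definition off i p (x y : R) : R * R :=
  if horizontal i then (p.1 + x, p.2 + y) else (p.1 + y, p.2 + x).

Lemma edge_off i b s t : edge i b t = off i (edge i b s) (t - s) 0.
Proof. by rewrite /off /edge; case: (horizontal i) => /=; congr pair; ring. Qed.

Lemma shift_side i d b p x y : (if horizontal i then shift p (side i d b) x y
  else shift p (side i d b) y x) = off i p (sg d x) (sg b y).
Proof. by rewrite /side /off; case: (horizontal i). Qed.

Lemma off_perp i j p x y : horizontal i != horizontal j -> off i p x y = off j p y x.
Proof. by rewrite /off; case: (horizontal i); case: (horizontal j). Qed.

Lemma len_gt0 i : 0 < len i. Proof. by case: HP. Qed.

Lemma edge_corner i b s d : 0 < s < len i -> is_corner U (edge i b s, side i d b).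
Proof. by move=> h; case: HP => _ _ H _ _; have [] := H i b d s h. Qed.

Lemma edge_not_corner i b s d : 0 < s < len i ->
  ~ is_corner U (edge i b s, side i d (~~ b)).
Proof. by move=> h; case: HP => _ _ H _ _; have [] := H i b d s h. Qed.

Lemma boundary_edge p : U p -> ~ U° p ->
  exists i b s, 0 <= s <= len i /\ p = edge i b s.
Proof. by move=> h1 h2; case: HP => _ _ _ _ /(_ p); apply. Qed.

Lemma edge_inj i b s t : edge i b s = edge i b t -> s = t.
Proof. by rewrite /edge; case: (horizontal i) => -[/addrI]. Qed.

Lemma open_edges_disjoint i b s j b' s' : 0 < s < len i -> 0 < s' < len j ->
  edge i b s = edge j b' s' -> [/\ i = j, b = b' & s = s'].
Proof.
move=> hs hs' E; case: HP => _ _ _ /(_ (i, b) (j, b') I I) H _.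
have /= [ij bb'] : (i, b) = (j, b').
  by apply: H; exists (edge i b s); split; [exists s|exists s'].
by split=> //; move: E; rewrite -ij -bb'; exact: edge_inj.
Qed.

(** The two corners at the point on the side [b] make a half box. *)
Lemma edge_half i b s : 0 < s < len i -> exists2 e, 0 < e &
  forall x y, `|x| < e -> 0 < y < e -> U° (off i (edge i b s) x (sg b y)).
Proof.
move=> hs; set p := edge i b s.
have [e1 e10 H1] : is_corner U (p, side i true b) by exact: edge_corner.
have [e2 e20 H2] : is_corner U (p, side i false b) by exact: edge_corner.
have H e x y : e <= e1 -> e <= e2 -> `|x| < e -> 0 <= y < e -> U (off i p x (sg b y)).
  move=> ee1 ee2 hx hy; have [x0|x0] := leP 0 x.
    have := shift_side i true b p x y; move: hx; rewrite ger0_norm // /sg => hx <-.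
    by case: ifP => _; apply: H1; lras.
  have := shift_side i false b p (- x) y; move: hx.
  rewrite ltr0_norm // /sg opprK => hx <-.
  by case: ifP => _; apply: H2; lras.
have [e [e0 ee1 ee2]] := below2 e10 e20.
exists (e / 2); first by lra.
move=> x y hx hy; apply/interior_box.
have [||f [f0 f1 f2]] := @below2 _ y (e / 2); try by lras.
exists f => // z; set c := off _ _ _ _ => h1 h2.
have Hn x' y' : `|x' - x| < f -> `|y' - sg b y| < f -> U (off i p x' y').
  move=> hx' hy'; rewrite -[y'](sgK b).
  apply: (H e) => //; move: hx hx' hy'; rewrite !ltr_norml /sg; case: (b) => *; lras.
move: h1 h2; rewrite /c /off; case hi : (horizontal i) => /= h1 h2.
  have -> : z = off i p (z.1 - p.1) (z.2 - p.2).
    by rewrite /off hi !subrKC -surjective_pairing.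
  by apply: Hn; rewrite -addrA -opprD.
have -> : z = off i p (z.2 - p.2) (z.1 - p.1).
  by rewrite /off hi !subrKC -surjective_pairing.
by apply: Hn; rewrite -addrA -opprD.
Qed.

Lemma edge_outer i b s : 0 < s < len i -> exists2 e, 0 < e &
  forall x y, 0 < `|x| < e -> 0 < y < e -> ~ U (off i (edge i b s) x (sg (~~ b) y)).
Proof.
move=> hs; set p := edge i b s.
have out d : exists2 e, 0 < e &
    forall x y, 0 < x < e -> 0 < y < e -> ~ U (shift p (side i d (~~ b)) x y).
  have [e e0 [He|He]] := quadrant_dichotomy p (side i d (~~ b)); last by exists e.
  case: (@edge_not_corner i b s d hs); apply: corner_limit => e' e'0.
  have [f [f0 f1 f2]] := below2 e0 e'0.
  by exists (f / 2), (f / 2); split; [lras|lras|apply: He; lras].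
have [e1 e10 H1] := out true; have [e2 e20 H2] := out false.
have [e [e0 ee1 ee2]] := below2 e10 e20.
exists e => // x y hx hy; have [x0|x0] := leP 0 x.
  have := shift_side i true (~~ b) p x y; move: hx; rewrite ger0_norm // => hx.
  by rewrite /sg => <-; case: ifP => _; apply: H1; lras.
have := shift_side i false (~~ b) p (- x) y; move: hx.
rewrite ltr0_norm // => hx; rewrite [sg false _]opprK => <-.
by case: ifP => _; apply: H2; lras.
Qed.

Lemma open_edge_boundary i b s : 0 < s < len i ->
  U (edge i b s) /\ ~ U° (edge i b s).
Proof.
move=> hs; split.
  have [e e0 H] := @edge_corner i b s true hs.
  by have := H 0 0; rewrite /= /shift; do 2 case: ifP => _; rewrite ?oppr0 !addr0
    -surjective_pairing; apply; rewrite lexx.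
move=> /interior_box [e e0 H]; apply: (@edge_not_corner i b s true hs).
exists e => // x y hx hy; apply: H; rewrite /= /shift /= addrAC subrr add0r.
  by case: ifP => _; rewrite ?normrN ger0_norm; lras.
by case: ifP => _; rewrite ?normrN ger0_norm; lras.
Qed.

Lemma edge_dist i b s t : `|(edge i b s).1 - (edge i b t).1| <= `|s - t| /\
  `|(edge i b s).2 - (edge i b t).2| <= `|s - t|.
Proof.
rewrite /edge; case: (horizontal i) => /=; rewrite subrr normr0 normr_ge0.
  by rewrite opprD addrACA subrr add0r.
by rewrite opprD addrACA subrr add0r.
Qed.

Lemma edge_boundary i b s : 0 <= s <= len i -> U (edge i b s) /\ ~ U° (edge i b s).
Proof.
move=> hs; have l0 := len_gt0 i.
have near e : 0 < e -> exists2 t, 0 < t < len i & `|t - s| < e.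
  move=> e0; have [f [f0 f1 f2]] := below2 e0 l0.
  have [h|h] := leP s (len i / 2).
    by exists (s + f / 3); [lras|rewrite ltr_norml; lras].
  by exists (s - f / 3); [lras|rewrite ltr_norml; lras].
split.
  apply: region_closed => e /near [t ht ts].
  have [d1 d2] := edge_dist i b t s; exists (edge i b t); split.
  - exact: le_lt_trans ts.
  - exact: le_lt_trans ts.
  - by have [] := @open_edge_boundary i b t ht.
move=> /interior_box_open [e /near [t ht ts] H].
have [d1 d2] := edge_dist i b t s.
have [_] := @open_edge_boundary i b t ht; apply; apply: H.
  exact: le_lt_trans ts.
exact: le_lt_trans ts.
Qed.

(** If an end of the edge [j] lay inside the edge [i], then [j] would leave it
    along [i], against the disjointness of open edges, or into the region,
    where no boundary point lies, or away from it, where the region has no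
    points. *)
Lemma edge_unique i b s j b' s' : 0 < s < len i -> 0 <= s' <= len j ->
  edge i b s = edge j b' s' -> [/\ i = j, b = b' & s = s'].
Proof.
move=> hs hs' E; case: (pselect (0 < s' < len j)) => [|ends].
  by move=> h; exact: open_edges_disjoint.
exfalso; have lj := len_gt0 j.
(* [c] is the direction in which the edge [j] leaves its end. *)
have [c hc] : exists c, forall t, 0 < t < len j -> 0 < s' + sg c t < len j.
  have [s'0|s'0] := leP s' 0; first by exists true => t /= ht; lras.
  exists false => t /= ht; have : len j <= s'.
    by rewrite leNgt; apply/negP => h; apply: ends; rewrite s'0 h.
  by lras.
have [hij|hij] := eqVneq (horizontal i) (horizontal j).
  have [|||f [f0 f1 f2 f3]] := @below3 _ (len j) s (len i - s); try by lras.
  have h1 : 0 < s + sg c (f / 2) < len i by rewrite /sg; case: (c); lras.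
  have h2 : 0 < s' + sg c (f / 2) < len j by apply: hc; lras.
  have [|ij bb' ss'] := @open_edges_disjoint _ b _ _ b' _ h1 h2.
    rewrite (@edge_off i b s) (@edge_off j b' s') E /off hij.
    by case: ifP => _; congr pair; ring.
  by apply: ends; rewrite -(addIr _ ss') -ij.
have zE t : edge j b' (s' + sg c t) = off i (edge i b s) 0 (sg c t).
  by rewrite (off_perp _ _ _ hij) E (@edge_off j b' s') addrAC subrr add0r.
have [cb|cb] := eqVneq c b.
  have [e e0 He] := @edge_half i b s hs.
  have [f [f0 f1 f2]] := below2 e0 lj.
  have hf : 0 < f / 2 < len j by lras.
  have [_] := @open_edge_boundary j b' _ (hc _ hf); apply.
  by rewrite zE cb; apply: He; rewrite ?normr0 //; lras.
have {}cb : c = ~~ b by move: cb; case: (c); case: (b).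
have [e e0 He] := @edge_outer i b s hs.
have [f' [f'0 f1 f2]] := below2 e0 lj; pose f := f' / 2.
have hf : 0 < f < len j by rewrite /f; lras.
have [e' e'0 He'] := @edge_corner j b' _ c (hc _ hf).
have e2 : 0 < e / 2 by lra.
have [g' [g'0 g1 g2]] := below2 e'0 e2; pose g := g' / 2.
have [g0 ge fge] : [/\ 0 < g, g < e' & f + g < e] by rewrite /g /f; split; lra.
have hg : 0 <= g < e' by rewrite (ltW g0).
have Ug : U (off j (edge j b' (s' + sg c f)) (sg c g) (sg b' g)).
  by rewrite -shift_side; case: ifP => _; apply: He'.
have f0 : 0 < f by case/andP: hf.
apply: (He (sg b' g) (f + g)).
- have -> : `|sg b' g| = g by rewrite /sg; case: (b'); rewrite ?normrN gtr0_norm.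
  by rewrite g0 (lt_trans _ fge) // ltrDr.
- by rewrite addr_gt0.
rewrite -cb; move: Ug; rewrite zE -(off_perp _ _ _ hij).
rewrite (_ : off i (off _ _ _ _) _ _ = off i (edge i b s) (sg b' g) (sg c (f + g))) //.
have sgD : sg c (f + g) = sg c f + sg c g by rewrite /sg; case: (c); rewrite ?opprD.
by rewrite /off sgD; case: (horizontal i); rewrite /= addr0 addrA.
Qed.

End Region.

(** * Straight-line flow in the region *)

Section Flow.
Variables (R : realType) (P : net R).
Hypothesis HP : polyrectangle_translation_surface P.
Local Notation U := (region P).
Implicit Types (p z u : R * R) (i j : 'I_(npairs P)).

Definition rev_dir u : R * R := (- u.1, - u.2).
Definition quadrant_of u : quadrant := (0 < u.1, 0 < u.2).

Definition seg p u t := forall s, 0 < s < t -> U° (flow p u s).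

Lemma flow_flow p u s t : flow (flow p u s) u t = flow p u (s + t).
Proof. by rewrite /flow /=; congr pair; ring. Qed.

Lemma flow_rev p u s : flow p (rev_dir u) s = flow p u (- s).
Proof. by rewrite /flow /=; congr pair; ring. Qed.

Lemma flow0 p u : flow p u 0 = p.
Proof. by rewrite /flow !mul0r !addr0 -surjective_pairing. Qed.

Lemma rev_dirK u : rev_dir (rev_dir u) = u.
Proof. by rewrite /rev_dir /= !opprK -surjective_pairing. Qed.

Lemma seg_rev p u t : seg p u t -> seg (flow p u t) (rev_dir u) t.
Proof.
move=> H s hs; rewrite flow_rev flow_flow; apply: H.
by lras.
Qed.

Lemma seg_mem p u t s : seg p u t -> 0 < s < t -> U (flow p u s).
Proof. by move=> H /H; exact: interior_subset. Qed.

Lemma seg_le p u t t' : t' <= t -> seg p u t -> seg p u t'.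
Proof. by move=> tt' H s /andP[s0 st]; apply: H; rewrite s0 (lt_le_trans st tt'). Qed.

Lemma flow_near p u s e : 0 < e -> exists2 d, 0 < d & forall s', `|s' - s| < d ->
  `|(flow p u s').1 - (flow p u s).1| < e /\ `|(flow p u s').2 - (flow p u s).2| < e.
Proof.
move=> e0; pose k := `|u.1| + `|u.2| + 1.
have k0 : 0 < k by rewrite /k ltr_wpDl ?addr_ge0.
exists (e / k) => [|s' hs]; first exact: divr_gt0.
have H (x y : R) : `|y| <= k -> `|x + s' * y - (x + s * y)| < e.
  move=> yk; rewrite opprD addrACA subrr add0r -mulrBl normrM.
  rewrite ltr_pdivlMr // in hs; apply: le_lt_trans hs.
  by rewrite ler_wpM2l.
have n1 := normr_ge0 u.1; have n2 := normr_ge0 u.2.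
by split; apply: H; rewrite /k; lra.
Qed.

(** The time is the supremum of the times of free flight; it is finite because
    the region is bounded, and the region is closed. *)
Lemma exit_exists p u : u.1 != 0 \/ u.2 != 0 -> (exists2 e, 0 < e & seg p u e) ->
  exists2 t, 0 < t & [/\ seg p u t, U (flow p u t) & ~ U° (flow p u t)].
Proof.
move=> u0 [e e0 He]; have [B HB] := region_bounded HP.
pose S := [set t | 0 < t /\ seg p u t].
have Se : S e by [].
have Sb : exists M, ubound S M.
  have bnd (x y : R) : y != 0 -> exists M, forall t, 0 < t ->
      `|x + t / 2 * y| <= B -> t <= M.
    move=> y0; exists (2 * (B + `|x|) / `|y|) => t t0 h.
    rewrite ler_pdivlMr ?normr_gt0 //.
    have : `|t / 2 * y| <= B + `|x|.
      rewrite -[t / 2 * y](addKr x) addrC (le_trans (ler_normB _ _)) //.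
      by rewrite lerD2r.
    by rewrite normrM (gtr0_norm (_ : 0 < t / 2)) ?divr_gt0 //; lra.
  case: u0 => u0.
    have [M HM] := bnd p.1 _ u0; exists M => t [t0 st]; apply: HM => //.
    have [|//] := HB _ (seg_mem (s := t / 2) st _).
    by lras.
  have [M HM] := bnd p.2 _ u0; exists M => t [t0 st]; apply: HM => //.
  have [|//] := HB _ (seg_mem (s := t / 2) st _).
  by lras.
have Ss : has_sup S by split; [exists e|].
pose T := sup S; have eT : e <= T := ub_le_sup Sb Se.
have T0 : 0 < T := lt_le_trans e0 eT.
have segT : seg p u T.
  move=> s /andP[s0 sT]; have [t [t0 st] lt] : exists2 t, S t & s < t.
    have h : 0 < T - s by rewrite subr_gt0.
    by have [t St] := sup_adherent h Ss; rewrite subKr; exists t.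
  by apply: st; rewrite s0.
exists T => //; split=> //.
  apply: (region_closed HP) => e' e'0.
  have [d d0 Hd] := flow_near p u T e'0.
  have [f [f0 f1 f2]] := below2 d0 T0; pose s := T - f / 2.
  have [|h1 h2] := Hd s.
    by rewrite /s addrAC subrr add0r normrN gtr0_norm; lra.
  exists (flow p u s); split => //; apply: (seg_mem segT); rewrite /s.
  by lras.
move=> /interior_box_open [e' e'0 H].
have [d d0 Hd] := flow_near p u T e'0.
have : S (T + d / 2).
  split=> [|s /andP[s0 sT]]; first by lra.
  have [sT'|Ts] := ltP s T; first by apply: segT; rewrite s0.
  by have [|h1 h2] := Hd s; [rewrite ger0_norm; lra|exact: H].
by move=> /(ub_le_sup Sb); rewrite -/T; lra.
Qed.

Lemma flow_shift p u s : u.1 != 0 -> u.2 != 0 ->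
  flow p u s = shift p (quadrant_of u) (s * `|u.1|) (s * `|u.2|).
Proof.
move=> u1 u2; rewrite /flow /shift /=; congr pair; congr (_ + _).
  by case: (ltrgt0P u.1) u1 => // *; rewrite ?mulrN ?opprK.
by case: (ltrgt0P u.2) u2 => // *; rewrite ?mulrN ?opprK.
Qed.

Lemma depart p u : u.1 != 0 -> u.2 != 0 -> is_corner U (p, quadrant_of u) ->
  exists2 e, 0 < e & seg p u e.
Proof.
move=> u1 u2 /corner_interior [e e0 H].
pose k := `|u.1| + `|u.2|.
have n1 : 0 < `|u.1| by rewrite normr_gt0.
have n2 : 0 < `|u.2| by rewrite normr_gt0.
have k0 : 0 < k by rewrite addr_gt0.
exists (e / k) => [|s /andP[s0]]; first exact: divr_gt0.
rewrite ltr_pdivlMr // /k mulrDr => se.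
have h1 : 0 < s * `|u.1| by rewrite mulr_gt0.
have h2 : 0 < s * `|u.2| by rewrite mulr_gt0.
by rewrite flow_shift //; apply: H; lras.
Qed.

Lemma arrive p u t : u.1 != 0 -> u.2 != 0 -> 0 < t -> seg p u t ->
  is_corner U (flow p u t, quadrant_of (rev_dir u)).
Proof.
move=> u1 u2 t0 /seg_rev H; apply: (corner_limit HP) => e e0.
have n1 : 0 < `|u.1| by rewrite normr_gt0.
have n2 : 0 < `|u.2| by rewrite normr_gt0.
pose k := `|u.1| + `|u.2|.
have k0 : 0 < k by rewrite addr_gt0.
have [||s [s0 st se]] := @below2 _ (t / 2) (e / (2 * k)); try by rewrite divr_gt0 ?mulr_gt0.
rewrite ler_pdivlMr ?mulr_gt0 // /k in se.
have h1 : 0 < s * `|u.1| by rewrite mulr_gt0.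
have h2 : 0 < s * `|u.2| by rewrite mulr_gt0.
exists (s * `|u.1|), (s * `|u.2|); split; [by lras|by lras|].
have := flow_shift (flow p u t) s (_ : (rev_dir u).1 != 0) (_ : (rev_dir u).2 != 0).
rewrite /= !normrN !oppr_eq0 => <- //.
by apply: (seg_mem H); lras.
Qed.

(** The copy of the i-th edges from which the flow departs; on the copy [~~
    out_side u i] it arrives. *)
Definition out_side u i := if horizontal i then 0 < u.2 else 0 < u.1.

Lemma out_side_rev u i : u.1 != 0 -> u.2 != 0 -> out_side (rev_dir u) i = ~~ out_side u i.
Proof.
by move=> u1 u2; rewrite /out_side /rev_dir /= !oppr_gt0; case: ifP => _;
  [case: (ltrgt0P u.2) u2|case: (ltrgt0P u.1) u1].
Qed.

Lemma out_side_quadrant u i : exists d, quadrant_of u = side i d (out_side u i).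
Proof.
rewrite /quadrant_of /side /out_side; case: (horizontal i).
  by exists (0 < u.1).
by exists (0 < u.2).
Qed.

Lemma edge_depart u i s : u.1 != 0 -> u.2 != 0 -> 0 < s < len i ->
  is_corner U (edge i (out_side u i) s, quadrant_of u).
Proof.
move=> u1 u2 hs; have [d ->] := out_side_quadrant u i; exact: (edge_corner HP).
Qed.

Lemma edge_no_depart u i b s : 0 < s < len i ->
  is_corner U (edge i b s, quadrant_of u) -> b = out_side u i.
Proof.
move=> hs; have [d ->] := out_side_quadrant u i => H.
apply/eqP; case: eqVneq => // nb.
have E : out_side u i = ~~ b by move: nb; case: (b); case: (out_side u i).
by rewrite E in H; case: (edge_not_corner HP hs H).
Qed.

Definition vtx (x : 'I_(npairs P) * bool * bool) : R * R :=
  edge x.1.1 x.1.2 (if x.2 then len x.1.1 else 0).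

Lemma vertex_vtx v : vertex P v -> exists x, v = vtx x.
Proof. by move=> [i [b [->|->]]]; [exists (i, b, false)|exists (i, b, true)]. Qed.

Lemma boundary_split z : U z -> ~ U° z ->
  vertex P z \/ exists i b s, 0 < s < len i /\ z = edge i b s.
Proof.
move=> h1 h2; have [i [b [s [/andP[s0 sl] E]]]] := boundary_edge HP h1 h2.
have [s00|s00] := eqVneq s 0; first by left; exists i, b; left; rewrite E s00.
have [sl'|sl'] := eqVneq s (len i); first by left; exists i, b; right; rewrite E sl'.
by right; exists i, b, s; rewrite !lt_neqAle s0 sl sl' eq_sym s00.
Qed.

Lemma vertex_not_open i b s : 0 < s < len i -> ~ vertex P (edge i b s).
Proof.
move=> hs [j [b' E]]; have l0 := ltW (len_gt0 HP j); case: E => E.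
  have [|ij _ ss] := edge_unique HP hs _ E; first by rewrite lexx.
  by rewrite ss ltxx in hs.
have [|ij _ ss] := edge_unique HP hs _ E; first by rewrite lexx l0.
by rewrite ss ij ltxx andbF in hs.
Qed.

End Flow.

(** * The transverse coordinate and the edge hit first *)

Section Hits.
Variables (R : realType) (P : net R) (alpha : R).
Hypothesis HP : polyrectangle_translation_surface P.
Hypothesis alpha0 : alpha != 0.
Implicit Types (p z u : R * R) (i j : 'I_(npairs P)).

(** The transverse coordinate: constant along lines of slope [alpha], and
    shifted by a constant at each identification. *)
Definition om p : R := p.2 - alpha * p.1.

Definition direction u := u.1 != 0 /\ u.2 = alpha * u.1.

Lemma direction_neq0 u : direction u -> u.1 != 0 /\ u.2 != 0.
Proof. by move=> [u1 ->]; rewrite mulf_neq0. Qed.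

Lemma direction_rev u : direction u -> direction (rev_dir u).
Proof. by move=> [u1 u2]; split; rewrite /= ?oppr_eq0 // u2 mulrN. Qed.

Lemma om_flow u p t : direction u -> om (flow p u t) = om p.
Proof. by move=> [_ u2]; rewrite /om /flow /= u2; ring. Qed.

Lemma flow_om u p z : direction u -> om p = om z -> flow p u ((z.1 - p.1) / u.1) = z.
Proof.
move=> [u1 u2] E; rewrite /flow [RHS]surjective_pairing divfK //; congr pair.
  by rewrite subrKC.
have -> : (z.1 - p.1) / u.1 * u.2 = alpha * (z.1 - p.1) by rewrite u2; field.
by move: E; rewrite /om => E; lra.
Qed.

(** A point of an edge is given by its transverse coordinate [w]: [spos] is its
    distance from the lower or left end, and [dom] says that it lies in the open
    edge. *)
Definition slope_of i : R := if horizontal i then - alpha else 1.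
Definition spos i b (w : R) : R := (w - om (origin i b)) / slope_of i.
Definition pe i b w := edge i b (spos i b w).
Definition dom i b w := 0 < spos i b w < len i.

Lemma slope_of_neq0 i : slope_of i != 0.
Proof. by rewrite /slope_of; case: ifP => _; rewrite ?oppr_eq0 ?oner_eq0. Qed.

Lemma om_edge i b s : om (edge i b s) = om (origin i b) + s * slope_of i.
Proof. by rewrite /om /edge /slope_of; case: ifP => _ /=; ring. Qed.

Lemma om_pe i b w : om (pe i b w) = w.
Proof. by rewrite om_edge divfK ?slope_of_neq0 // subrKC. Qed.

Lemma edge_pe i b s : edge i b s = pe i b (om (edge i b s)).
Proof. by rewrite /pe /spos om_edge addrAC subrr add0r mulfK ?slope_of_neq0. Qed.

Lemma spos_om i b s : spos i b (om (edge i b s)) = s.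
Proof. by rewrite /spos om_edge addrAC subrr add0r mulfK ?slope_of_neq0. Qed.

(** The change of the transverse coordinate on passing to the copy [b] of the
    i-th edges from the other copy. *)
Definition tr i b : R := om (origin i b) - om (origin i (~~ b)).

Lemma spos_tr i b w : spos i b (w + tr i b) = spos i (~~ b) w.
Proof. by rewrite /spos /tr; congr (_ / _); ring. Qed.

Lemma pe_tr i b w : pe i b (w + tr i b) = edge i b (spos i (~~ b) w).
Proof. by rewrite /pe spos_tr. Qed.

Lemma tr_neg i b : tr i (~~ b) = - tr i b.
Proof. by rewrite /tr negbK; ring. Qed.

Lemma dom_tr i b w : dom i b (w + tr i b) <-> dom i (~~ b) w.
Proof. by rewrite /dom spos_tr; split. Qed.

(** The arrival is on the copy of [j] that the flow enters from the region;
    [seg] makes it the first boundary point met. *)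
Definition hits u z j := dom j (~~ out_side u j) (om z) /\
  exists2 t, 0 < t & pe j (~~ out_side u j) (om z) = flow z u t /\ seg P z u t.

Lemma exit_hits u z : direction u -> (exists2 e, 0 < e & seg P z u e) ->
  (exists j, hits u z j) \/
  exists t v, [/\ 0 < t, vertex P v, flow z u t = v & seg P z u t].
Proof.
move=> du; have [u1 u2] := direction_neq0 du.
move=> /(exit_exists HP (or_introl u1)) [t t0 [st U1 U2]].
case: (boundary_split HP U1 U2) => [v|[j [b [s [hs E]]]]].
  by right; exists t, (flow z u t).
left; exists j; have arr := arrive HP u1 u2 t0 st.
rewrite E in arr; have bE := edge_no_depart HP hs arr.
have bE' : b = ~~ out_side u j by rewrite bE out_side_rev.
have omE : om (edge j b s) = om z by rewrite -E om_flow.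
split; first by rewrite -bE' /dom -omE spos_om.
by exists t => //; split => //; rewrite -bE' -omE -edge_pe E.
Qed.

Lemma seg_edge_time u z t j b s t' : seg P z u t -> 0 < t' ->
  0 <= s <= len j -> edge j b s = flow z u t' -> t <= t'.
Proof.
move=> st t'0 hs E; rewrite leNgt; apply/negP => tt'.
have [_] := edge_boundary HP b hs; rewrite E; apply; apply: st.
by rewrite t'0.
Qed.

Lemma hits_uniq u z j j' : hits u z j -> hits u z j' -> j = j'.
Proof.
move=> [dj [t t0 [E st]]] [dj' [t' t'0 [E' st']]].
have hj := dj; have hj' := dj'; rewrite /dom in hj hj'.
have h1 : t <= t'.
  by apply: (seg_edge_time st t'0 _ E'); case/andP: hj' => /ltW-> /ltW->.
have h2 : t' <= t.
  by apply: (seg_edge_time st' t0 _ E); case/andP: hj => /ltW-> /ltW->.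
have tt : t = t' by apply/eqP; rewrite eq_le h1.
by rewrite -tt -E in E'; have [] := open_edges_disjoint HP hj' hj E'.
Qed.

(** Along a transversal all positions on edges and all arrival times are
    affine in the transverse coordinate, so that comparing them needs no
    continuity. *)
Definition affine (f : R -> R) := exists A B, forall w, f w = A + B * w.

Lemma affineB f g : affine f -> affine g -> affine (fun w => f w - g w).
Proof.
by move=> [A [B fE]] [A' [B' gE]]; exists (A - A'), (B - B') => w; rewrite fE gE; ring.
Qed.

Lemma affineZ f c : affine f -> affine (fun w => f w / c).
Proof. by move=> [A [B fE]]; exists (A / c), (B / c) => w; rewrite fE; ring. Qed.

Lemma affine_pe j b : affine (fun w => (pe j b w).1).
Proof.
rewrite /pe /edge /spos /slope_of; case: (horizontal j) => /=.
  exists ((origin j b).1 + om (origin j b) / alpha), (- alpha^-1) => w.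
  by field.
by exists (origin j b).1, 0 => w; rewrite mul0r addr0.
Qed.

Lemma affine_spos j b : affine (spos j b).
Proof.
by exists (- om (origin j b) / slope_of j), (slope_of j)^-1 => w; rewrite /spos; ring.
Qed.

Lemma affine_zero f w1 w2 : affine f -> f w1 < 0 -> 0 < f w2 -> exists2 w,
  f w = 0 & forall l r, l < w1 < r -> l < w2 < r -> l < w < r.
Proof.
move=> [A [B fE]]; rewrite !fE => h1 h2.
have B0 : B != 0 by apply/eqP => B0; move: h1 h2; rewrite B0; lra.
exists (- A / B) => [|l r hl hr].
  by rewrite fE mulrC divfK // subrr.
have [Bp|Bn|B00] := ltrgt0P B; last by rewrite B00 eqxx in B0.
  by rewrite ltr_pdivlMr // ltr_pdivrMr //; case/andP: hl hr => ? ? /andP[? ?]; nra.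
by rewrite ltr_ndivlMr // ltr_ndivrMr //; case/andP: hl hr => ? ? /andP[? ?]; nra.
Qed.

Lemma affine_pos_near f w0 : affine f -> 0 < f w0 ->
  exists2 e, 0 < e & forall w, `|w - w0| < e -> 0 < f w.
Proof.
move=> [A [B fE]]; rewrite fE => h; pose k := `|B| + 1.
have k0 : 0 < k by rewrite ltr_wpDl.
exists ((A + B * w0) / k) => [|w]; first exact: divr_gt0.
rewrite ltr_pdivlMr // => hw.
have : `|B * (w - w0)| < A + B * w0.
  by apply: le_lt_trans hw; rewrite normrM mulrC ler_wpM2l // /k lerDl.
by rewrite fE ltr_norml => /andP[]; lra.
Qed.

Lemma affine_le_limit f w0 e : affine f -> 0 < e ->
  (forall w, w0 < w < w0 + e -> f w <= 0) \/ (forall w, w0 - e < w < w0 -> f w <= 0) ->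
  f w0 <= 0.
Proof.
move=> [A [B fE]] e0 H; rewrite leNgt fE; apply/negP => pos.
pose y := A + B * w0; pose k := `|B| + 1.
have k0 : 0 < k by rewrite ltr_wpDl.
have yk : 0 < y / k by exact: divr_gt0.
have [m [m0 m1 m2]] := below2 e0 yk; pose d := m / 2.
have d0 : 0 < d by rewrite divr_gt0.
have dk : d * k < y by rewrite -ltr_pdivlMr // /d; lra.
have n1 : - `|B| <= B <= `|B| by rewrite -ler_norml.
have bd : - (d * k) < B * d < d * k by rewrite /k; apply/andP; split; nra.
case: H => H.
  have : y + B * d <= 0.
    by have := H (w0 + d); rewrite fE mulrDr addrA -/y; apply; rewrite /d; lras.
  by lras.
have : y - B * d <= 0.
  by have := H (w0 - d); rewrite fE mulrBr addrA -/y; apply; rewrite /d; lras.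
by lras.
Qed.

(** The edges that are excluded are those on which the flow arrives: the
    family may run along an edge from which it departs. *)
Definition transversal u (q : R -> R * R) (l r : R) :=
  [/\ forall w, om (q w) = w, affine (fun w => (q w).1) &
   forall w, l < w < r -> (exists2 e, 0 < e & seg P (q w) u e) /\
     forall j s, 0 <= s <= len j -> q w <> edge j (~~ out_side u j) s].

Definition vertex_free l r := forall v, vertex P v -> ~ (l < om v < r).

(** [spos] is affine, and where it passes an end of the edge the flow line
    meets a vertex. *)
Lemma dom_spread j b l r w w' : vertex_free l r -> l < w < r -> l < w' < r ->
  dom j b w -> dom j b w'.
Proof.
move=> vf hw hw'; have af := affine_spos j b.
have afl : affine (fun w => len j - spos j b w).
  by apply: affineB => //; exists (len j), 0 => x; rewrite mul0r addr0.
have novtx x s : l < x < r -> spos j b x = s -> (s == 0) || (s == len j) -> False.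
  move=> hx E hs; apply: (vf (pe j b x)); last by rewrite om_pe.
  by exists j, b; rewrite /pe E; case/orP: hs => /eqP->; [left|right].
rewrite /dom => /andP[h1 h2]; apply/andP; split.
  rewrite ltNge; apply/negP; rewrite le_eqVlt => /orP[/eqP E|h3].
    by apply: (novtx w' _ hw' E); rewrite eqxx.
  have [x xE xlr] := affine_zero af h3 h1.
  by apply: (novtx x _ (xlr _ _ hw' hw) xE); rewrite eqxx.
rewrite ltNge; apply/negP; rewrite le_eqVlt => /orP[/eqP E|h3].
  by apply: (novtx w' _ hw' (esym E)); rewrite eqxx orbT.
have h3' : len j - spos j b w' < 0 by rewrite subr_lt0.
have h2' : 0 < len j - spos j b w by rewrite subr_gt0.
have [x /eqP xE xlr] := affine_zero afl h3' h2'.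
rewrite subr_eq0 in xE.
by apply: (novtx x _ (xlr _ _ hw' hw) (esym (eqP xE))); rewrite eqxx orbT.
Qed.

(** The arrival time is read off the abscissas, so that being hit first
    becomes an inequality between affine functions. *)
Lemma hits_time u q l r w j : direction u -> transversal u q l r -> hits u (q w) j ->
  let tm j := ((pe j (~~ out_side u j) w).1 - (q w).1) / u.1 in
  [/\ 0 < tm j, seg P (q w) u (tm j) &
   forall j' s, 0 <= s <= len j' -> (om (edge j' (~~ out_side u j') s)) = w ->
     let t' := ((edge j' (~~ out_side u j') s).1 - (q w).1) / u.1 in
     0 < t' -> tm j <= t' /\ (t' = tm j -> j' = j)].
Proof.
move=> du [omq _ _] [dj [t t0 [E st]]]; have [u1 _] := du; rewrite omq in dj E.
move=> tm; have tmE : tm j = t.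
  by rewrite /tm E /flow /= addrAC subrr add0r mulfK.
rewrite tmE; split => // j' s hs oms t' t'0.
have E' : edge j' (~~ out_side u j') s = flow (q w) u t'.
  by rewrite /t' flow_om // omq.
split; first exact: seg_edge_time E'.
move=> tt'; rewrite tt' -E in E'.
by have [] := edge_unique HP dj hs (esym E').
Qed.

(** Two edges that are first at two places would be hit at the same time in
    between, and so would meet at a point of two open edges; nor can an edge
    cross the transversal. *)
Lemma hits_uniform u q l r w0 : direction u -> transversal u q l r ->
  vertex_free l r -> l < w0 < r -> exists j, forall w, l < w < r -> hits u (q w) j.
Proof.
move=> du tq vf hw0; have [omq aq sq] := tq; have [u1 _] := du.
have hit w : l < w < r -> exists j, hits u (q w) j.
  move=> hw; have [e_ _] := sq w hw; case: (exit_hits du e_) => //.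
  by move=> [t [v [t0 vv E _]]]; case: (vf v vv); rewrite -E om_flow // omq.
have [j hj] := hit w0 hw0; exists j => w hw; have [j' hj'] := hit w hw.
suff -> : j = j' by [].
have spread i w1 w2 b : l < w1 < r -> l < w2 < r -> dom i b w1 -> dom i b w2.
  by move=> h1 h2; exact: dom_spread vf h1 h2.
have d0 : dom j (~~ out_side u j) w0 by have := hj.1; rewrite omq.
have d1' : dom j' (~~ out_side u j') w by have := hj'.1; rewrite omq.
pose tm i x := ((pe i (~~ out_side u i) x).1 - (q x).1) / u.1.
have atm i : affine (tm i) by apply: affineZ; apply: affineB => //; exact: affine_pe.
have fl i x : pe i (~~ out_side u i) x = flow (q x) u (tm i x).
  by rewrite /tm flow_om // omq om_pe.
have tm0 i x : l < x < r -> dom i (~~ out_side u i) x -> tm i x = 0 -> False.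
  move=> hx dx tmx; have [_ nq] := sq x hx; apply: (nq i (spos i (~~ out_side u i) x)).
    by case/andP: dx => /ltW-> /ltW->.
  by rewrite -/(pe _ _ _) fl tmx flow0.
(* positivity of the hitting time propagates along the interval *)
have tm_pos i x y : l < x < r -> l < y < r -> dom i (~~ out_side u i) x ->
    0 < tm i x -> 0 < tm i y.
  move=> hx hy dx px; rewrite ltNge; apply/negP; rewrite le_eqVlt => /orP[/eqP E|ny].
    by apply: (tm0 i y hy _ E); exact: spread hx hy dx.
  have [z zE zlr] := affine_zero (atm i) ny px.
  by apply: (tm0 i z (zlr _ _ hy hx) _ zE); exact: spread hx (zlr _ _ hy hx) dx.
have [p0 _ first0] := hits_time du tq hj.
have [p1 _ first1] := hits_time du tq hj'.
have cl i x : dom i (~~ out_side u i) x -> 0 <= spos i (~~ out_side u i) x <= len i.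
  by case/andP => /ltW-> /ltW->.
have d0' : dom j' (~~ out_side u j') w0 by exact: spread hw hw0 d1'.
have d1 : dom j (~~ out_side u j) w by exact: spread hw0 hw d0.
have [le0 eq0] := first0 j' _ (cl _ _ d0') (om_pe _ _ _) (tm_pos j' w w0 hw hw0 d1' p1).
have [le1 eq1] := first1 j _ (cl _ _ d1) (om_pe _ _ _) (tm_pos j w0 w hw0 hw d0 p0).
rewrite -/(tm j w0) -/(tm j' w0) in le0 eq0.
rewrite -/(tm j' w) -/(tm j w) in le1 eq1.
have [E|n0] := eqVneq (tm j' w0) (tm j w0); first exact/esym/eq0.
have [E|n1] := eqVneq (tm j w) (tm j' w); first exact: eq1.
have h0 : tm j w0 - tm j' w0 < 0 by rewrite subr_lt0 lt_neqAle eq_sym n0.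
have h1 : 0 < tm j w - tm j' w by rewrite subr_gt0 lt_neqAle eq_sym n1.
have [x /eqP xE xlr] := affine_zero (affineB (atm j) (atm j')) h0 h1.
have hx := xlr _ _ hw0 hw; rewrite subr_eq0 in xE.
have dx := spread _ _ _ _ hw0 hx d0; have dx' := spread _ _ _ _ hw hx d1'.
have E : pe j (~~ out_side u j) x = pe j' (~~ out_side u j') x.
  by rewrite !fl (eqP xE).
by have [] := open_edges_disjoint HP dx dx' E.
Qed.

Lemma vertex_gap w0 : exists2 e, 0 < e &
  vertex_free w0 (w0 + e) /\ vertex_free (w0 - e) w0.
Proof.
pose Q (x : 'I_(npairs P) * bool * bool) e :=
  ~ (w0 < om (vtx x) < w0 + e) /\ ~ (w0 - e < om (vtx x) < w0).
have [||e e0 He] := @finite_eps R _ Q.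
- move=> x; have [h|h|h] := ltgtP w0 (om (vtx x)).
  + by exists (om (vtx x) - w0); [lra|split => H; lras].
  + by exists (w0 - om (vtx x)); [lra|split => H; lras].
  + by exists 1; [lra|split; rewrite -h ltxx ?andbF].
- by move=> x e e' he' [h1 h2]; split => H; [apply: h1|apply: h2]; lras.
exists e => //; split => v /vertex_vtx [x ->]; by have [] := He x.
Qed.

(** Near [w0] the lines through vertices other than that of [w0] are absent,
    so the edge is constant on either side of [w0]. Such an edge is touched at
    [w0] by continuity, not before [j] is hit and not after, so it is [j]. *)
Lemma hits_locally u q l r w0 j : direction u -> transversal u q l r ->
  l < w0 < r -> hits u (q w0) j ->
  exists2 e, 0 < e & forall w, `|w - w0| < e -> l < w < r /\ hits u (q w) j.
Proof.
move=> du tq hw0 hj; have [omq aq sq] := tq; have [u1 _] := du.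
have [e e0 [vf1 vf2]] := vertex_gap w0.
have [||| d [d0 h1 h2 h3]] := @below3 _ e (w0 - l) (r - w0); try by lras.
have sub1 : transversal u q w0 (w0 + d).
  by split => // w hw; apply: sq; lras.
have sub2 : transversal u q (w0 - d) w0.
  by split => // w hw; apply: sq; lras.
have vf1' : vertex_free w0 (w0 + d) by move=> v /vf1 H hv; apply: H; lras.
have vf2' : vertex_free (w0 - d) w0 by move=> v /vf2 H hv; apply: H; lras.
have [|j1 H1] := @hits_uniform u q _ _ (w0 + d / 2) du sub1 vf1'; first by lras.
have [|j2 H2] := @hits_uniform u q _ _ (w0 - d / 2) du sub2 vf2'; first by lras.
pose tm i x := ((pe i (~~ out_side u i) x).1 - (q x).1) / u.1.
have atm i : affine (tm i) by apply: affineZ; apply: affineB => //; exact: affine_pe.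
have asp i : affine (spos i (~~ out_side u i)) by exact: affine_spos.
have fl i x : pe i (~~ out_side u i) x = flow (q x) u (tm i x).
  by rewrite /tm flow_om // omq om_pe.
have [p0 st0 first0] := hits_time du tq hj; rewrite -/(tm j w0) in p0 st0 first0.
have dj : dom j (~~ out_side u j) w0 by have := hj.1; rewrite omq.
(* an edge that is hit on one side of [w0] is also touched at [w0] *)
have one_sided i : (forall w, w0 < w < w0 + d -> hits u (q w) i) \/
    (forall w, w0 - d < w < w0 -> hits u (q w) i) -> i = j.
  move=> Hi; have lim f : affine f ->
     (exists2 e', 0 < e' & forall w, `|w - w0| < e' -> hits u (q w) i -> f w <= 0) ->
     f w0 <= 0.
    move=> af [e' e'0 Hf]; have [g [g0 g1 g2]] := below2 d0 e'0.
    apply: (affine_le_limit af g0).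
    case: Hi => Hi; [left|right] => w hw; (apply: Hf; [|apply: Hi]);
      by rewrite ?ltr_norml; lras.
  have dfi w : hits u (q w) i -> dom i (~~ out_side u i) w by move=> [+ _]; rewrite omq.
  have s0 : 0 <= spos i (~~ out_side u i) w0 <= len i.
    apply/andP; split.
      rewrite -oppr_le0; apply: (lim (fun w => - spos i (~~ out_side u i) w)).
        have [A [B E]] := asp i; exists (- A), (- B) => w; rewrite E; ring.
      by exists 1 => // w _ /dfi/andP[/ltW]; rewrite oppr_le0.
    rewrite -subr_le0; apply: (lim (fun w => spos i (~~ out_side u i) w - len i)).
      by apply: affineB => //; exists (len i), 0 => w; rewrite mul0r addr0.
    by exists 1 => // w _ /dfi/andP[_ /ltW]; rewrite subr_le0.
  have t0 : 0 <= tm i w0.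
    rewrite -oppr_le0; apply: (lim (fun w => - tm i w)).
      have [A [B E]] := atm i; exists (- A), (- B) => w; rewrite E; ring.
    by exists 1 => // w _ /(hits_time du tq)[/ltW]; rewrite oppr_le0.
  have tpos : 0 < tm i w0.
    rewrite lt_neqAle t0 andbT; apply/eqP => E; have [_ nq] := sq w0 hw0.
    apply: (nq i _ s0); by rewrite -/(pe _ _ _) fl -E flow0.
  have [le0 eq0] := first0 i _ s0 (om_pe _ _ _) tpos; apply: eq0.
  rewrite -/(tm i w0) in le0 *.
  apply/eqP; rewrite eq_le le0 andbT -subr_le0.
  (* near [w0] the edge [j] is also met at a positive time, so [i] comes first *)
  apply: (lim (fun w => tm i w - tm j w)); first exact: affineB.
  have /andP[dj1 dj2] := dj.
  have [e1 e10 H1'] := affine_pos_near (asp j) dj1.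
  have al : affine (fun w => len j - spos j (~~ out_side u j) w).
    by apply: affineB => //; exists (len j), 0 => w; rewrite mul0r addr0.
  have dj2' : 0 < len j - spos j (~~ out_side u j) w0 by rewrite subr_gt0.
  have [e2 e20 H2'] := affine_pos_near al dj2'.
  have [e3 e30 H3'] := affine_pos_near (atm j) p0.
  exists (Num.min e1 (Num.min e2 e3)); first by rewrite !lt_min e10 e20.
  move=> w; rewrite !lt_min => /and3P[/H1' a1 /H2' a2 /H3' a3].
  rewrite subr_gt0 in a2; move=> /(hits_time du tq)[_ _].
  move=> /(_ j (spos j (~~ out_side u j) w)) H; rewrite subr_le0.
  by apply: (H _ _ a3).1; rewrite ?(ltW a1) ?(ltW a2) // -/(pe _ _ _) om_pe.
exists d => // w; rewrite ltr_norml => hw; split; first by lras.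
have [wl|wg|->//] := ltgtP w w0.
  by rewrite -(one_sided j2); [apply: H2; lras|right].
by rewrite -(one_sided j1); [apply: H1; lras|left].
Qed.

End Hits.

(** * Points of the surface *)

Section Classes.
Variables (R : realType) (P : net R).
Hypothesis HP : polyrectangle_translation_surface P.
Local Notation U := (region P).
Local Notation cls := (surface_point P).
Implicit Types (p z u v : R * R) (i j : 'I_(npairs P)) (q : quadrant).

Lemma class_refl (c : corner R) : cls c c.
Proof. exact: rst_refl. Qed.

Lemma class_eq (c c' : corner R) : cls c c' -> cls c = cls c'.
Proof.
move=> cc'; apply/seteqP; split=> x; last exact: rst_trans.
by apply: rst_trans; apply: rst_sym.
Qed.

Lemma class_mem (c c' : corner R) : cls c = cls c' -> cls c c'.
Proof. by move=> ->; exact: class_refl. Qed.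

Lemma class_invariant (S : set (corner R)) (c c' : corner R) :
  (forall x y, glue P x y -> S x <-> S y) -> cls c c' -> S c -> S c'.
Proof.
move=> H cc'; suff [] : S c <-> S c' by [].
elim: cc' => [x y /H //|x|x y _ [h1 h2]|x y z _ [h1 h2] _ [h3 h4]]; split; tauto.
Qed.

Lemma class_interior p q p' q' : U° p -> cls (p, q) (p', q') -> p' = p.
Proof.
move=> Up h; pose S : set (corner R) := [set c | c.1 = p].
apply: (@class_invariant S (p, q) (p', q')) h erefl => x y [|i d s hs _].
  by move=> x' q1 q2 _ _ _.
have [_ n1] := edge_boundary HP false hs; have [_ n2] := edge_boundary HP true hs.
by rewrite /S /=; split=> E; [case: n1|case: n2]; rewrite E.
Qed.

Lemma interior_corner p q : U° p -> is_corner U (p, q).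
Proof.
move=> /interior_box [e e0 H]; exists e => // x y hx hy; apply: H.
  by rewrite /= addrAC subrr add0r; case: ifP => _; rewrite ?normrN ger0_norm; lras.
by rewrite /= addrAC subrr add0r; case: ifP => _; rewrite ?normrN ger0_norm; lras.
Qed.

Lemma class_interior_quadrant p q q' : U° p -> cls (p, q) = cls (p, q').
Proof.
move=> Up; have adj q1 q2 : adjacent q1 q2 -> cls (p, q1) = cls (p, q2).
  by move=> h; apply/class_eq/rst_step/glue_inside => //; exact: interior_corner.
case: q q' => [[] []] [[] []] //; try exact: adj.
- by apply: etrans (adj _ (true, false) _) (adj _ _ _).
- by apply: etrans (adj _ (true, true) _) (adj _ _ _).
- by apply: etrans (adj _ (true, true) _) (adj _ _ _).
- by apply: etrans (adj _ (true, false) _) (adj _ _ _).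
Qed.

Lemma class_open_edge i b s q p' q' : 0 < s < len i ->
  cls (edge i b s, q) (p', q') -> p' = edge i b s \/ p' = edge i (~~ b) s.
Proof.
move=> hs h; pose S : set (corner R) := [set c | exists b', c.1 = edge i b' s].
suff [b' /= ->] : S (p', q') by case: (b'); case: (b) => /=; tauto.
apply: (@class_invariant S) h _; last by exists b.
move=> x y [|i' d s' hs' _]; first by move=> x' q1 q2 _ _ _.
by split=> -[b' /= /esym E]; have [ii' _ ss'] := edge_unique HP hs hs' E;
    rewrite -ss' -ii'; [exists true|exists false].
Qed.

Lemma class_vertex p q p' q' : vertex P p -> cls (p, q) (p', q') -> vertex P p'.
Proof.
move=> vp h; pose S : set (corner R) := [set c | vertex P c.1].
apply: (@class_invariant S (p, q) (p', q')) h vp => x y [|i d s hs _].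
  by move=> x' q1 q2 _ _ _.
have ends b : vertex P (edge i b s) -> s = 0 \/ s = len i.
  move=> vb; case: (eqVneq s 0) => [->|s0]; first by left.
  case: (eqVneq s (len i)) => [->|sl]; first by right.
  have hs' : 0 < s < len i.
    by case/andP: hs => h1 h2; rewrite !lt_neqAle h1 h2 sl eq_sym s0.
  by case: (vertex_not_open HP hs' vb).
by rewrite /S /=; split=> /ends [->|->]; [exists i, true|exists i, true|
  exists i, false|exists i, false]; tauto.
Qed.

(** * Curves with straight charts *)

(** Time runs forward in both cases: [back_chart] describes the curve just
    before [t]. *)

Definition chart (g : R -> set (corner R)) v q t p := is_corner U (p, q) /\
  exists2 e, 0 < e & forall s, 0 <= s < e -> g (t + s) = cls (flow p v s, q).

Definition back_chart (g : R -> set (corner R)) v q t p := is_corner U (p, q) /\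
  exists2 e, 0 < e & forall s, 0 <= s < e -> g (t - s) = cls (flow p v (- s), q).

Lemma flow_inj p p' v s : flow p v s = flow p' v s -> p = p'.
Proof.
by move=> /(congr1 (fun z => flow z v (- s))); rewrite !flow_flow subrr !flow0.
Qed.

Lemma develop_back g v q q' t0 p tau p' :
  0 < tau -> seg P p v tau -> (forall s, 0 < s < tau -> g (t0 + s) = cls (flow p v s, q)) ->
  back_chart g v q' (t0 + tau) p' -> p' = flow p v tau.
Proof.
move=> tau0 sg H [_ [e e0 He]]; have [m [m0 m1 m2]] := below2 e0 tau0; pose s := m / 2.
have hs : 0 < tau - s < tau by rewrite /s; lras.
have := He s; rewrite -addrA H // => /(_ _)/class_mem.
have hs' : 0 <= s < e by rewrite /s; lras.
move=> /(_ hs') /(class_interior (sg _ hs)) E.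
apply: (@flow_inj _ _ v (- s)); rewrite E flow_flow.
by [].
Qed.

(** In the interior a class determines its point in the plane, so the charts
    of the curve at successive times continue the same line; the supremum of
    the times up to which the curve follows the line is the end. *)
Lemma develop g v q q' t0 p tau : chart g v q t0 p -> seg P p v tau ->
  (forall t, t0 < t < t0 + tau -> exists p', chart g v q t p') ->
  (forall t, t0 < t < t0 + tau -> exists p', back_chart g v q' t p') ->
  forall s, 0 < s < tau -> g (t0 + s) = cls (flow p v s, q).
Proof.
move=> [_ [e e0 He]] sg ch bch s hs.
pose S := [set r | 0 < r <= s /\ forall r', 0 < r' <= r -> g (t0 + r') = cls (flow p v r', q)].
have [m [m0 m1 m2]] := below2 e0 (proj1 (andP hs)); pose r0 := m / 2.
have Sr0 : S r0.
  split=> [|r' hr']; first by rewrite /r0; lras.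
  by apply: He; rewrite /r0 in hr'; lras.
have Sb : ubound S s by move=> r [/andP[]].
have Ss : has_sup S by split; [exists r0|exists s].
pose T := sup S; have rT : r0 <= T by apply: ub_le_sup Sr0; exists s.
have Ts : T <= s by apply: ge_sup Sb; exists r0.
have r00 : 0 < r0 by rewrite divr_gt0.
have T0 : 0 < T := lt_le_trans r00 rT.
have below r : 0 < r < T -> g (t0 + r) = cls (flow p v r, q).
  move=> /andP[hr rT']; have h : 0 < T - r by rewrite subr_gt0.
  by have [x [_ Sx]] := sup_adherent h Ss; rewrite subKr => /ltW rx; apply: Sx; rewrite hr.
have hT : 0 < T < tau by lras.
have hT' : t0 < t0 + T < t0 + tau by lras.
have UT := sg T hT.
have [p' bc] := bch _ hT'.
have E := develop_back T0 (seg_le (ltW (proj2 (andP hT))) sg) below bc.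
have gT : g (t0 + T) = cls (flow p v T, q).
  case: bc => _ [e' e'0 /(_ 0)]; rewrite lexx e'0 subr0 oppr0 flow0 => /(_ isT) ->.
  by rewrite E; exact: class_interior_quadrant.
have [p2 [_ [e2 e20 He2]]] := ch _ hT'.
have E2 : p2 = flow p v T.
  have := He2 0; rewrite lexx e20 addr0 flow0 gT => /(_ isT)/class_mem.
  exact: class_interior.
have after r : 0 < r < T + e2 -> g (t0 + r) = cls (flow p v r, q).
  move=> hr; have [rT'|Tr] := ltP r T; first by apply: below; lras.
  rewrite (_ : t0 + r = t0 + T + (r - T)); last by ring.
  by rewrite He2; [rewrite E2 flow_flow subrKC|lras].
suff sT : s <= T by apply: after; lras.
rewrite leNgt; apply/negP => Ts'.
have sT0 : 0 < s - T by lra.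
have [n [n0 n1 n2]] := below2 e20 sT0; pose r1 := T + n / 2.
have : S r1.
  split=> [|r' hr']; first by rewrite /r1; lras.
  by apply: after; rewrite /r1 in hr'; lras.
move=> Sr1; have : r1 <= T by apply: ub_le_sup Sr1; exists s.
by rewrite /r1; lras.
Qed.

(** The backward chart at the end lies over the line itself, and the forward
    chart over another representative of the same point of the surface. *)
Lemma develop_cross g v q q' t0 p tau : 0 < tau -> chart g v q t0 p -> seg P p v tau ->
  (forall t, t0 < t <= t0 + tau -> exists p', chart g v q t p') ->
  (forall t, t0 < t <= t0 + tau -> exists p', back_chart g v q' t p') ->
  exists p', [/\ chart g v q (t0 + tau) p', is_corner U (flow p v tau, q') &
    cls (flow p v tau, q') (p', q)].
Proof.
move=> tau0 ch0 sg ch bch.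
have sub t : t0 < t < t0 + tau -> t0 < t <= t0 + tau by move=> ?; lras.
have dev := develop ch0 sg (fun t h => ch t (sub t h)) (fun t h => bch t (sub t h)).
have hend : t0 < t0 + tau <= t0 + tau by lras.
have [p1 bc] := bch _ hend; have [p2 c2] := ch _ hend; exists p2.
have E := develop_back tau0 sg dev bc; rewrite -E; split => //; first by case: bc.
case: bc => _ [e1 e10 /(_ 0)]; rewrite lexx e10 subr0 oppr0 flow0 => /(_ isT) h1.
case: c2 => _ [e2 e20 /(_ 0)]; rewrite lexx e20 addr0 flow0 h1 => /(_ isT).
exact: class_mem.
Qed.

End Classes.

(** * Geodesics and squares in the plane *)

Section Geodesics.
Variables (R : realType) (P : net R) (alpha : R).
Hypothesis HP : polyrectangle_translation_surface P.
Hypothesis alpha0 : alpha != 0.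
Local Notation U := (region P).
Local Notation cls := (surface_point P).
Local Notation direction := (direction alpha).
Local Notation om := (om alpha).
Local Notation pe := (pe (P := P) alpha).
Local Notation dom := (dom (P := P) alpha).
Local Notation tr := (tr (P := P) alpha).
Implicit Types (p z u v : R * R) (i j : 'I_(npairs P)) (q : quadrant).

Definition geodesic (L : R -> set (corner R)) u := forall t, 0 <= t ->
  (exists p, chart P L u (quadrant_of u) t p) /\
  (0 < t -> exists p, back_chart P L u (quadrant_of (rev_dir u)) t p).

Lemma geodesic_of L : half_infinite_geodesic P alpha L ->
  exists u, [/\ u.1 ^+ 2 + u.2 ^+ 2 = 1, direction u & geodesic L u].
Proof.
move=> [u [u1 u2 H]]; exists u; split => //.
  split => //; apply/eqP => u10; move: u1; rewrite u2 u10 mulr0 expr0n addr0 => /eqP.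
  by rewrite eq_sym oner_eq0.
move=> t t0; have [[p [e [e0 c He]]] Hb] := H t t0; split; first by exists p; split => //; exists e.
move=> t0'; have [_ [p' [e' [e'0 c' He']]]] := Hb t0'.
exists p'; rewrite /quadrant_of /= !oppr_gt0; split => //; by exists e'.
Qed.

Section Steps.
Variables (L : R -> set (corner R)) (u : R * R).
Hypothesis du : direction u.
Hypothesis LP : geodesic L u.
Local Notation at_ := (chart P L u (quadrant_of u)).

Lemma geodesic_chart t : 0 <= t -> exists p, at_ t p.
Proof. by move=> /LP []. Qed.

Lemma geodesic_back t : 0 < t ->
  exists p, back_chart P L u (quadrant_of (rev_dir u)) t p.
Proof. by move=> t0; have [_] := LP (ltW t0); apply. Qed.

Lemma geodesic_mid t p tau s : 0 <= t -> at_ t p -> seg P p u tau -> 0 < s < tau ->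
  L (t + s) = cls (flow p u s, quadrant_of u).
Proof.
move=> t0 ch sg; apply: develop ch sg _ _ s => // r hr.
  by apply: geodesic_chart; lras.
by apply: geodesic_back; lras.
Qed.

Lemma geodesic_cross t p tau : 0 <= t -> at_ t p -> seg P p u tau -> 0 < tau ->
  exists p', [/\ at_ (t + tau) p',
    is_corner U (flow p u tau, quadrant_of (rev_dir u)) &
    cls (flow p u tau, quadrant_of (rev_dir u)) (p', quadrant_of u)].
Proof.
move=> t0 ch sg tau0; apply: develop_cross ch sg _ _ => // r hr.
  by apply: geodesic_chart; lras.
by apply: geodesic_back; lras.
Qed.

(** The class of a point of an open edge has representatives over its two
    copies only, and one of these has no corner in the forward quadrant. *)
Lemma geodesic_step t p tau j : 0 <= t -> at_ t p -> 0 < tau -> seg P p u tau ->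
  dom j (~~ out_side u j) (om p) -> pe j (~~ out_side u j) (om p) = flow p u tau ->
  at_ (t + tau) (pe j (out_side u j) (om p + tr j (out_side u j))).
Proof.
move=> t0 ch tau0 sg dj E.
have [p' [ch' _ cl]] := geodesic_cross t0 ch sg tau0.
rewrite pe_tr -E in cl *.
case: (class_open_edge HP dj cl) => E'; last by rewrite negbK in E'; rewrite -E'.
case: ch' => c' _; rewrite E' in c'; have := edge_no_depart HP dj c'.
by case: (out_side u j).
Qed.

Lemma geodesic_vertex t p tau : 0 <= t -> at_ t p -> 0 < tau -> seg P p u tau ->
  vertex P (flow p u tau) -> exists2 p', vertex P p' & at_ (t + tau) p'.
Proof.
move=> t0 ch tau0 sg vx; have [p' [ch' _ cl]] := geodesic_cross t0 ch sg tau0.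
by exists p' => //; exact: class_vertex vx cl.
Qed.

End Steps.

Lemma avoid_countable (A : set R) l r : countable A -> l < r ->
  exists2 x, l < x < r & ~ A x.
Proof.
move=> cA lr; apply: contrapT => nx.
have sub : `]l, r[%classic `<=` A.
  move=> x /=; rewrite in_itv /= => hx; apply: contrapT => nA; apply: nx.
  by exists x.
have cI : countable `]l, r[%classic by exact: sub_countable (subset_card_le sub) cA.
have := countable_lebesgue_measure0 cI.
rewrite lebesgue_measure_itv /= lte_fin lr => /eqP.
by rewrite -EFinB eqe subr_eq0 gt_eqF.
Qed.

(** An aligned square, even if it crosses the boundary of the net, contains the
    image of a vertical segment drawn in the net: a generic vertical line can
    cross at most one horizontal edge before rising by the least difference of
    heights. *)
Lemma square_segment l A delta : aligned_square P l A -> 0 < delta ->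
  delta <= l / 2 ->
  (forall v v', vertex P v -> vertex P v' -> v.2 != v'.2 -> delta <= `|v.2 - v'.2|) ->
  exists p, forall r, 0 < r < delta -> U° (flow p (0, 1) r) /\
    forall q, A (cls (flow p (0, 1) r, q)).
Proof.
move=> [phi [Hphi AE]] d0 dl gap; pose up : R * R := (0, 1).
have l0 : 0 < l by lra.
have up0 : up.1 != 0 \/ up.2 != 0 by right; rewrite /= oner_eq0.
have z0 : rectangle ((0, 0), (l, l)) (0, 0) by rewrite /rectangle /= lexx ltW.
have [p0 [e0 [e00 c0 H0]]] := Hphi (0, 0) (true, true) z0 l0 l0.
have [e1 e10 H1] := corner_interior c0.
(* Abscissas from which a vertical line meets a vertex, at once or after
   crossing an identified horizontal edge. *)
pose bad : seq R := [seq (vtx x).1 | x : 'I_(npairs P) * bool * bool] ++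
  [seq (vtx xy.1).1 + (origin xy.2 false).1 - (origin xy.2 true).1 |
    xy : ('I_(npairs P) * bool * bool) * 'I_(npairs P)].
have [e2 e20 H2] := c0.
have [f [f0 f1 f2 f3 f4]] := below4 l0 e00 e10 e20.
have [x hx nbad] : exists2 x, p0.1 < x < p0.1 + f & ~ [set` bad] x.
  by apply: avoid_countable; [exact/finite_set_countable|rewrite ltrDl].
have {}nbad : x \notin bad by apply/negP.
pose a := x - p0.1.
have ha : 0 < a < f by rewrite /a; lras.
pose p1 : R * R := (x, p0.2).
pose g r := phi (a, r).
have flowE p s : flow p up s = (p.1, p.2 + s) by rewrite /flow /= mulr0 addr0 mulr1.
have rect t : 0 <= t <= l -> rectangle ((0, 0), (l, l)) (a, t).
  by rewrite /rectangle /= => ht; split; lras.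
have chg t : 0 <= t < l -> exists p, chart P g up (true, true) t p.
  move=> ht; have [|||p [e [e_0 c He]]] := Hphi (a, t) (true, true).
  - by apply: rect; lras.
  - by rewrite /=; lras.
  - by rewrite /=; lras.
  exists p; split=> //; exists e => // s hs; rewrite /g flowE.
  have := He 0 s; rewrite /shift /= !addr0 lexx e_0 hs => -> //.
have bchg t : 0 < t < l -> exists p, back_chart P g up (true, false) t p.
  move=> ht; have [|||p [e [e_0 c He]]] := Hphi (a, t) (true, false).
  - by apply: rect; lras.
  - by rewrite /=; lras.
  - by rewrite /=; lras.
  exists p; split=> //; exists e => // s hs; rewrite /g flowE.
  have := He 0 s; rewrite /shift /= !addr0 lexx e_0 hs => -> //.
have ch1 : chart P g up (true, true) 0 p1.
  split.
    exists (e2 - a) => [|y1 y2 hy1 hy2]; first by lras.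
    by have := H2 (a + y1) y2; rewrite /shift /= addrA /a subrKC; apply; rewrite -?/a; lras.
  exists e0 => // s hs; have := H0 a s; rewrite /shift /= !add0r /g flowE.
  rewrite /a subrKC hs => -> //; lras.
have seg1 : exists2 e, 0 < e & seg P p1 up e.
  exists e1 => // s hs; rewrite flowE; have := H1 a s.
  rewrite /shift /= /a subrKC; apply => //; rewrite -/a; lras.
have notx v : vertex P v -> v.1 != x.
  move=> /vertex_vtx [y ->]; apply: contra nbad => /eqP <-.
  by rewrite mem_cat; apply/orP; left; apply/fintype.imageP; exists y.
have notx' v i : vertex P v -> v.1 != x + ((origin i true).1 - (origin i false).1).
  move=> /vertex_vtx [y ->]; apply: contra nbad => /eqP E.
  rewrite mem_cat; apply/orP; right; apply/fintype.imageP; exists (y, i) => //=.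
  by rewrite E; ring.
(* a vertical line off the vertices leaves the region through horizontal edges *)
have exit_h p t : U (flow p up t) -> ~ U° (flow p up t) ->
    (forall v, vertex P v -> v.1 != p.1) ->
    exists i b s, [/\ horizontal i, 0 < s < len i & flow p up t = edge i b s].
  move=> U1 U2 nv; case: (boundary_split HP U1 U2) => [v|[i [b [s [hs E]]]]].
    by have := nv _ v; rewrite flowE /= eqxx.
  exists i, b, s; split => //; apply: contraT => hi.
  have v : vertex P (edge i b 0) by exists i, b; left.
  have := nv _ v; rewrite /edge (negPf hi) /=.
  have := congr1 fst E; rewrite flowE /edge (negPf hi) /= => ->.
  by rewrite eqxx.
have fin p t0 : 0 <= t0 -> t0 + delta <= l -> chart P g up (true, true) t0 p ->
    seg P p up delta -> forall r, 0 < r < delta -> U° (flow p up r) /\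
    forall q, A (cls (flow p up r, q)).
  move=> t00 tdl ch sg r hr; split=> [|q]; first exact: sg.
  rewrite (class_interior_quadrant q (true, true) (sg _ hr)).
  rewrite -(develop HP ch sg (q' := (true, false)) _ _ hr) => [|t ht|t ht]; last 2 first.
  - by apply: chg; lras.
  - by apply: bchg; lras.
  by rewrite AE; exists (a, t0 + r) => //; apply: rect; lras.
have [t1 t10 [sg1 U1 U1']] := exit_exists HP up0 seg1.
have [dt1|t1d] := leP delta t1.
  exists p1; apply: (fin p1 0) => //; first by lra.
  exact: seg_le dt1 sg1.
have [i [b [s [hi hs E1]]]] := exit_h p1 t1 U1 U1' notx.
have [||p' [ch' cy cl]] := develop_cross HP t10 ch1 sg1 (q' := (true, false)).
- by move=> t ht; apply: chg; lras.
- by move=> t ht; apply: bchg; lras.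
rewrite add0r in ch'; rewrite E1 in cy cl.
have hq c : side i true c = (true, c) by rewrite /side hi.
have bF : b = false.
  case: (b) cy (@edge_not_corner _ _ HP i b s true hs) => //.
  by rewrite hq.
have p'E : p' = edge i true s.
  rewrite bF in cl; case: (class_open_edge HP hs cl) => // E'.
  case: ch' => c' _; rewrite E' in c'.
  by case: (@edge_not_corner _ _ HP i false s true hs); rewrite hq.
have [e3 e30 H3] := edge_half HP true hs.
have seg2 : exists2 e, 0 < e & seg P p' up e.
  exists e3 => // r hr; rewrite flowE p'E.
  have := H3 0 r; rewrite normr0 /off hi /= addr0; exact.
have p'1 : p'.1 = x + ((origin i true).1 - (origin i false).1).
  have := congr1 fst E1; rewrite flowE p'E /edge hi bF /= => ->; ring.
have [t2 t20 [sg2 U2 U2']] := exit_exists HP up0 seg2.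
have [|j [b' [s' [hj hs' E2]]]] := exit_h p' t2 U2 U2'.
  by move=> v vx; rewrite p'1; exact: notx'.
exists p'; apply: (fin p' t1) => //; [exact: ltW|by lra|].
apply: seg_le sg2.
have v1 : vertex P (edge i true 0) by exists i, true; left.
have v2 : vertex P (edge j b' 0) by exists j, b'; left.
have E2' : (edge j b' 0).2 = (edge i true 0).2 + t2.
  have := congr1 snd E2; rewrite flowE p'E /edge hi hj /= => <-.
  by [].
have := gap _ _ v2 v1; rewrite E2' addrAC subrr add0r gtr0_norm //; apply.
by rewrite -subr_eq0 addrAC subrr add0r gt_eqF.
Qed.

End Geodesics.

(** * The first-return map to the edges *)

Section States.
Variables (R : realType) (P : net R) (alpha : R).
Hypothesis HP : polyrectangle_translation_surface P.
Hypothesis alpha0 : alpha != 0.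
Local Notation direction := (direction alpha).
Local Notation om := (om alpha).
Local Notation pe := (pe (P := P) alpha).
Local Notation dom := (dom (P := P) alpha).
Local Notation tr := (tr (P := P) alpha).
Local Notation hits := (hits (P := P) alpha).
Local Notation state := ('I_(npairs P) * R)%type.
Implicit Types (p u v : R * R) (i j : 'I_(npairs P)) (x y z : state).

Lemma direction_out u i : direction u -> out_side (rev_dir u) i = ~~ out_side u i.
Proof. by move=> /(direction_neq0 alpha0) [u1 u2]; exact: out_side_rev. Qed.

Lemma edge_transversal u i l r : direction u ->
  (forall w, l < w < r -> dom i (out_side u i) w) ->
  transversal P alpha u (pe i (out_side u i)) l r.
Proof.
move=> du H; split=> [w||w /H dw]; [exact: om_pe|exact: affine_pe|split].
  have [u1 u2] := direction_neq0 alpha0 du.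
  by apply: depart => //; exact: edge_depart.
move=> j s hs E; have [ij bb _] := edge_unique HP dw hs E.
by move: bb; rewrite ij; case: out_side.
Qed.

(** The edge [i] leads to the edge [j] along the flow line with transverse
    coordinate [w]. *)
Definition conn u i j w := dom i (out_side u i) w /\ hits u (pe i (out_side u i) w) j.

Lemma conn_rev u i j w : direction u -> conn u i j w -> conn (rev_dir u) j i w.
Proof.
move=> du [di [dj [t t0 [E st]]]]; rewrite om_pe // in dj E.
split; first by rewrite direction_out.
rewrite /hits /= om_pe // !direction_out // !negbK; split => //.
exists t => //; rewrite E; split; last exact: seg_rev.
by rewrite flow_rev flow_flow subrr flow0.
Qed.

Definition vertex_lines : seq R := [seq om (vtx x) | x : 'I_(npairs P) * bool * bool].

Lemma vertex_linesP v : vertex P v -> om v \in vertex_lines.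
Proof. by move=> /vertex_vtx [x ->]; apply/fintype.imageP; exists x. Qed.

Lemma conn_uniform u i l r w0 : direction u -> l < w0 < r ->
  (forall w, l < w < r -> w \notin vertex_lines) -> dom i (out_side u i) w0 ->
  exists j, forall w, l < w < r -> conn u i j w.
Proof.
move=> du hw nC di; have vf : vertex_free P alpha l r.
  by move=> v /vertex_linesP vC /nC; rewrite vC.
have dall w : l < w < r -> dom i (out_side u i) w.
  by move=> hw'; exact: (dom_spread alpha0 vf hw hw' di).
have [j Hj] := hits_uniform HP alpha0 du (edge_transversal du dall) vf hw.
by exists j => w hw'; split; [exact: dall|exact: Hj].
Qed.

Lemma conn_dom u i j w : conn u i j w ->
  dom j (out_side u j) (w + tr j (out_side u j)).
Proof. by move=> [_ [dj _]]; apply/dom_tr; rewrite om_pe in dj. Qed.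

Lemma conn_uniq u i j j' w : conn u i j w -> conn u i j' w -> j = j'.
Proof. by move=> [_ h] [_ h']; apply: (hits_uniq HP h h'). Qed.

Lemma conn_inj u i i' j w w' : direction u -> conn u i j w -> conn u i' j w' ->
  w + tr j (out_side u j) = w' + tr j (out_side u j) -> i = i' /\ w = w'.
Proof.
move=> du c c' /addIr E; split => //; rewrite -E in c'.
exact: conn_uniq (conn_rev du c) (conn_rev du c').
Qed.

Lemma dom_bound X i b w : (forall v, vertex P v -> `|om v| <= X) -> dom i b w -> `|w| <= X.
Proof.
move=> H /andP[s0 sl]; rewrite -[w](om_pe alpha0 i b) om_edge.
have v1 : vertex P (edge i b 0) by exists i, b; left.
have v2 : vertex P (edge i b (len i)) by exists i, b; right.
move: (H _ v1) (H _ v2); rewrite !om_edge mul0r addr0 !ler_norml.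
move: (spos _ _ _ _) s0 sl => s s0 sl /andP[h1 h2] /andP[h3 h4].
by have [k0|k0] := leP 0 (slope_of alpha i); apply/andP; split; nra.
Qed.

(** A state is an edge with a transverse coordinate, read on the copy from
    which the flow departs. *)
Definition valid u x := dom x.1 (out_side u x.1) x.2.
Definition pos u x := pe x.1 (out_side u x.1) x.2.
Definition step u x y := conn u x.1 y.1 x.2 /\ y.2 = x.2 + tr y.1 (out_side u y.1).
Fixpoint path u k x y : Prop :=
  if k is k'.+1 then exists2 x', step u x x' & path u k' x' y else y = x.

Lemma step_valid u x y : step u x y -> valid u y.
Proof. by move=> [c E]; rewrite /valid E; exact: conn_dom c. Qed.

Lemma path_valid u k x y : valid u x -> path u k x y -> valid u y.
Proof. by elim: k x => [|k IH] x vx /= => [->|[x' /step_valid vx' /(IH _ vx')]]. Qed.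

Lemma step_uniq u x y y' : step u x y -> step u x y' -> y = y'.
Proof.
case: y y' => [j w] [j' w'] [c /= E] [c' /= E'].
have jj : j = j' := conn_uniq c c'.
by rewrite E E' jj.
Qed.

Lemma path_uniq u k x y y' : path u k x y -> path u k x y' -> y = y'.
Proof.
elim: k x => [|k IH] x /=; first by move=> -> ->.
move=> [x1 s1 p1] [x2 s2 p2]; have E := step_uniq s1 s2.
by rewrite -E in p2; exact: IH p1 p2.
Qed.

Lemma path_add u k l x y z : path u k x y -> path u l y z -> path u (k + l) x z.
Proof.
elim: k x => [|k IH] x /=; first by move=> ->.
by move=> [x' sx px] pl; exists x' => //; exact: IH px pl.
Qed.

Lemma path_split u k l x z : path u (k + l) x z -> exists2 y, path u k x y & path u l y z.
Proof.
elim: k x => [|k IH] x /=; first by exists x.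
by move=> [x' sx /IH [y py pl]]; exists y => //; exists x'.
Qed.

(** The same point of the surface as a state of the reversed flow, which
    departs from the other copy of the edge. *)
Definition conv u x : state := (x.1, x.2 - tr x.1 (out_side u x.1)).

Lemma convK u x : direction u -> conv (rev_dir u) (conv u x) = x.
Proof.
move=> du; case: x => i w; rewrite /conv /= direction_out // tr_neg opprK subrK.
by [].
Qed.

Lemma convK' u x : direction u -> conv u (conv (rev_dir u) x) = x.
Proof. by move=> du; have := convK x (direction_rev du); rewrite rev_dirK. Qed.

Lemma conv_valid u x : direction u -> valid u x -> valid (rev_dir u) (conv u x).
Proof.
move=> du; rewrite /valid /conv /= direction_out // => vx.
by apply/dom_tr; rewrite subrK.
Qed.

Lemma step_rev u x y : direction u -> step u x y ->
  step (rev_dir u) (conv u y) (conv u x).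
Proof.
move=> du [c E]; split; rewrite /= E addrK; first exact: conn_rev.
by rewrite direction_out // tr_neg.
Qed.

Lemma path_rev u k x y : direction u -> path u k x y ->
  path (rev_dir u) k (conv u y) (conv u x).
Proof.
move=> du; elim: k x => [|k IH] x /=; first by move=> ->.
move=> [x' sx /IH px].
suff : path (rev_dir u) (k + 1) (conv u y) (conv u x) by rewrite addn1.
apply: path_add px _; by exists (conv u x); first exact: step_rev.
Qed.

Lemma path_inj u k x x' y : direction u -> path u k x y -> path u k x' y -> x = x'.
Proof.
move=> du /(path_rev du) h /(path_rev du) h'.
have := path_uniq h h'.
by move=> /(congr1 (conv (rev_dir u))); rewrite !convK.
Qed.

Definition vertex_ahead u p := exists t v,
  [/\ 0 < t, vertex P v, flow p u t = v & seg P p u t].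

Lemma step_exists u x : direction u -> valid u x ->
  (exists y, step u x y) \/ vertex_ahead u (pos u x).
Proof.
move=> du vx; have [u1 u2] := direction_neq0 alpha0 du.
have dep : exists2 e, 0 < e & seg P (pos u x) u e.
  by apply: depart => //; exact: edge_depart.
case: (exit_hits HP alpha0 du dep) => [[j hj]|]; last by right.
by left; exists (j, x.2 + tr j (out_side u j)).
Qed.

Lemma dom_open i b w : dom i b w -> exists2 e, 0 < e &
  forall w', `|w' - w| < e -> dom i b w'.
Proof.
move=> /andP[h1 h2]; have af := affine_spos alpha i b.
have al : affine (fun w => len i - spos alpha i b w).
  by apply: affineB => //; exists (len i), 0 => y; rewrite mul0r addr0.
have h2' : 0 < len i - spos alpha i b w by rewrite subr_gt0.
have [e1 e10 H1] := affine_pos_near af h1.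
have [e2 e20 H2] := affine_pos_near al h2'.
exists (Num.min e1 e2); first by rewrite lt_min e10.
by move=> w'; rewrite lt_min => /andP[/H1 a1 /H2]; rewrite subr_gt0 /dom a1.
Qed.

Lemma step_locally u x y : direction u -> step u x y -> exists2 e, 0 < e &
  forall w, `|w - x.2| < e -> step u (x.1, w) (y.1, w + tr y.1 (out_side u y.1)).
Proof.
move=> du [[dx hx] E]; have [e e0 He] := dom_open dx.
have dall w : x.2 - e < w < x.2 + e -> dom x.1 (out_side u x.1) w.
  by move=> hw; apply: He; rewrite ltr_norml; lras.
have hx2 : x.2 - e < x.2 < x.2 + e by lras.
have [e' e'0 H] := hits_locally HP alpha0 du (edge_transversal du dall) hx2 hx.
by exists e' => // w /H [hw hw']; split=> //; split => //; exact: dall.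
Qed.

(** Along a path that meets no vertex, nearby states take the same edges. *)
Lemma path_locally u k x y : direction u -> path u k x y -> exists2 e, 0 < e &
  forall w, `|w - x.2| < e -> path u k (x.1, w) (y.1, y.2 + (w - x.2)).
Proof.
move=> du; elim: k x => [|k IH] x /=.
  by move=> ->; exists 1 => // w _; rewrite subrKC.
move=> [x' sx /IH [e e0 He]]; have [e' e'0 He'] := step_locally du sx.
exists (Num.min e e'); first by rewrite lt_min e0.
move=> w; rewrite lt_min => /andP[h1 h2].
exists (x'.1, w + tr x'.1 (out_side u x'.1)); first exact: He'.
have Ex : x'.2 = x.2 + tr x'.1 (out_side u x'.1) by case: sx.
have E : w + tr x'.1 (out_side u x'.1) - x'.2 = w - x.2 by rewrite Ex; ring.
by rewrite -E; apply: He; rewrite E.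
Qed.

(** * Generic coordinates *)

Variable E : seq R.

Definition tr_sum (l : seq ('I_(npairs P) * bool)) : R := \sum_(c <- l) tr c.1 c.2.

(** The sums range over all finite sequences of identifications, realized by
    an orbit or not: no orbit through a generic coordinate ever has a
    coordinate in [E], and the exceptions are countable. *)
Definition gen (w : R) := forall l, w + tr_sum l \notin E.

Lemma gen_tr w i b : gen w -> gen (w + tr i b).
Proof. by move=> g l; have := g ((i, b) :: l); rewrite /tr_sum big_cons addrA. Qed.

Lemma gen_step u x y : step u x y -> gen x.2 -> gen y.2.
Proof. by move=> [_ ->]; exact: gen_tr. Qed.

Lemma gen_conv u x : gen x.2 -> gen (conv u x).2.
Proof. by move=> g; rewrite /conv /= -tr_neg; exact: gen_tr. Qed.

Lemma gen_path u k x y : path u k x y -> gen x.2 -> gen y.2.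
Proof. by elim: k x => [|k IH] x /= => [->|[x' /gen_step sx /IH px /sx]]. Qed.

Lemma gen_E w : gen w -> w \notin E.
Proof. by move=> /(_ [::]); rewrite /tr_sum big_nil addr0. Qed.

Lemma gen_dense l r : l < r -> exists2 w, l < w < r & gen w.
Proof.
move=> lr; pose A : set R :=
  \bigcup_(c in [set: seq ('I_(npairs P) * bool)]) [set w | w + tr_sum c \in E].
have cA : countable A.
  apply: bigcup_countable => // c _; apply: finite_set_countable.
  apply: (@sub_finite_set _ _ [set` [seq e - tr_sum c | e <- E]]) => // w /= wE.
  by apply/mapP; exists (w + tr_sum c) => //; rewrite addrK.
have [w hw nA] := avoid_countable cA lr; exists w => // c; apply/negP => wE.
by apply: nA; exists c.
Qed.

End States.

(** * Absence of saddle connections *)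

Section Minimality.
Variables (R : realType) (P : net R) (alpha : R).
Hypothesis HP : polyrectangle_translation_surface P.
Hypothesis alpha0 : alpha != 0.
Hypothesis alphaK : ~ field_gen (coordinate P) alpha.
Local Notation direction := (direction alpha).
Local Notation om := (om alpha).
Local Notation pe := (pe (P := P) alpha).
Local Notation tr := (tr (P := P) alpha).
Local Notation hits := (hits (P := P) alpha).
Local Notation valid := (valid (P := P) alpha).
Local Notation pos := (pos (P := P) alpha).
Local Notation step := (step (P := P) alpha).
Local Notation path := (path (P := P) alpha).
Local Notation conv := (conv (P := P) alpha).
Local Notation state := ('I_(npairs P) * R)%type.
Implicit Types (p u v : R * R) (i j : 'I_(npairs P)) (x y z : state).

Definition in_field (p : R * R) := field_gen (coordinate P) p.1 /\ field_gen (coordinate P) p.2.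

Lemma field_genB s t : field_gen (coordinate P) s -> field_gen (coordinate P) t ->
  field_gen (coordinate P) (s - t).
Proof. move=> hs ht F FP HF; have [_ FB _] := FP; apply: FB; [exact: hs FP HF|exact: ht FP HF]. Qed.

Lemma field_genD s t : field_gen (coordinate P) s -> field_gen (coordinate P) t ->
  field_gen (coordinate P) (s + t).
Proof.
move=> hs ht; rewrite (_ : s + t = s - ((t - t) - t)); last by ring.
by apply: field_genB => //; apply: field_genB => //; exact: field_genB.
Qed.

Lemma in_fieldB p p' : in_field p -> in_field p' -> in_field (p - p').
Proof. by move=> [h1 h2] [h3 h4]; split; exact: field_genB. Qed.

Lemma in_fieldD p p' : in_field p -> in_field p' -> in_field (p + p').
Proof. by move=> [h1 h2] [h3 h4]; split; exact: field_genD. Qed.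

Lemma vertex_in_field v : vertex P v -> in_field v.
Proof. by move=> vv; split=> F _; apply; exists v => //; [left|right]. Qed.

Lemma origin_in_field i b : in_field (origin i b).
Proof.
rewrite (_ : origin i b = edge i b 0); first by apply: vertex_in_field; exists i, b; left.
by rewrite /edge; case: ifP => _; rewrite addr0 -surjective_pairing.
Qed.

(** [q] is reached from [p] by a positive time of flow and some identifications,
    as far as the field of the coordinates can tell. *)
Definition rel u p q := exists t c, [/\ 0 < t, in_field c & q = flow p u t + c].

Lemma rel_trans u p q r : rel u p q -> rel u q r -> rel u p r.
Proof.
move=> [t [c [t0 hc ->]]] [t' [c' [t'0 hc' ->]]]; exists (t + t'), (c + c').
split; [exact: addr_gt0|exact: in_fieldD|].
by rewrite /flow /=; congr pair; rewrite /=; ring.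
Qed.

(** A displacement with both coordinates in the field has its slope in the
    field. Hence the flow has no saddle connections and no closed orbits. *)
Lemma no_displacement u t c : direction u -> 0 < t -> in_field c ->
  t * u.1 = c.1 -> t * u.2 = c.2 -> False.
Proof.
move=> [u1 u2] t0 [h1 h2] E1 E2; apply: alphaK => F FP HF.
have c0 : c.1 != 0 by rewrite -E1 mulf_neq0 // gt_eqF.
have -> : alpha = c.2 / c.1.
  by rewrite -E2 u2 -E1; field; rewrite u1 gt_eqF.
by have [_ _ Fd] := FP; apply: Fd; [exact: h2 FP HF|exact: h1 FP HF].
Qed.

Lemma rel_irrefl u p : direction u -> ~ rel u p p.
Proof.
move=> du [t [c [t0 hc E]]].
have [E1 E2] : p.1 = p.1 + t * u.1 + c.1 /\ p.2 = p.2 + t * u.2 + c.2.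
  by rewrite {1 3}E /=.
have z : in_field (c - c - c) by apply: in_fieldB => //; exact: in_fieldB.
by apply: (no_displacement du t0 z); rewrite /=; lra.
Qed.

Lemma rel_vertex u v v' : direction u -> vertex P v -> vertex P v' -> ~ rel u v v'.
Proof.
move=> du /vertex_in_field hv /vertex_in_field hv' [t [c [t0 hc E]]].
have z : in_field (v' - v - c) by apply: in_fieldB => //; exact: in_fieldB.
by apply: (no_displacement du t0 z); rewrite E /=; ring.
Qed.

Lemma rel_vertex_ahead u p : vertex_ahead P u p -> exists2 v, vertex P v & rel u p v.
Proof.
move=> [t [v [t0 vv E _]]]; exists v => //; exists t, (v - v); split => //.
  by apply: in_fieldB; exact: vertex_in_field.
by rewrite E subrr addr0.
Qed.

Lemma rel_hits u p j : hits u p j ->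
  rel u p (pos u (j, om p + tr j (out_side u j))).
Proof.
move=> [_ [t t0 [E _]]]; exists t, (origin j (out_side u j) - origin j (~~ out_side u j)).
split => //; first by apply: in_fieldB; exact: origin_in_field.
rewrite -E /pos /= pe_tr /pe /edge.
by case: ifP => _; congr pair => /=; ring.
Qed.

Lemma rel_step u x y : direction u -> step u x y -> rel u (pos u x) (pos u y).
Proof.
move=> du; case: y => j w [[_ h] /= ->]; have := rel_hits h.
by rewrite /pos om_pe.
Qed.

Lemma rel_path u k x y : direction u -> path u k.+1 x y -> rel u (pos u x) (pos u y).
Proof.
move=> du; elim: k x => [|k IH] x [x' sx]; first by move=> /= ->; exact: rel_step.
by move=> /IH; apply: rel_trans; exact: rel_step.
Qed.

(** * Hitting a target interval *)

Variable E : seq R.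
Hypothesis EC : {subset vertex_lines P alpha <= E}.
Local Notation gen := (gen P alpha E).

Lemma gen_vertex p v u t : direction u -> gen (om p) -> vertex P v -> flow p u t <> v.
Proof.
move=> du g /(vertex_linesP alpha)/EC vE E'.
by have := gen_E g; rewrite -(om_flow p t du) E' vE.
Qed.

Lemma gen_next u x : direction u -> valid u x -> gen x.2 -> exists y, step u x y.
Proof.
move=> du vx g; case: (step_exists HP alpha0 du vx) => // -[t [v [_ vv Ev _]]].
have g' : gen (om (pos u x)) by rewrite /pos om_pe.
by case: (gen_vertex (t := t) du g' vv).
Qed.

Variables (i0 : 'I_(npairs P)) (N : nat).
Definition target a b x := x.1 = i0 /\ a < x.2 < b.
Definition Hit u a b x := exists k y, path u k x y /\ target a b y.
(** Only generic states are considered; [E] is going to contain the ends of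
    the target, so that their orbits neither end at a vertex nor visit such an
    end. *)
Definition recurrent u a b := forall x, valid u x -> gen x.2 -> target a b x ->
  exists k y, [/\ (0 < k <= N)%N, path u k x y & target a b y].
(** The offset between the coordinates on the edge [i0] for the flow and for
    its reverse. *)
Definition jump u := tr i0 (out_side u i0).
Definition recurrent2 u a b :=
  recurrent u a b /\ recurrent (rev_dir u) (a - jump u) (b - jump u).

Lemma jump_rev u : direction u -> jump (rev_dir u) = - jump u.
Proof. by move=> du; rewrite /jump (direction_out alpha0) // tr_neg. Qed.

Lemma target_conv u a b x : target (a - jump u) (b - jump u) (conv u x) <-> target a b x.
Proof.
rewrite /target /conv /=; split=> -[e h]; split=> //; move: h; rewrite e /jump => h; lras.
Qed.

Lemma recurrent2_rev u a b : direction u -> recurrent2 u a b ->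
  recurrent2 (rev_dir u) (a - jump u) (b - jump u).
Proof.
by move=> du [h1 h2]; split => //; rewrite rev_dirK jump_rev // !opprK !subrK.
Qed.

Lemma hit_back u a b k x z : direction u -> recurrent2 u a b -> valid u x -> gen x.2 ->
  path u k x z -> target a b z ->
  exists k' z', [/\ (0 < k' <= N)%N, path (rev_dir u) k' (conv u z) (conv u z') &
    target a b z'].
Proof.
move=> du [_ rb] vx g pz tz.
have vz := path_valid alpha0 vx pz; have gz := gen_path pz g.
have [|||k' [y [hk py ty]]] := rb (conv u z).
- exact: conv_valid.
- exact: gen_conv.
- exact/target_conv.
exists k', (conv (rev_dir u) y); rewrite (convK' alpha0) //; split => //.
by apply/(target_conv u); rewrite (convK' alpha0).
Qed.

Lemma path_rev' u k x y : direction u -> path (rev_dir u) k (conv u y) (conv u x) ->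
  path u k x y.
Proof.
move=> du /(path_rev alpha0 (direction_rev du)).
by rewrite rev_dirK !(convK alpha0).
Qed.

(** A first visit cannot be late: on tracing the flow back from it, the target
    is met again within [N] steps. *)
Lemma hit_bound u a b k x z : direction u -> recurrent2 u a b -> valid u x -> gen x.2 ->
  path u k x z -> target a b z ->
  exists k' z', [/\ (k' <= N)%N, path u k' x z' & target a b z'].
Proof.
move=> du rb vx g; elim/ltn_ind: k z => k IH z pz tz.
have [kN|Nk] := leqP k N; first by exists k, z.
have [k' [z' [/andP[k'0 k'N] pb tz']]] := hit_back du rb vx g pz tz.
have pz' := path_rev' du pb.
have k'k : (k' <= k)%N by rewrite (leq_trans k'N) // ltnW.
rewrite -(subnK k'k) in pz; have [y py pyz] := path_split pz.
have yz' := path_inj HP alpha0 du pyz pz'; rewrite yz' in py.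
by apply: (IH (k - k')%N _ z') => //; lia.
Qed.

Lemma hit_step u a b x y : recurrent2 u a b -> valid u x -> gen x.2 ->
  step u x y -> Hit u a b x <-> Hit u a b y.
Proof.
move=> rb vx g sxy; split=> [[k [z [pz tz]]]|[k [z [pz tz]]]]; last first.
  by exists k.+1, z; split => //; exists y.
have [k1 [z1 [p1 t1]]] : exists k z, path u k.+1 x z /\ target a b z.
  case: k pz => [/= zx|k pz]; last by exists k, z.
  rewrite zx in tz; have [[|k] [y' [// _ py ty]]] := rb.1 x vx g tz.
  by exists k, y'.
by case: p1 => x' /(step_uniq HP sxy) <- p1; exists k1, z1.
Qed.

(** The reversed orbit from a visit returns to the target within [N] steps:
    either beyond [x], which is a visit of the reversed orbit of [x], or
    before [x] is reached, at an earlier visit of the orbit of [x]. *)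
Lemma hit_rev u a b x : direction u -> recurrent2 u a b -> valid u x -> gen x.2 ->
  Hit u a b x -> Hit (rev_dir u) (a - jump u) (b - jump u) (conv u x).
Proof.
move=> du rb vx g [k [z [pz tz]]]; elim/ltn_ind: k z pz tz => k IH z pz tz.
case: k IH pz => [|k] IH pz.
  by exists 0%N, (conv u x); split => //; apply/target_conv; rewrite -[x]pz.
have [k' [z' [/andP[k'0 k'N] pb tz']]] := hit_back du rb vx g pz tz.
have [k'k|kk'] := leqP k' k.+1.
  have pz' := path_rev' du pb.
  rewrite -(subnK k'k) in pz; have [y py pyz] := path_split pz.
  have yz' := path_inj HP alpha0 du pyz pz'; rewrite yz' in py.
  by apply: (IH (k.+1 - k')%N _ z') => //; lia.
rewrite -(subnK (ltnW kk')) addnC in pb; have [y py pyz] := path_split pb.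
have yx := path_uniq HP py (path_rev alpha0 du pz); rewrite yx in pyz.
by exists (k' - k.+1)%N, (conv u z'); split => //; apply/target_conv.
Qed.

Lemma hit_rev_iff u a b x : direction u -> recurrent2 u a b -> valid u x -> gen x.2 ->
  Hit u a b x <-> Hit (rev_dir u) (a - jump u) (b - jump u) (conv u x).
Proof.
move=> du rb vx g; split; first exact: hit_rev.
move=> /(hit_rev (direction_rev du) (recurrent2_rev du rb) (conv_valid alpha0 du vx) (gen_conv u g)).
by rewrite rev_dirK jump_rev // !opprK !subrK (convK alpha0).
Qed.

(** Up to the first vertex or the first visit to the closed target, all nearby
    orbits run parallel to that of [x]. *)
Lemma itinerary_cases u a b n x : direction u -> valid u x ->
  [\/ exists k y, [/\ (k <= n)%N, path u k x y & vertex_ahead P u (pos u y)],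
      exists k y, [/\ (k <= n)%N, path u k x y, y.1 = i0 & a <= y.2 <= b] |
      exists2 e, 0 < e & forall w, `|w - x.2| < e -> forall k y, (k <= n)%N ->
        path u k (x.1, w) y -> ~ target a b y].
Proof.
move=> du; elim: n x => [|n IH] x vx.
all: case: (pselect (x.1 = i0 /\ a <= x.2 <= b)) => [[xi xab]|nx];
  [by apply: Or32; exists 0%N, x|].
all: have [e1 e10 He1] : exists2 e, 0 < e & forall w, `|w - x.2| < e -> ~ target a b (x.1, w).
1,3: case: (eqVneq x.1 i0) => [xi|xi]; last by exists 1 => // w _ [/eqP]; rewrite (negPf xi).
1,2: have [h|h] := ltP x.2 a.
1,3: by exists (a - x.2) => [|w]; [rewrite subr_gt0|rewrite ltr_norml => hw [_ /= hw']; lras].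
1,2: exists (x.2 - b) => [|w]; last by rewrite ltr_norml => hw [_ /= hw']; lras.
1,2: by rewrite subr_gt0 ltNge; apply/negP => h'; apply: nx; rewrite h h'.
  apply: Or33; exists e1 => // w hw [|k] // y _ /= ->; exact: He1.
case: (step_exists HP alpha0 du vx) => [[y sxy]|va]; last by apply: Or31; exists 0%N, x.
case: (IH y (step_valid alpha0 sxy)) => [[k [z [kn pz vz]]]|[k [z [kn pz z1 z2]]]|[e e0 He]].
- by apply: Or31; exists k.+1, z; split => //; exists y.
- by apply: Or32; exists k.+1, z; split => //; exists y.
have [e2 e20 He2] := step_locally HP alpha0 du sxy.
apply: Or33; exists (Num.min e (Num.min e1 e2)); first by rewrite !lt_min e0 e10.
move=> w; rewrite !lt_min => /and3P[h h1 h2] [|k] z kn /=.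
  by move=> ->; exact: He1.
move=> [x' /(step_uniq HP (He2 w h2)) <-]; apply: (He _ _ k) => //.
have -> : y.2 = x.2 + tr y.1 (out_side u y.1) by case: sxy.
by rewrite opprD addrACA subrr addr0.
Qed.

End Minimality.

(** * Minimality *)

Section Density.
Variables (R : realType) (P : net R) (alpha : R).
Hypothesis HP : polyrectangle_translation_surface P.
Hypothesis alpha0 : alpha != 0.
Hypothesis alphaK : ~ field_gen (coordinate P) alpha.
Local Notation U := (region P).
Local Notation direction := (direction alpha).
Local Notation om := (om alpha).
Local Notation pe := (pe (P := P) alpha).
Local Notation tr := (tr (P := P) alpha).
Local Notation hits := (hits (P := P) alpha).
Local Notation valid := (valid (P := P) alpha).
Local Notation pos := (pos (P := P) alpha).
Local Notation step := (step (P := P) alpha).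
Local Notation path := (path (P := P) alpha).
Local Notation conv := (conv (P := P) alpha).
Local Notation state := ('I_(npairs P) * R)%type.
Implicit Types (p u v z : R * R) (i j : 'I_(npairs P)) (x y : state).

Variable E : seq R.
Hypothesis EC : {subset vertex_lines P alpha <= E}.
Local Notation gen := (gen P alpha E).
Variables (i0 : 'I_(npairs P)) (N : nat).
Local Notation target := (target i0).
Local Notation Hit := (Hit alpha i0).
Local Notation jump := (jump alpha i0).
Local Notation recurrent2 := (recurrent2 alpha E i0 N).
Local Notation rel := (rel P).

(** [s] may be negative. *)
Lemma hits_slide u p s j : direction u ->
  (forall r, 0 <= r <= s \/ s <= r <= 0 -> U° (flow p u r)) ->
  hits u p j -> hits u (flow p u s) j.
Proof.
move=> du H [dj [t t0 [Et st]]]; rewrite /hits om_flow //; split => //.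
have ts : s < t.
  rewrite ltNge; apply/negP => ts.
  have hj : 0 <= spos alpha j (~~ out_side u j) (om p) <= len j.
    by case/andP: dj => /ltW -> /ltW ->.
  have [_] := edge_boundary HP (~~ out_side u j) hj; apply.
  by rewrite -/(pe _ _ _) Et; apply: H; left; lras.
exists (t - s); first by lra.
split; first by rewrite flow_flow subrKC.
move=> r hr; rewrite flow_flow; have [h|h] := leP (s + r) 0.
  by apply: H; right; lras.
by apply: st; lras.
Qed.

Definition box z e p := `|p.1 - z.1| < e /\ `|p.2 - z.2| < e.

Lemma box_between (z p : R * R) u e s r : box z e p -> box z e (flow p u s) ->
  0 <= r <= s \/ s <= r <= 0 -> box z e (flow p u r).
Proof.
have H (x d c : R) : `|x - c| < e -> `|x + s * d - c| < e ->
    0 <= r <= s \/ s <= r <= 0 -> `|x + r * d - c| < e.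
  rewrite !ltr_norml => /andP[h1 h2] /andP[h3 h4].
  by case=> /andP[h5 h6]; have [h7|h7] := leP 0 d; apply/andP; split; nra.
by move=> [h1 h2] [h3 h4] h; split; apply: H.
Qed.

(** The vertical transversal through [z]. *)
Definition vert (z : R * R) (w : R) : R * R := (z.1, z.2 + (w - om z)).

Lemma om_vert z w : om (vert z w) = w.
Proof. by rewrite /vert /om /=; ring. Qed.

Lemma vert_transversal u z e : direction u -> (forall p, box z e p -> U° p) ->
  transversal P alpha u (vert z) (om z - e) (om z + e).
Proof.
move=> du H; split=> [w||w hw]; first exact: om_vert.
  by exists z.1, 0 => w; rewrite mul0r addr0.
have e0 : 0 < e by lras.
have Uw : U° (vert z w).
  apply: H; split; rewrite /vert /= ?subrr ?normr0 //.
  by rewrite addrAC subrr add0r ltr_norml; lras.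
split; last first.
  by move=> j s hs Ej; have [_] := edge_boundary HP (~~ out_side u j) hs; rewrite -Ej.
have [u1 u2] := direction_neq0 alpha0 du.
by apply: depart => //; exact: interior_corner.
Qed.

Definition hits_target u a b (z : R * R) := exists j, hits u z j /\
  Hit u a b (j, om z + tr j (out_side u j)).

(** Near [z] it does not depend on the point whether its orbit visits the
    target. Generic points have infinite orbits and are dense, so they decide. *)
Definition settled u a b z (c : bool) := exists2 e, 0 < e & forall p, box z e p ->
  U° p -> gen (om p) -> (hits_target u a b p <-> c).
Definition settled_state u a b x (c : bool) := exists2 e, 0 < e &
  forall w, `|w - x.2| < e -> gen w -> (Hit u a b (x.1, w) <-> c).

(** The edge hit first is the same for all points near [z], and the coordinate
    there depends continuously on the point. *)
Lemma settled_next u a b z j c : direction u -> U° z -> hits u z j ->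
  settled_state u a b (j, om z + tr j (out_side u j)) c -> settled u a b z c.
Proof.
move=> du Uz hj [e e0 He].
have [e1 e10 H1] := interior_box_open Uz.
have H1' p : box z e1 p -> U° p by move=> [h1 h2]; exact: H1.
have tv := vert_transversal du H1'.
have omz : om z - e1 < om z < om z + e1 by lras.
have vz : vert z (om z) = z by rewrite /vert subrr addr0 -surjective_pairing.
have hj' : hits u (vert z (om z)) j by rewrite vz.
have [e2 e20 H2] := hits_locally HP alpha0 du tv omz hj'.
have [f [f0 f1 f2 f3]] := below3 e10 e0 e20; pose k := 1 + `|alpha|.
have k1 : 1 <= k by rewrite lerDl.
have k0 : 0 < k by lra.
have fk : f / k <= f by rewrite ler_pdivrMr // ler_peMr // ltW.
exists (f / k); first exact: divr_gt0.
move=> p [p1 p2] Up gp.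
have omp : `|om p - om z| < f.
  have -> : om p - om z = (p.2 - z.2) - alpha * (p.1 - z.1) by rewrite /om; ring.
  rewrite (le_lt_trans (ler_normB _ _)) // normrM.
  have -> : f = f / k + `|alpha| * (f / k) by rewrite /k; field; rewrite gt_eqF.
  by rewrite ltr_leD // ler_wpM2l // ltW.
have [_ hv] := H2 (om p) (lt_le_trans omp f3).
have bp : box z e1 p by split; rewrite (lt_le_trans _ f1) // (lt_le_trans _ fk).
have bv : box z e1 (vert z (om p)).
  split; rewrite /vert /= ?subrr ?normr0 //.
  by rewrite addrAC subrr add0r (lt_le_trans omp).
have hp : hits u p j.
  have Ep := flow_om (p := vert z (om p)) (z := p) du (om_vert _ _).
  rewrite -Ep; apply: hits_slide => // r hr; apply: H1'.
  by apply: box_between hr => //; rewrite Ep.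
have := He (om p + tr j (out_side u j)).
rewrite /= opprD addrACA subrr addr0 => /(_ (lt_le_trans omp f2) (gen_tr _ _ gp)) <-.
split=> [[j' [hp' Hj']]|Hj]; last by exists j.
by rewrite (hits_uniq HP hp hp').
Qed.

Lemma step_valid_src u x y : step u x y -> valid u x.
Proof. by move=> [[]]. Qed.

Lemma settled_step u a b x y c : direction u -> recurrent2 u a b -> step u x y ->
  settled_state u a b y c -> settled_state u a b x c.
Proof.
move=> du rb sxy [e e0 He]; have [e1 e10 H1] := step_locally HP alpha0 du sxy.
exists (Num.min e e1); first by rewrite lt_min e0.
move=> w; rewrite lt_min => /andP[h h1] g.
have sw := H1 w h1; have yE : y.2 = x.2 + tr y.1 (out_side u y.1) by case: sxy.
rewrite (hit_step HP rb (step_valid_src sw) g sw) -(He (w + tr y.1 (out_side u y.1))) //.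
  by rewrite yE opprD addrACA subrr addr0.
exact: gen_tr.
Qed.

(** The states on the boundary of the set of states whose orbits visit the
    target. *)
Definition bad u a b x := valid u x /\ forall c, ~ settled_state u a b x c.

Lemma bad_path u a b k x y : direction u -> recurrent2 u a b -> bad u a b x ->
  path u k x y -> bad u a b y.
Proof.
move=> du rb; elim: k x => [|k IH] x bx /=; first by move=> ->.
move=> [x' sx]; apply: IH; split; first exact: step_valid sx.
by move=> c /(settled_step du rb sx); exact: bx.2.
Qed.

(** If the orbit met neither a vertex nor the closed target within [N] steps,
    nearby orbits would run parallel and miss the target for [N] steps, hence
    for ever by [hit_bound]; if it met the open target, nearby orbits would
    meet it too. *)
Lemma bad_next u a b x : direction u -> recurrent2 u a b -> bad u a b x ->
  (exists2 v, vertex P v & rel u (pos u x) v) \/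
  exists y, [/\ bad u a b y, y.1 = i0, y.2 = a \/ y.2 = b & rel u (pos u x) (pos u y)].
Proof.
move=> du rb bx; have [vx _] := bx.
case: (step_exists HP alpha0 du vx) => [[x1 s1]|/rel_vertex_ahead]; last by left.
have b1 : bad u a b x1 by apply: (bad_path (k := 1) du rb bx); exists x1.
have pathS k y : path u k x1 y -> path u k.+1 x y by exists x1.
case: (itinerary_cases HP alpha0 i0 a b N du b1.1).
- move=> [k [y [_ /pathS py /rel_vertex_ahead [v vv ry]]]]; left; exists v => //.
  exact: rel_trans (rel_path alpha0 du py) ry.
- move=> [k [y [_ py y1 yab]]]; right; exists y; split => //; last 2 first.
  + have [h|h|<-] := ltgtP a y.2; [|lras|by left].
    have [h'|h'|->] := ltgtP y.2 b; [|lras|by right].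
    exfalso; apply: (b1.2 true); have [e e0 He] := path_locally HP alpha0 du py.
    have [|||f [f0 f1 f2 f3]] := @below3 _ e (y.2 - a) (b - y.2); rewrite ?subr_gt0 //.
    exists f => // w hw _; split=> // _; exists k, (y.1, y.2 + (w - x1.2)); split.
      by apply: He; exact: lt_le_trans f1.
    by split => //=; move: hw; rewrite ltr_norml => hw; lras.
  + exact (rel_path alpha0 du (pathS _ _ py)).
  + exact: bad_path du rb b1 py.
move=> [e e0 He]; exfalso; apply: (b1.2 false).
have [e1 e10 He1] := dom_open b1.1.
exists (Num.min e e1); first by rewrite lt_min e0.
move=> w; rewrite lt_min => /andP[hw hw1] g; split=> // -[k [y [py ty]]].
have vw : valid u (x1.1, w) by exact: He1.
have [k' [z [k'N pz tz]]] := hit_bound HP alpha0 du rb vw g py ty.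
by case: (He w hw k' z k'N pz tz).
Qed.

(** Bad orbits stay bad, so that without a vertex they would meet an end of
    the target three times, and one of the two ends twice; but there are no
    closed orbits. *)
Lemma bad_vertex u a b x : direction u -> recurrent2 u a b -> bad u a b x ->
  exists2 v, vertex P v & rel u (pos u x) v.
Proof.
move=> du rb bx; have nx := fun x => @bad_next u a b x du rb.
have [//|[y1 [b1 i1 e1 r1]]] := nx _ bx.
have [[v vv r2]|[y2 [b2 i2 e2 r2]]] := nx _ b1.
  by exists v => //; exact: rel_trans r2.
have r12 := rel_trans r1 r2.
have [[v vv r3]|[y3 [b3 i3 e3 r3]]] := nx _ b2.
  by exists v => //; exact: rel_trans r3.
have ends (y y' : state) : y.1 = i0 -> y'.1 = i0 -> y.2 = y'.2 -> rel u (pos u y) (pos u y') -> False.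
  move=> h h' h''; rewrite (_ : y = y'); first exact: (rel_irrefl alphaK du).
  by rewrite [y]surjective_pairing [y']surjective_pairing h h' h''.
exfalso; have r23 := rel_trans r2 r3.
case: e1 e2 e3 => h1 [] h2 [] h3.
- by apply: (ends y1 y2 i1 i2 _ r2); rewrite h1 h2.
- by apply: (ends y1 y2 i1 i2 _ r2); rewrite h1 h2.
- by apply: (ends y1 y3 i1 i3 _ r23); rewrite h1 h3.
- by apply: (ends y2 y3 i2 i3 _ r3); rewrite h2 h3.
- by apply: (ends y2 y3 i2 i3 _ r3); rewrite h2 h3.
- by apply: (ends y1 y3 i1 i3 _ r23); rewrite h1 h3.
- by apply: (ends y1 y2 i1 i2 _ r2); rewrite h1 h2.
- by apply: (ends y1 y2 i1 i2 _ r2); rewrite h1 h2.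
Qed.

Lemma interior_depart u z : direction u -> U° z -> exists2 e, 0 < e & seg P z u e.
Proof.
move=> du Uz; have [u1 u2] := direction_neq0 alpha0 du.
by apply: depart => //; exact: interior_corner.
Qed.

Lemma unsettled_vertex u a b z : direction u -> recurrent2 u a b -> U° z ->
  (forall c, ~ settled u a b z c) -> exists2 v, vertex P v & rel u z v.
Proof.
move=> du rb Uz nz.
case: (exit_hits HP alpha0 du (interior_depart du Uz)) => [[j hj]|]; last first.
  exact: rel_vertex_ahead.
have bj : bad u a b (j, om z + tr j (out_side u j)).
  split; first by apply/dom_tr; case: hj.
  by move=> c /(settled_next du Uz hj); exact: nz.
have [v vv rv] := bad_vertex du rb bj; exists v => //.
exact: rel_trans (rel_hits hj) rv.
Qed.

Lemma hits_join u z i j : direction u -> U° z -> hits (rev_dir u) z i -> hits u z j ->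
  conn alpha u i j (om z).
Proof.
move=> du Uz [di [t1 t10 [E1 s1]]] [dj [t2 t20 [E2 s2]]].
rewrite (direction_out alpha0) // negbK in di E1; split => //.
rewrite /hits om_pe //; split => //; exists (t1 + t2); first exact: addr_gt0.
split; first by rewrite E1 flow_rev flow_flow addKr.
move=> r hr; rewrite E1 flow_rev flow_flow.
have [h|h|h] := ltgtP r t1.
- have := s1 (t1 - r); rewrite flow_rev opprB [r - t1]addrC; apply; lras.
- by apply: s2; lras.
- by rewrite h addNr flow0.
Qed.

Lemma gen_hits u z : direction u -> U° z -> gen (om z) -> exists j, hits u z j.
Proof.
move=> du Uz g; case: (exit_hits HP alpha0 du (interior_depart du Uz)) => //.
by move=> [t [v [_ vv Ev _]]]; case: (gen_vertex EC (t := t) du g vv).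
Qed.

(** An orbit that visits a recurrent target in the future has visited it in
    the past, and conversely. *)
Lemma hits_target_rev u a b z : direction u -> recurrent2 u a b -> U° z -> gen (om z) ->
  hits_target u a b z <-> hits_target (rev_dir u) (a - jump u) (b - jump u) z.
Proof.
move=> du rb Uz g; have [j hj] := gen_hits du Uz g.
have [i hi] := gen_hits (direction_rev du) Uz g.
have c := hits_join du Uz hi hj.
have sij : step u (i, om z) (j, om z + tr j (out_side u j)) by [].
have vi : valid u (i, om z) by case: c.
have gi : gen (i, om z).2 by [].
have Ei : (i, om z + tr i (out_side (rev_dir u) i)) = conv u (i, om z).
  by rewrite /conv /= (direction_out alpha0) // tr_neg.
have H1 := hit_step HP rb vi gi sij.
have H2 := hit_rev_iff HP alpha0 du rb vi gi.
split=> [[j' [h' Hj]]|[i' [h' Hi]]].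
  exists i; split => //; rewrite Ei; apply/H2/H1.
  by rewrite (hits_uniq HP hj h').
exists j; split => //; apply/H1/H2; rewrite -Ei.
by rewrite (hits_uniq HP hi h').
Qed.

(** An unsettled point is unsettled for the reversed flow too, so that its
    flow line ends at vertices in both directions: a saddle connection. *)
Lemma settled_everywhere u a b z : direction u -> recurrent2 u a b -> U° z ->
  exists c, settled u a b z c.
Proof.
move=> du rb Uz; apply: contrapT => nz.
have nz' c : ~ settled u a b z c by move=> h; apply: nz; exists c.
have [v vv [t [k [t0 hk Ev]]]] := unsettled_vertex du rb Uz nz'.
have nr c : ~ settled (rev_dir u) (a - jump u) (b - jump u) z c.
  move=> [e e0 He]; apply: (nz' c); exists e => // p bp Up g.
  exact: iff_trans (hits_target_rev du rb Up g) (He p bp Up g).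
have [v' vv' [t' [k' [t'0 hk' Ev']]]] :=
  unsettled_vertex (direction_rev du) (recurrent2_rev alpha0 du rb) Uz nr.
have hv := vertex_in_field vv; have hv' := vertex_in_field vv'.
have hc : in_field P (v - v' - (k - k')) by do 2 (apply: in_fieldB => //); apply: in_fieldB.
apply: (no_displacement alphaK du (addr_gt0 t0 t'0) hc); rewrite Ev Ev' /=; ring.
Qed.

(** Minimality: the points settled in favour of a visit and those settled
    against it form two disjoint open sets that cover the connected interior,
    and the former contain the points just after the target. *)
Lemma all_hit u a b x : direction u -> recurrent2 u a b -> a < b ->
  (forall w, a < w < b -> valid u (i0, w)) -> valid u x -> gen x.2 -> Hit u a b x.
Proof.
move=> du rb ab Jv vx gx.
pose O c := [set z | U° z /\ settled u a b z c].
have O_disj z : O true z -> O false z -> False.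
  move=> [Uz [e e0 He]] [_ [e' e'0 He']]; have [e1 e10 H1] := interior_box_open Uz.
  have [f [f0 f1 f2 f3]] := below3 e0 e'0 e10.
  have zf : om z < om z + f by rewrite ltrDl.
  have [w hw g] := gen_dense P alpha E zf.
  pose p := vert z w.
  have bp d : f <= d -> box z d p.
    move=> fd; split; rewrite /p /vert /= ?subrr ?normr0; first exact: lt_le_trans fd.
    by rewrite addrAC subrr add0r ltr_norml; lras.
  have Up : U° p by have [h1 h2] := bp e1 f3; exact: H1.
  have gp : gen (om p) by rewrite om_vert.
  by have /(He _ (bp _ f1) Up) := gp; have /(He' _ (bp _ f2) Up) := gp; move=> [h1 h2] [h3 h4]; have := h1 (h4 isT).
have O_open c : open (O c).
  rewrite openE => z [Uz [e e0 He]]; apply/interior_box.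
  have [e1 e10 H1] := interior_box_open Uz.
  have e2 : 0 < e / 2 by lra.
  have [f [f0 f1 f2]] := below2 e2 e10.
  exists f => // p h1 h2; split; first by apply: H1; exact: lt_le_trans f2.
  exists (e / 2) => [|p' [h1' h2'] Up' g']; first by lra.
  by apply: He => //; split; move: h1 h2 h1' h2'; rewrite !ltr_norml => *; lras.
(* generic points on the flow line just after the state [x] *)
have start y : valid u y -> gen y.2 -> exists z, [/\ U° z, gen (om z) &
    hits_target u a b z <-> Hit u a b y].
  move=> vy gy; have [y' syy'] := gen_next HP alpha0 EC du vy gy.
  have [[dy hy] Ey'] := syy'.
  have [_ [t t0 [Et st]]] := hy.
  have Uz : U° (flow (pos u y) u (t / 2)) by apply: st; lras.
  exists (flow (pos u y) u (t / 2)); split => //; first by rewrite om_flow // /pos om_pe.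
  have hz : hits u (flow (pos u y) u (t / 2)) y'.1.
    have [dj _] := hy; rewrite /hits om_flow //; split => //.
    exists (t / 2); first by lra.
    split; first by rewrite flow_flow -splitr Et.
    by move=> r hr; rewrite flow_flow; apply: st; lras.
  rewrite (hit_step HP rb vy gy syy').
  have Ez : om (flow (pos u y) u (t / 2)) = y.2 by rewrite om_flow // /pos om_pe.
  have y'E : y' = (y'.1, y.2 + tr y'.1 (out_side u y'.1)).
    by rewrite -Ey' -surjective_pairing.
  split=> [[j [hj Hj]]|Hy]; last by exists y'.1; rewrite Ez -y'E.
  by rewrite y'E; move: Hj; rewrite Ez (hits_uniq HP hj hz).
have gen_settled z c : U° z -> gen (om z) -> settled u a b z c -> (hits_target u a b z <-> c).
  move=> Uz g [e e0 He]; apply: He => //; by split; rewrite subrr normr0.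
have [w hw gw] := gen_dense P alpha E ab.
have [z0 [Uz0 gz0 Hz0]] := start (i0, w) (Jv w hw) gw.
have Ht0 : hits_target u a b z0 by apply/Hz0; exists 0%N, (i0, w).
have Oz0 : O true z0.
  split => //; have [[] sc] := settled_everywhere du rb Uz0; first exact: sc.
  by have [/(_ Ht0)] := gen_settled z0 false Uz0 gz0 sc.
have conn_U : connected U° by case: HP => -[].
have OU : O true = U°.
  apply: conn_U; first by exists z0.
    exists (O true) => //; apply/seteqP; split=> z; first by move=> h; split => //; case: h.
    by case.
  exists (~` O false); first exact: open_closedC.
  apply/seteqP; split=> z; first by move=> h; split; [case: h|move=> h'; exact: O_disj h h'].
  move=> [Uz nz]; split => //; have [[] sc] := settled_everywhere du rb Uz => //.
  by case: nz.
have [z [Uz gz Hz]] := start x vx gx.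
have [_ sz] : O true z by rewrite OU.
by apply/Hz; exact/(gen_settled z true).
Qed.

End Density.

(** * Recurrence to the target *)

Section Recurrence.
Variables (R : realType) (P : net R) (alpha : R).
Hypothesis HP : polyrectangle_translation_surface P.
Hypothesis alpha0 : alpha != 0.
Local Notation direction := (direction alpha).
Local Notation om := (om alpha).
Local Notation dom := (dom (P := P) alpha).
Local Notation tr := (tr (P := P) alpha).
Local Notation valid := (valid (P := P) alpha).
Local Notation path := (path (P := P) alpha).
Local Notation state := ('I_(npairs P) * R)%type.
Implicit Types (p u v z : R * R) (i j : 'I_(npairs P)) (x y : state).

Lemma walk_path u i0 a b k w j t : walk (conn alpha u) (fun _ j => tr j (out_side u j)) i0 a b k w j t ->
  path u k (i0, w) (j, w + t).
Proof.
elim: k j t => [|k IH] j t /=; first by move=> [-> ->]; rewrite addr0.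
move=> [j' [t' [/IH pk cn -> _]]].
suff : path u (k + 1) (i0, w) (j, w + (t' + tr j (out_side u j))) by rewrite addn1.
by apply: path_add pk _; exists (j, w + (t' + tr j (out_side u j))); split; rewrite //= addrA.
Qed.

Lemma returns_path u i0 a b k w :
  returns (conn alpha u) (fun _ j => tr j (out_side u j)) i0 a b k w ->
  exists y, path u k.+1 (i0, w) y /\ target i0 a b y.
Proof.
move=> [j [t [/walk_path pk cn hw]]].
exists (i0, w + t + tr i0 (out_side u i0)); split=> //.
suff : path u (k + 1) (i0, w) (i0, w + t + tr i0 (out_side u i0)) by rewrite addn1.
by apply: path_add pk _; exists (i0, w + t + tr i0 (out_side u i0)).
Qed.

Lemma displacement_tr_sum u k t :
  displacement (fun _ j : 'I_(npairs P) => tr j (out_side u j)) k t ->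
  exists l : seq ('I_(npairs P) * bool), t = tr_sum alpha l.
Proof.
elim: k t => [|k IH] t /=; first by move=> ->; exists [::]; rewrite /tr_sum big_nil.
move=> [t' [i [j [/IH [l ->] ->]]]]; exists ((j, out_side u j) :: l).
by rewrite /tr_sum big_cons addrC.
Qed.

Variables (E : seq R) (i0 : 'I_(npairs P)).
Hypothesis EC : {subset vertex_lines P alpha <= E}.

(** The strip argument for the flow; a generic state is not at a mark, because
    the marks are translates of ends of the target and of vertices. *)
Lemma recurrent_bound u a b (X : R) (T : nat -> nat) (kappa : nat -> R) (K : nat -> nat) :
  direction u -> a < b -> (forall w, a < w < b -> valid u (i0, w)) ->
  (forall v, vertex P v -> `|om v| <= X) ->
  (exists la : seq ('I_(npairs P) * bool), a + tr_sum alpha la \in E) ->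
  (exists lb : seq ('I_(npairs P) * bool), b + tr_sum alpha lb \in E) ->
  (forall l, (T l < T l.+1)%N) -> (forall l, 0 < kappa l) ->
  (forall l (x x' : R), let mp := mark_place (fun _ j => tr j (out_side u j))
       (vertex_lines P alpha) a b (T l) in
     mp x -> mp x' -> x != x' -> kappa l <= `|x - x'|) ->
  (forall l, 2 * X < (K l)%:R * kappa l) -> (forall l, (npairs P * K l < (T l.+1).+1)%N) ->
  recurrent alpha E i0 (T (npairs P * size (vertex_lines P alpha) + 2).+1) u a b.
Proof.
move=> du ab Jv HX [la ha] [lb hb] Tlt k0 sep XK IK [i w] vx gx [/= ei hw].
rewrite ei in vx *.
have nm l : ~ mark_place (fun _ j => tr j (out_side u j)) (vertex_lines P alpha) a b (T l) w.
  case=> [wa|[wb|[k [t [e [_ /displacement_tr_sum [c ->] he wE]]]]]].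
  - by have := gx la; rewrite /= wa ha.
  - by have := gx lb; rewrite /= wb hb.
  case: he => [/EC eE|[Ee|Ee]].
  - by have := gx c; rewrite /= wE subrK eE.
  - have := gx (c ++ la); rewrite /= /tr_sum big_cat -!/(tr_sum _ _) addrA wE subrK Ee.
    by rewrite ha.
  - have := gx (c ++ lb); rewrite /= /tr_sum big_cat -!/(tr_sum _ _) addrA wE subrK Ee.
    by rewrite hb.
have [|||||k kT /returns_path [y [py ty]]] :=
  @returns_bound R 'I_(npairs P) (fun i => dom i (out_side u i)) (conn alpha u)
    (fun _ j => tr j (out_side u j)) (vertex_lines P alpha) X _ _ _ _ i0 a b ab Jv
    T kappa K w Tlt k0 sep XK _ hw nm.
- by move=> i' a' b' w0; exact: conn_uniform.
- by move=> i' j w'; exact: conn_dom.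
- by move=> i' i'' j w' w''; exact: conn_inj.
- by move=> i' w'; exact: dom_bound.
- by move=> l; rewrite card_ord.
rewrite card_ord in kT.
by exists k.+1, y.
Qed.

End Recurrence.

(** * Heights of transverse coordinates *)

Section Heights.
Variables (R : realType) (P : net R) (alpha : R).
Hypothesis alpha0 : alpha != 0.
Local Notation om := (om alpha).
Local Notation tr := (tr (P := P) alpha).

(** [None] stands for the slope; the last boolean of a vertex selects the
    abscissa. *)
Definition generator : finType := option ('I_(npairs P) * bool * bool * bool)%type.
Definition gen_value (g : generator) : R :=
  if g is Some y then (if y.2 then (vtx y.1).1 else (vtx y.1).2) else alpha.
Local Notation comb := (@bounded_comb R generator gen_value None).

Lemma comb_le N H H' z : (H <= H')%N -> comb N H z -> comb N H' z.
Proof.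
move=> HH [k [n [m [hk hn hm E]]]]; have le : H%:R <= H'%:R :> int by rewrite ler_nat.
by exists k, n, m; split=> // [|g|g]; apply: le_trans le.
Qed.

Lemma combN N H z : comb N H z -> comb N H (- z).
Proof.
move=> [k [n [m [hk hn hm E]]]]; exists (- k), (fun g => - n g), (fun g => - m g).
split=> [|g|g|]; rewrite ?normrN //.
rewrite mulrN E; rewrite [X in _ = _ + X + _](_ : _ = - \sum_g (n g)%:~R * gen_value g); last first.
  by rewrite -sumrN; apply: eq_bigr => g _; rewrite mulrNz mulNr.
rewrite [X in _ = _ + _ * X](_ : _ = - \sum_g (m g)%:~R * gen_value g); last first.
  by rewrite -sumrN; apply: eq_bigr => g _; rewrite mulrNz mulNr.
by rewrite mulrNz mulrN !opprD.
Qed.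

Lemma combD N H H' z z' : comb N H z -> comb N H' z' -> comb N (H + H') (z + z').
Proof.
move=> [k [n [m [hk hn hm E]]]] [k' [n' [m' [hk' hn' hm' E']]]].
exists (k + k'), (fun g => n g + n' g), (fun g => m g + m' g).
split=> [|g|g|]; rewrite ?natrD; try by rewrite (le_trans (ler_normD _ _)) // lerD.
rewrite mulrDr E E'.
have sumD (f f' : generator -> int) : \sum_g (f g + f' g)%:~R * gen_value g =
    \sum_g (f g)%:~R * gen_value g + \sum_g (f' g)%:~R * gen_value g.
  by rewrite -big_split; apply: eq_bigr => g _; rewrite intrD mulrDl.
by rewrite !sumD intrD; ring.
Qed.

Lemma combB N H H' z z' : comb N H z -> comb N H' z' -> comb N (H + H') (z - z').
Proof. by move=> hz /combN; exact: combD. Qed.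

Lemma comb_rational N (k : int) : (0 < N)%N -> comb N (absz k) (k%:~R / N%:R).
Proof.
move=> N0; exists k, (fun=> 0), (fun=> 0); split=> [|g|g|]; rewrite ?normr0 ?ler0n //.
  by rewrite -abszE natz.
rewrite big1 => [|g _]; last by rewrite mul0r.
by rewrite mulr0 !addr0 mulrC divfK // pnatr_eq0 -lt0n.
Qed.

Lemma comb_coord N (y : 'I_(npairs P) * bool * bool * bool) : comb N N (gen_value (Some y)).
Proof.
exists 0, (fun g => if g == Some y then N%:R else 0), (fun=> 0); split=> [|g|g|].
- by rewrite normr0.
- by case: ifP; rewrite ?normr_nat ?normr0.
- by rewrite normr0.
rewrite (bigD1 (Some y)) //= eqxx !big1 => [|g _|g /negPf ->]; rewrite ?mul0r //.
by rewrite mulr0 !addr0 add0r mulrz_nat.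
Qed.

Lemma comb_om N x : comb N N (om (vtx (P := P) x)).
Proof.
exists 0, (fun g => if g == Some (x, false) then N%:R else 0),
  (fun g => if g == Some (x, true) then - N%:R else 0); split=> [|g|g|].
- by rewrite normr0.
- by case: ifP; rewrite ?normr_nat ?normr0.
- by case: ifP; rewrite ?normrN ?normr_nat ?normr0.
rewrite (bigD1 (Some (x, false))) //= eqxx big1 => [|g /negPf ->]; last by rewrite mul0r.
rewrite (bigD1 (Some (x, true))) //= eqxx big1 => [|g /negPf ->]; last by rewrite mul0r.
by rewrite mulrNz mulrz_nat /om; ring.
Qed.

Lemma comb_tr N i b : comb N (2 * N) (tr i b).
Proof.
have o c : origin i c = vtx (i, c, false).
  by rewrite /vtx /edge /=; case: ifP => _; rewrite addr0 -surjective_pairing.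
by rewrite /tr !o mul2n -addnn; apply: combB; exact: comb_om.
Qed.

Lemma comb_displacement N u k t :
  displacement (fun _ j : 'I_(npairs P) => tr j (out_side u j)) k t -> comb N (2 * N * k) t.
Proof.
elim: k t => [|k IH] t /=.
  move=> ->; rewrite muln0; exists 0, (fun=> 0), (fun=> 0).
  split=> [|g|g|]; rewrite ?normr0 //.
  by rewrite big1 => [|g _]; rewrite ?mul0r // !mulr0 !addr0.
move=> [t' [i [j [/IH ht ->]]]]; rewrite mulnS addnC; apply: combD => //.
exact: comb_tr.
Qed.

Lemma comb_mark_place N Ha u a b T x : comb N Ha a -> comb N Ha b ->
  mark_place (fun _ j => tr j (out_side u j)) (vertex_lines P alpha) a b T x ->
  comb N (Ha + N + 2 * N * T) x.
Proof.
move=> ca cb [->|[->|[k [t [e [kT /(comb_displacement N) ct he ->]]]]]].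
- by apply: comb_le ca; rewrite -addnA leq_addr.
- by apply: comb_le cb; rewrite -addnA leq_addr.
have ce : comb N (Ha + N) e.
  case: he => [/fintype.imageP [y _ ->]|[->|->]].
  - by apply: comb_le (comb_om N y); rewrite leq_addl.
  - by apply: comb_le ca; rewrite leq_addr.
  - by apply: comb_le cb; rewrite leq_addr.
apply: combB ce _; apply: comb_le ct; by rewrite leq_mul2l kT orbT.
Qed.

End Heights.

(** * From a square to a target, and from recurrence to a visit *)

Section Visits.
Variables (R : realType) (P : net R) (alpha : R).
Hypothesis HP : polyrectangle_translation_surface P.
Hypothesis alpha0 : alpha != 0.
Hypothesis alphaK : ~ field_gen (coordinate P) alpha.
Local Notation U := (region P).
Local Notation direction := (direction alpha).
Local Notation om := (om alpha).
Local Notation pe := (pe (P := P) alpha).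
Local Notation tr := (tr (P := P) alpha).
Local Notation valid := (valid (P := P) alpha).
Local Notation pos := (pos (P := P) alpha).
Local Notation path := (path (P := P) alpha).
Local Notation state := ('I_(npairs P) * R)%type.
Implicit Types (p u v z : R * R) (i j : 'I_(npairs P)) (x y : state).

Local Notation cls := (surface_point P).

(** The cells of length [1 / n] in an interval of length [delta] outnumber the
    lines through vertices; three more make up for rounding. *)
Lemma free_cell (s delta : R) (n : nat) : (0 < n)%N ->
  (#|{: 'I_(npairs P) * bool * bool}| + 3)%:R <= delta * n%:R ->
  exists k : int, [/\ s <= k%:~R / n%:R, (k + 1)%:~R / n%:R <= s + delta &
    vertex_free P alpha (k%:~R / n%:R) ((k + 1)%:~R / n%:R)].
Proof.
set c := #|_| => n0 hd; have n0' : 0 < n%:R :> R by rewrite ltr0n.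
(* The first cell that starts to the right of [s]. *)
pose k0 := Num.floor (s * n%:R) + 1.
have [h1 h2] : k0%:~R - 1 <= s * n%:R /\ s * n%:R < k0%:~R.
  rewrite /k0; split; last exact: floorD1_gt.
  by rewrite intrD addrK floor_le.
pose good (t : nat) := vertex_free P alpha ((k0 + t%:Z)%:~R / n%:R) ((k0 + t%:Z + 1)%:~R / n%:R).
case: (pselect (exists2 t, (t <= c)%N & good t)) => [[t tc gt]|ng].
  have tc' : t%:R <= c%:R :> R by rewrite ler_nat.
  exists (k0 + t%:Z); split=> //.
    rewrite ler_pdivlMr // intrD (le_trans (ltW h2)) // lerDl ler0z.
    by [].
  rewrite ler_pdivrMr // !intrD mulrDl; move: hd; rewrite natrD => hd.
  have -> : (t%:Z)%:~R = t%:R :> R by [].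
  by rewrite mulr1z; move: h1; rewrite {1}/k0 intrD mulr1z; lra.
exfalso; have {ng} H (t : 'I_c.+1) : {x : 'I_(npairs P) * bool * bool |
    (k0 + t%:Z)%:~R / n%:R < om (vtx x) < (k0 + t%:Z + 1)%:~R / n%:R}.
  apply: cid; apply: contrapT => nx; apply: ng; exists t; first by rewrite -ltnS.
  by move=> v /vertex_vtx [x ->] hx; apply: nx; exists x.
have inj : injective (fun t => projT1 (H t)).
  move=> t t' E; have := projT2 (H t); have := projT2 (H t'); rewrite -E.
  rewrite !ltr_pdivrMr // !ltr_pdivlMr // => /andP[a1 a2] /andP[a3 a4].
  have lt (x : R) (y z : int) : y%:~R < x -> x < z%:~R -> (y < z :> int).
    by move=> h h'; rewrite -(ltr_int R) (lt_trans h).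
  have b1 := lt _ _ _ a1 a4; have b2 := lt _ _ _ a3 a2.
  by apply: val_inj => /=; lia.
by have := leq_card _ inj; rewrite card_ord ltnn.
Qed.

(** On tracing the flow back from the vertical segment inside the square, all
    lines of a free cell leave the same edge [i0]. The target is the middle
    third of the cell: its closure lies in the open cell, and its ends are
    rational. *)
Lemma square_target u l A delta n : direction u -> aligned_square P l A -> 0 < delta ->
  delta <= l / 2 ->
  (forall v v', vertex P v -> vertex P v' -> v.2 != v'.2 -> delta <= `|v.2 - v'.2|) ->
  (0 < n)%N -> (#|{: 'I_(npairs P) * bool * bool}| + 3)%:R <= delta * n%:R ->
  exists (i0 : 'I_(npairs P)) (k : int), forall w,
    (3 * k + 1)%:~R / (3 * n)%:R <= w <= (3 * k + 2)%:~R / (3 * n)%:R ->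
    valid u (i0, w) /\ exists s, [/\ 0 < s, seg P (pos u (i0, w)) u s,
      U° (flow (pos u (i0, w)) u s) & A (cls (flow (pos u (i0, w)) u s, quadrant_of u))].
Proof.
move=> du sqA d0 dl gap n0 hd.
have [p Hp] := square_segment HP sqA d0 dl gap.
have [k [k1 k2 vf]] := free_cell (om p) n0 hd.
set l' := k%:~R / n%:R in k1 vf; set r' := (k + 1)%:~R / n%:R in k2 vf.
have n0' : 0 < n%:R :> R by rewrite ltr0n.
have dr := direction_rev du.
have vertE w : vert alpha p w = flow p (0, 1) (w - om p).
  by rewrite /vert /flow /= mulr0 addr0 mulr1.
have Uw w : l' < w < r' -> 0 < w - om p < delta.
  by move=> hw; lras.
have tv : transversal P alpha (rev_dir u) (vert alpha p) l' r'.
  split=> [w||w hw]; first exact: om_vert.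
    by exists p.1, 0 => w; rewrite mul0r addr0.
  have [Ui _] := Hp _ (Uw w hw); rewrite -vertE in Ui.
  split; first exact (interior_depart alpha0 dr Ui).
  by move=> j s hs Ej; have [_] := edge_boundary HP (~~ out_side (rev_dir u) j) hs; rewrite -Ej.
have third (x : int) : x = 1 \/ x = 2 -> l' < (3 * k + x)%:~R / (3 * n)%:R < r'.
  move=> hx; have -> : (3 * k + x)%:~R / (3 * n)%:R = (k%:~R + x%:~R / 3) / n%:R :> R.
    by rewrite intrD intrM natrM; field; rewrite gt_eqF.
  rewrite /l' /r' !ltr_pM2r ?invr_gt0 // intrD mulr1z.
  by case: hx => ->; rewrite ?mulr1z; apply/andP; split; lra.
have t1 := third 1 (or_introl erefl); have t2 := third 2 (or_intror erefl).
have [i0 Hi] := hits_uniform HP alpha0 dr tv vf t1.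
exists i0, k => w hw; have hw' : l' < w < r' by lras.
have [di [s s0 [Es ss]]] := Hi w hw'; have [Ui Aq] := Hp _ (Uw w hw').
rewrite om_vert (direction_out alpha0) // negbK in di Es.
have Ev : flow (pos u (i0, w)) u s = vert alpha p w.
  by rewrite /pos /= Es flow_rev flow_flow addNr flow0.
split=> //; exists s; rewrite Ev vertE; split => //.
by have := seg_rev ss; rewrite rev_dirK -Es.
Qed.

Section Run.
Variables (L : R -> set (corner R)) (u : R * R) (A : set (set (corner R))).
Hypothesis du : direction u.
Hypothesis LP : geodesic P L u.
Local Notation at_ := (chart P L u (quadrant_of u)).
Variable Xc : R.
Hypothesis HX : forall v, vertex P v -> `|v.1| <= Xc.
(** A bound for the time of any flight between two edges. *)
Let D := 2 * Xc / `|u.1|.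

Lemma edge_x_bound i b s : 0 <= s <= len i -> `|(edge i b s).1| <= Xc.
Proof.
move=> hs; have l0 := len_gt0 HP i.
have v1 : vertex P (edge i b 0) by exists i, b; left.
have v2 : vertex P (edge i b (len i)) by exists i, b; right.
move: (HX v1) (HX v2); rewrite /edge; case: ifP => _ //=.
by rewrite !ler_norml addr0 => *; lras.
Qed.

Lemma flight_time z t i b s : `|z.1| <= Xc -> 0 < t -> 0 <= s <= len i ->
  flow z u t = edge i b s -> t <= D.
Proof.
move=> zX t0 hs E; have [u1 _] := du; have eX := edge_x_bound b hs.
rewrite /D ler_pdivlMr ?normr_gt0 // -[t]gtr0_norm // -normrM.
have -> : t * u.1 = (edge i b s).1 - z.1 by rewrite -E /flow /=; ring.
by rewrite (le_trans (ler_normB _ _)) //; lra.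
Qed.

Lemma vertex_edge v : vertex P v -> exists i b s, 0 <= s <= len i /\ v = edge i b s.
Proof.
by move=> [i [b E]]; have l0 := ltW (len_gt0 HP i); case: E => ->;
  [exists i, b, 0|exists i, b, (len i)]; rewrite lexx l0.
Qed.

Lemma pos_x_bound x : valid u x -> `|(pos u x).1| <= Xc.
Proof. by move=> /andP[/ltW h1 /ltW h2]; apply: edge_x_bound; rewrite h1. Qed.

Lemma geodesic_path t k x y : 0 <= t -> at_ t (pos u x) -> valid u x -> path u k x y ->
  exists2 t', t <= t' <= t + k%:R * D & at_ t' (pos u y).
Proof.
elim: k x t => [|k IH] x t t0 ch vx /=; first by move=> ->; exists t; rewrite // mul0r addr0 lexx.
move=> [x' sx px]; have [[_ [dj [tau tau0 [E st]]]] E2] := sx.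
have ch' := geodesic_step HP LP t0 ch tau0 st dj E.
have tD : tau <= D.
  have [h1 h2] := andP dj; apply: flight_time (pos_x_bound vx) tau0 _ (esym E).
  by rewrite !ltW.
have pE : pe x'.1 (out_side u x'.1) (om (pos u x) + tr x'.1 (out_side u x'.1)) = pos u x'.
  by rewrite /pos om_pe // -E2.
rewrite pE in ch'.
have [|t' ht' ch2] := IH x' (t + tau) _ ch' (step_valid alpha0 sx) px; first by lra.
by exists t' => //; rewrite -natr1; lras.
Qed.

Lemma seg_extend p s : 0 < s -> seg P p u s -> U° (flow p u s) ->
  exists2 t, s < t & seg P p u t.
Proof.
move=> s0 ss Us; have [e e0 se] := interior_depart alpha0 du Us.
exists (s + e) => [|r hr]; first by rewrite ltrDl.
have [h|h|->//] := ltgtP r s; first by apply: ss; lras.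
by have := se (r - s); rewrite flow_flow subrKC; apply; lras.
Qed.

Variables (i0 : 'I_(npairs P)) (a b : R) (E : seq R) (N : nat).
Hypothesis visit : forall w, a <= w <= b -> valid u (i0, w) /\
  exists s, [/\ 0 < s, seg P (pos u (i0, w)) u s, U° (flow (pos u (i0, w)) u s) &
    A (cls (flow (pos u (i0, w)) u s, quadrant_of u))].
Hypothesis hit : forall x, valid u x -> gen P alpha E x.2 ->
  exists k y, [/\ (k <= N)%N, path u k x y & target i0 a b y].

Lemma D_ge0 : 0 <= D.
Proof.
have v : vertex P (edge i0 true 0) by exists i0, true; left.
by rewrite divr_ge0 // mulr_ge0 // (le_trans _ (HX v)).
Qed.

Lemma run_visit t w : 0 <= t -> a <= w <= b -> at_ t (pos u (i0, w)) ->
  exists2 t0, t <= t0 <= t + D & A (L t0).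
Proof.
move=> t0 hw ch; have [vx [s [s0 ss Us As]]] := visit hw.
have [s' ss' ext] := seg_extend s0 ss Us.
exists (t + s); last first.
  by rewrite (geodesic_mid HP LP t0 ch ext) //; lras.
have [u1 u2] := direction_neq0 alpha0 du.
have dep : exists2 e, 0 < e & seg P (pos u (i0, w)) u e.
  by apply: depart => //; exact: edge_depart.
have [t1 t10 [st U1 U2]] := exit_exists HP (or_introl u1) dep.
have [i [c [r [hr Er]]]] := boundary_edge HP U1 U2.
have st1 : s <= t1.
  rewrite leNgt; apply/negP => h; apply: U2; apply: ss; lras.
have := flight_time (pos_x_bound vx) t10 hr Er; lras.
Qed.

(** Within [N] steps the orbit meets a vertex or the closed target: otherwise
    the nearby orbits would run parallel to it and miss the target, although
    the generic ones among them hit it. The relation to [v0] records that the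
    vertex is ahead of [x]; the geodesic goes on from [v], which may be
    another representative of the same point. *)
Lemma run_state t x : 0 <= t -> at_ t (pos u x) -> valid u x ->
  (exists2 t0, t <= t0 <= t + N.+1%:R * D & A (L t0)) \/
  (exists t1 v v0, [/\ t <= t1 <= t + N.+1%:R * D, vertex P v, at_ t1 v,
     vertex P v0 & rel P u (pos u x) v0]).
Proof.
move=> t0 ch vx; have D0 := D_ge0.
have kD k : (k <= N)%N -> k%:R * D + D <= N.+1%:R * D.
  by move=> kN; rewrite -natr1 mulrDl mul1r lerD2r ler_wpM2r // ler_nat.
case: (itinerary_cases HP alpha0 i0 a b N du vx).
- move=> [k [y [kN py va]]]; right.
  have [t' ht' ch'] := geodesic_path t0 ch vx py.
  have [v0 vv0 ry] := rel_vertex_ahead va.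
  have [tau [v [tau0 vv Ev sv]]] := va.
  rewrite -Ev in vv; have t'0 : 0 <= t' by lras.
  have [v1 vv1 ch1] := geodesic_vertex HP LP t'0 ch' tau0 sv vv.
  exists (t' + tau), v1, v0; split => //; last first.
    case: k py kN ht' => [|k] py kN ht'; first by rewrite -[x]py.
    exact: rel_trans (rel_path alpha0 du py) ry.
  have [i [c [s [hs Es]]]] := vertex_edge vv.
  have := flight_time (pos_x_bound (path_valid alpha0 vx py)) tau0 hs Es.
  by have := kD _ kN; lras.
- move=> [k [[i w] [kN py /= yi hy]]]; left; rewrite yi in py.
  have [t' ht' ch'] := geodesic_path t0 ch vx py.
  have t'0 : 0 <= t' by lras.
  have [t2 ht2 At2] := run_visit t'0 hy ch'.
  by exists t2 => //; have := kD _ kN; lras.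
move=> [e e0 He]; exfalso; have [e1 e10 H1] := dom_open vx.
have [f [f0 f1 f2]] := below2 e0 e10.
have xf : x.2 < x.2 + f by rewrite ltrDl.
have [w hw gw] := gen_dense P alpha E xf.
have wf : `|w - x.2| < f by rewrite ltr_norml; lras.
have vw : valid u (x.1, w) by apply: H1; exact: lt_le_trans f2.
have [k [y [kN py ty]]] := hit vw gw.
by case: (He w (lt_le_trans wf f1) k y kN py ty).
Qed.

Lemma run_start t p : 0 <= t -> at_ t p ->
  (exists2 t0, t <= t0 <= t + N.+3%:R * D & A (L t0)) \/
  (exists t1 v v0, [/\ t <= t1 <= t + N.+3%:R * D, vertex P v, at_ t1 v,
     vertex P v0 & rel P u p v0]).
Proof.
move=> t0 ch; have D0 := D_ge0; have [u1 u2] := direction_neq0 alpha0 du.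
have [cp _] := ch; have dep := depart u1 u2 cp.
(* [p] need not lie on an edge, so half of the first flight is compared with
     the whole flight between edges through its midpoint *)
have first tau i b' s : 0 < tau -> seg P p u tau -> 0 <= s <= len i ->
    flow p u tau = edge i b' s -> tau <= 2 * D.
  move=> tau0 st hs Es; have hh : 0 < tau / 2 < tau by lras.
  have Uh := st _ hh.
  have dr := direction_rev du; have [r1 r2] := direction_neq0 alpha0 dr.
  have [t2 t20 [s2 U1 U2]] := exit_exists HP (or_introl r1) (interior_depart alpha0 dr Uh).
  have [i' [c' [s' [hs' Es']]]] := boundary_edge HP U1 U2.
  have Ez : flow (edge i' c' s') u (t2 + tau / 2) = edge i b' s.
    by rewrite -Es' flow_rev !flow_flow -Es; congr flow; field.
  have := flight_time (edge_x_bound c' hs') (_ : 0 < t2 + tau / 2) hs Ez.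
  by move=> /(_ _) H; have := H (addr_gt0 t20 (proj1 (andP hh))); lra.
have ND : 2 * D + N.+1%:R * D = N.+3%:R * D.
  by rewrite -mulrDl -natrD.
case: (exit_hits HP alpha0 du dep) => [[j hj]|va].
  have [dj [tau tau0 [Ej sj]]] := hj.
  have tD : tau <= 2 * D.
    apply: first tau0 sj _ (esym Ej); by case/andP: dj => /ltW -> /ltW ->.
  have ch' := geodesic_step HP LP t0 ch tau0 sj dj Ej.
  have vy : valid u (j, om p + tr j (out_side u j)) by apply/dom_tr.
  have t'0 : 0 <= t + tau by lra.
  case: (run_state (x := (j, _)) t'0 ch' vy) => [[t2 ht2 At2]|[t1 [v [v0 [ht1 vv chv vv0 rv]]]]].
    by left; exists t2 => //; lras.
  right; exists t1, v, v0; split => //; first by lras.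
  exact: rel_trans (rel_hits hj) rv.
right; have [v0 vv0 ry] := rel_vertex_ahead va.
have [tau [v [tau0 vv Ev sv]]] := va; rewrite -Ev in vv.
have [v1 vv1 ch1] := geodesic_vertex HP LP t0 ch tau0 sv vv.
exists (t + tau), v1, v0; split => //.
have [i [c [s [hs Es]]]] := vertex_edge vv.
have := first _ _ _ _ tau0 sv hs Es.
have : 0 <= N.+1%:R * D by rewrite mulr_ge0.
by lras.
Qed.

(** There are no saddle connections, so a geodesic meets at most one vertex in
    the time considered, and the orbit before it or the orbit after it is long
    enough for a visit. *)
Lemma run_geodesic : exists2 t0, 0 <= t0 <= 2 * N.+3%:R * D & A (L t0).
Proof.
have ND : 0 <= N.+3%:R * D by rewrite mulr_ge0 // D_ge0.
have [[p ch] _] := LP (lexx 0).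
case: (run_start (lexx 0) ch) => [[t0 ht0 At0]|[t1 [v [v0 [ht1 vv ch1 _ _]]]]].
  by exists t0 => //; lras.
have t10 : 0 <= t1 by lras.
case: (run_start t10 ch1) => [[t0 ht0 At0]|[t2 [v' [v1 [_ _ _ vv1 rv]]]]].
  by exists t0 => //; lras.
by case: (rel_vertex alphaK du vv vv1 rv).
Qed.

End Run.
End Visits.

(** * A bound for roots *)

Section RootBound.
Variable R : realType.

Lemma root_bound (q : {poly int}) (x : R) (d h : nat) : q != 0 ->
  root (map_poly intr q) x -> (size q <= d.+1)%N -> (forall i, `|q`_i| <= h%:R) ->
  `|x| <= (h * d).+1%:R.
Proof.
move=> q0 qx qd qh; have [x1|x1] := leP `|x| 1.
  by rewrite (le_trans x1) // ler1n.
have lc : 1 <= `|lead_coef q|%:~R :> R.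
  by rewrite -[1]/(1%:~R) ler_int -gtz0_ge1 normr_gt0 lead_coef_eq0.
move: qx; rewrite /root (@horner_coef_wide _ (size q)) ?size_poly //.
have -> : \sum_(i < size q) (map_poly intr q)`_i * x ^+ i =
    \sum_(i < size q) (q`_i)%:~R * x ^+ i.
  by apply: eq_bigr => i _; rewrite coef_map_id0.
have := q0; rewrite -size_poly_gt0.
move: lc qd; rewrite lead_coefE; case: (size q) => // n lc qd _.
rewrite big_ord_recr /= addrC addr_eq0 => /eqP E.
case: n qd lc E => [|n] qd lc E.
  move: E lc; rewrite big_ord0 oppr0 expr0 mulr1 /= intr_norm => ->.
  by rewrite normr0 ler10.
have x0 : 0 < `|x| := lt_trans ltr01 x1.
have : `|x| ^+ n.+1 <= (h * d)%:R * `|x| ^+ n.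
  rewrite -[leLHS]mul1r (le_trans (ler_wpM2r (exprn_ge0 _ (normr_ge0 x)) lc)) //.
  rewrite intr_norm -normrX -normrM E normrN (le_trans (ler_norm_sum _ _ _)) //.
  apply: (@le_trans _ _ (\sum_(i < n.+1) h%:R * `|x| ^+ n)).
    apply: ler_sum => i _; rewrite normrM normrX ler_pM //.
      by rewrite -intr_norm pmulrn -natz ler_int.
    by rewrite ler_weXn2l // ?ltW // -ltnS.
  rewrite sumr_const card_ord -mulrnAl -mulrnA ler_wpM2r ?exprn_ge0 //.
  by rewrite ler_nat leq_mul2l -ltnS qd orbT.
rewrite exprS ler_pM2r ?exprn_gt0 // => /le_trans; apply.
by rewrite ler_nat.
Qed.

End RootBound.

(** * Constants as functions of the code *)

Section Constants.
Local Open Scope nat_scope.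

(** [s] bounds the number of pairs of edges and the degrees and heights of the
    coordinates. A pair of edges has four ends with two coordinates each, and
    there is the slope. *)
Definition generators_bound s := 8 * s + 1.
Definition degree_bound s := s.+1 ^ generators_bound s.
(** [liouville_const] with a power for the factorial. *)
Definition height_factor s := s ^ generators_bound s * s ^ generators_bound s *
  (degree_bound s ^ degree_bound s *
   (liouville_entry (generators_bound s) s s).+1 ^ degree_bound s).
Definition coordinate_bound s := (s * s).+1.
(** A bound for the transverse coordinates of the vertices. *)
Definition line_bound s := coordinate_bound s + coordinate_bound s * coordinate_bound s.
(** Distinct heights of vertices differ by at least its inverse: a difference
    of two coordinates has height 2. *)
Definition gap_factor s := height_factor s * 2 ^ degree_bound s.
(** A vertical segment of length [1 / (2 n gap_factor)] is cut into [4 s + 3]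
    cells, and these into thirds. *)
Definition cells s := 6 * gap_factor s * (4 * s + 3).
(** Chosen for [scale_step]: the next scale exceeds the number of disjoint
    strips that have room when marks are as close as the Liouville bound
    allows. *)
Definition growth_base s := s * (2 * line_bound s + 1) * height_factor s *
  (2 * line_bound s + 10) ^ degree_bound s + 2.
Definition growth_exponent s := 2 * (degree_bound s).+1.
(** There are at most [s] pairs of edges and [4 s] lines through vertices, so
    that [4 s s + 3] time windows suffice. *)
Definition time_exponent s := growth_exponent s ^ (4 * s * s + 3).
(** The time is at most that of [2 * (N + 3) <= 8 * N] flights, where [N] is
    the last scale, and a flight takes at most [2 * coordinate_bound] divided
    by the horizontal speed. *)
Definition time_factor s := 16 * coordinate_bound s * (coordinate_bound s).+1 *
  (growth_base s * cells s) ^ time_exponent s.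

Lemma liouville_entry_le c c' d h : 0 < h -> c <= c' ->
  liouville_entry c d h <= liouville_entry c' d h.
Proof.
move=> h0 cc'; have H : h ^ c <= h ^ c' by rewrite leq_pexp2l.
have D : d.+1 ^ c <= d.+1 ^ c' by rewrite leq_pexp2l.
by rewrite /liouville_entry !leq_add // !leq_mul.
Qed.

Lemma fact_le_exp n : n`! <= n ^ n.
Proof.
elim: n => // n IH; rewrite factS expnS leq_mul2l /= (leq_trans IH) //.
by case: n {IH} => // n; rewrite leq_exp2r.
Qed.

Lemma liouville_const_le c s : 0 < s -> c <= generators_bound s ->
  liouville_const c s s <= height_factor s.
Proof.
move=> s0 cc; have H : s ^ c <= s ^ generators_bound s by rewrite leq_pexp2l.
have D : s.+1 ^ c <= degree_bound s by rewrite leq_pexp2l.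
have e := liouville_entry_le s s0 cc.
rewrite /liouville_const /height_factor !leq_mul //.
  rewrite (leq_trans (leq_fact D)) // fact_le_exp //.
apply: (@leq_trans ((liouville_entry c s s).+1 ^ degree_bound s)).
  by rewrite leq_pexp2l.
by rewrite leq_exp2r // expn_gt0.
Qed.

(** Times of the successive observation windows. *)
Definition scale s N l := (growth_base s * N) ^ (growth_exponent s ^ l).

Lemma growth_base_gt1 s : 1 < growth_base s.
Proof. by rewrite /growth_base addn2. Qed.

Lemma growth_exponent_gt1 s : 1 < growth_exponent s.
Proof. by rewrite /growth_exponent mulnS. Qed.

Lemma scale_lt s N l : 0 < N -> scale s N l < scale s N l.+1.
Proof.
move=> N0; have b1 : 1 < growth_base s * N.
  by rewrite (leq_trans (growth_base_gt1 s)) // leq_pmulr.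
by rewrite ltn_exp2l // ltn_exp2l // growth_exponent_gt1.
Qed.

Lemma scale_mono s N : 0 < N -> {homo scale s N : l l' / l <= l'}.
Proof.
move=> N0; apply: (@homo_leq _ (scale s N) leq) => [//|m n p|l]; first exact: leq_trans.
exact/ltnW/scale_lt.
Qed.

Lemma scale_gt0 s N l : 0 < N -> 0 < scale s N l.
Proof. by move=> N0; rewrite expn_gt0 muln_gt0 (ltnW (growth_base_gt1 s)) N0. Qed.

(** Up to a constant the left-hand side is at most the power [degree_bound +
    1] of [N] times the scale; doubling the exponent makes up for the constant
    and for [N]. *)
Lemma scale_step s m N l : 0 < N -> m <= s ->
  m * ((2 * line_bound s + 1) * (N * height_factor s *
    (N * scale s N l * (2 * line_bound s + 10)) ^ degree_bound s)) < (scale s N l.+1).+1.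
Proof.
move=> N0 ms; rewrite ltnS.
set D := degree_bound s; set W := 2 * line_bound s + 10; set T := scale s N l.
have T0 : 0 < T by exact: scale_gt0.
set F := height_factor s; set V := 2 * line_bound s + 1.
have le1 : m * (V * (N * F * (N * T * W) ^ D)) <= growth_base s * (N * T) ^ D.+1.
  rewrite expnMn expnS; move: ((N * T) ^ D) (leq_pmulr N T0) => Y NT.
  apply: (@leq_trans (s * V * F * W ^ D * (N * Y))).
    rewrite (_ : m * _ = m * (V * F * W ^ D * (N * Y))); last by ring.
    by rewrite -!mulnA leq_mul.
  by apply: leq_mul; [rewrite leq_addr|rewrite leq_mul2r NT orbT].
apply: leq_trans le1 _; apply: (@leq_trans ((growth_base s * N * T) ^ D.+1)).
  rewrite -mulnA [in leqRHS]expnMn leq_mul2r; apply/orP; right.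
  by rewrite -{1}[growth_base s]expn1 leq_pexp2l // ltnW // growth_base_gt1.
rewrite /T /scale [growth_exponent s ^ l.+1]expnS; set b := growth_base s * N; set x := growth_exponent s ^ l.
have x0 : 0 < x by rewrite expn_gt0 ltnW ?growth_exponent_gt1.
rewrite -expnS -expnM leq_pexp2l ?muln_gt0 ?N0 ?(ltnW (growth_base_gt1 s)) //.
rewrite /growth_exponent -/D -mulnA mulnCA mulnC leq_mul2l /= mul2n -addnn.
by rewrite -[x.+1]addn1 leq_add2l.
Qed.

End Constants.

(** * The time of the first visit *)

Section Core.
Variables (R : realType) (P : net R) (alpha : R) (s : nat).
Hypothesis HP : polyrectangle_translation_surface P.
Hypothesis alphaK : ~ field_gen (coordinate P) alpha.
Local Notation om := (om alpha).
Local Notation comb := (@bounded_comb R (generator P) (@gen_value R P alpha) None).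
Hypothesis liou : forall N H z, (0 < N)%N -> (0 < H)%N -> comb N H z -> z != 0 ->
  1 <= `|z| * (N * height_factor s * H ^ degree_bound s)%:R.
Hypothesis coordX : forall g, `|@gen_value R P alpha g| <= (coordinate_bound s)%:R.
Hypothesis edges_s : (npairs P <= s)%N.

Lemma slope_neq0 : alpha != 0.
Proof.
apply/eqP => a0; apply: alphaK => F [F1 FB _] _.
by rewrite a0 -(subrr 1); apply: FB.
Qed.
Local Notation alpha0 := slope_neq0.

Lemma vertex_coord v : vertex P v ->
  `|v.1| <= (coordinate_bound s)%:R /\ `|v.2| <= (coordinate_bound s)%:R.
Proof.
move=> /vertex_vtx [x ->]; split.
  exact: (coordX (Some (x, true))).
exact: (coordX (Some (x, false))).
Qed.

Lemma om_bound v : vertex P v -> `|om v| <= (line_bound s)%:R.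
Proof.
move=> /vertex_coord [h1 h2]; rewrite /om /line_bound natrD natrM.
rewrite (le_trans (ler_normB _ _)) // lerD // normrM ler_pM //.
exact: (coordX None).
Qed.

Lemma height_factor_gt0 : (0 < height_factor s)%N.
Proof.
case: (posnP (height_factor s)) => // h0.
have c : comb 1 1 1 by have := comb_rational P alpha (1 : int) (isT : (0 < 1)%N); rewrite divr1.
have := @liou 1%N 1%N 1 isT isT c (oner_neq0 _).
by rewrite h0 muln0 mul0n mulr0 ler10.
Qed.

Lemma comb_separated N H z : (0 < N)%N -> (0 < H)%N -> comb N H z -> z != 0 ->
  ((N * height_factor s * H ^ degree_bound s)%:R)^-1 <= `|z|.
Proof.
move=> N0 H0 cz z0; have h := liou N0 H0 cz z0.
have p0 : 0 < (N * height_factor s * H ^ degree_bound s)%:R :> R.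
  by rewrite ltr0n 2!muln_gt0 N0 height_factor_gt0 expn_gt0 H0.
by rewrite -[leLHS]div1r ler_pdivrMr.
Qed.

Lemma height_gap v v' : vertex P v -> vertex P v' -> v.2 != v'.2 ->
  ((gap_factor s)%:R)^-1 <= `|v.2 - v'.2|.
Proof.
move=> /vertex_vtx [x ->] /vertex_vtx [y ->] ne.
have c : comb 1 (1 + 1) ((vtx x).2 - (vtx y).2).
  exact: combB (comb_coord alpha 1 (x, false)) (comb_coord alpha 1 (y, false)).
have := @comb_separated 1%N (1 + 1)%N _ isT isT c.
by rewrite subr_eq0 mul1n; apply.
Qed.

Lemma mark_separated N Ha u a b T x x' : (0 < N)%N -> (0 < T)%N -> comb N Ha a -> comb N Ha b ->
  (Ha <= (line_bound s + 2) * N)%N ->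
  let mp := mark_place (fun _ j : 'I_(npairs P) => tr alpha j (out_side u j))
    (vertex_lines P alpha) a b T in
  mp x -> mp x' -> x != x' ->
  ((N * height_factor s * (N * T * (2 * line_bound s + 10)) ^ degree_bound s)%:R)^-1 <=
  `|x - x'|.
Proof.
move=> N0 T0 ca cb hHa mp mx mx' ne.
have cx := comb_mark_place ca cb mx; have cx' := comb_mark_place ca cb mx'.
have := combB cx cx' => c; apply: comb_separated => //.
- by rewrite 2!muln_gt0 N0 T0 addn_gt0 orbT.
- apply: comb_le c; rewrite -mulnA.
  have : (line_bound s * N <= line_bound s * N * T)%N by rewrite leq_pmulr.
  have : (N <= N * T)%N by rewrite leq_pmulr.
  move: hHa; rewrite mulnDl; move: (line_bound s) => X.
  by rewrite !mulnDr; nia.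
by rewrite subr_eq0.
Qed.

Lemma core_recurrent N u a b (i0 : 'I_(npairs P)) E Ha : (0 < N)%N -> direction alpha u -> a < b ->
  {subset vertex_lines P alpha <= E} ->
  (forall w, a < w < b -> valid alpha u (i0, w)) ->
  (exists la : seq ('I_(npairs P) * bool), a + tr_sum alpha la \in E) ->
  (exists lb : seq ('I_(npairs P) * bool), b + tr_sum alpha lb \in E) ->
  comb N Ha a -> comb N Ha b -> (Ha <= (line_bound s + 2) * N)%N ->
  recurrent alpha E i0 (scale s N (4 * s * s + 3)) u a b.
Proof.
move=> N0 du ab EC Jv ha hb ca cb hHa.
pose kap l : R := ((N * height_factor s *
  (N * scale s N l * (2 * line_bound s + 10)) ^ degree_bound s)%:R)^-1.
pose K l := ((2 * line_bound s + 1) * (N * height_factor s *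
  (N * scale s N l * (2 * line_bound s + 10)) ^ degree_bound s))%N.
have pos_nat l : (0 < N * height_factor s *
    (N * scale s N l * (2 * line_bound s + 10)) ^ degree_bound s)%N.
  by rewrite 2!muln_gt0 N0 height_factor_gt0 expn_gt0 2!muln_gt0 N0 scale_gt0 // addn_gt0 orbT.
have kap0 l : 0 < kap l by rewrite invr_gt0 ltr0n.
have rec := @recurrent_bound R P alpha HP alpha0 E i0 EC u a b (line_bound s)%:R (scale s N)
  kap K du ab Jv om_bound ha hb (fun l => scale_lt s l N0) kap0 _ _ _.
have le : (scale s N (npairs P * size (vertex_lines P alpha) + 2).+1 <=
    scale s N (4 * s * s + 3))%N.
  apply: scale_mono => //; rewrite size_map -cardT !card_prod card_bool card_ord; nia.
move=> x vx gx tx; have [|||k [y [/andP[k0 kN] py ty]]] := rec _ _ _ x vx gx tx.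
- move=> l y y' /=; apply: mark_separated ca cb hHa => //; exact: scale_gt0.
- move=> l; rewrite /K natrM /kap mulfK ?gt_eqF ?ltr0n // -[2 * _]natrM ltr_nat.
  by rewrite addn1.
- by move=> l; apply: scale_step.
by exists k, y; split => //; rewrite k0 (leq_trans kN).
Qed.

Lemma inv_u1 u : u.1 ^+ 2 + u.2 ^+ 2 = 1 -> direction alpha u ->
  `|u.1|^-1 <= (coordinate_bound s).+1%:R.
Proof.
move=> u12 [u1 u2]; have aX := coordX None; rewrite /= in aX.
have n1 : 0 < `|u.1| by rewrite normr_gt0.
have n2 : `|u.2| = `|alpha| * `|u.1| by rewrite u2 normrM.
have h : 1 <= `|u.1| * (1 + `|alpha|).
  have n0 := normr_ge0 alpha.
  have : 1 = `|u.1| ^+ 2 + `|u.2| ^+ 2 by rewrite !real_normK ?num_real.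
  rewrite n2 => E; rewrite -ler_sqr ?nnegrE ?mulr_ge0 ?addr_ge0 // expr1n [leLHS]E.
  by have := mulr_ge0 (mulr_ge0 (ltW n1) (ltW n1)) n0; lra.
rewrite -[leLHS]div1r ler_pdivrMr // mulrC (le_trans h) //.
by rewrite ler_wpM2l // -natr1 addrC lerD2r.
Qed.

(** The target belonging to a square of side [1 / n] has rational ends with
    denominator [cells s * n]; the scales are powers of this number, and the
    number of windows does not depend on [n]. *)
Lemma visit_time L n A : half_infinite_geodesic P alpha L -> (0 < n)%N ->
  aligned_square P n%:R^-1 A ->
  exists2 t0, 0 <= t0 <= (time_factor s)%:R * n%:R ^+ time_exponent s & A (L t0).
Proof.
move=> hL n0 sqA; have [u [u12 du LP]] := geodesic_of hL.
have n0' : 0 < n%:R :> R by rewrite ltr0n.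
have G0 : (0 < gap_factor s)%N by rewrite muln_gt0 height_factor_gt0 expn_gt0.
pose delta : R := (2 * n * gap_factor s)%:R^-1.
have d0 : 0 < delta by rewrite invr_gt0 ltr0n 2!muln_gt0 n0 G0.
have dl : delta <= n%:R^-1 / 2.
  rewrite -invfM lef_pV2 ?posrE ?mulr_gt0 ?ltr0n //; last by rewrite 2!muln_gt0 n0 G0.
  by rewrite -natrM ler_nat [(n * 2)%N]mulnC leq_pmulr.
have gap v v' : vertex P v -> vertex P v' -> v.2 != v'.2 -> delta <= `|v.2 - v'.2|.
  move=> vv vv' ne; apply: le_trans (height_gap vv vv' ne).
  rewrite lef_pV2 ?posrE ?ltr0n //; last by rewrite 2!muln_gt0 n0 G0.
  by rewrite ler_nat leq_pmull // muln_gt0 n0.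
pose nc := (2 * n * gap_factor s * (4 * s + 3))%N.
have nc0 : (0 < nc)%N by rewrite 3!muln_gt0 n0 G0 addn_gt0 orbT.
have hd : (#|{: 'I_(npairs P) * bool * bool}| + 3)%:R <= delta * nc%:R.
  rewrite /delta /nc [(_ * (4 * s + 3))%:R]natrM mulKf; last by rewrite pnatr_eq0 -lt0n 2!muln_gt0 n0 G0.
  by rewrite ler_nat !card_prod card_bool card_ord leq_add2r -mulnA mulnC leq_mul2l edges_s orbT.
have [i0 [k visit]] := square_target HP alpha0 du sqA d0 dl gap nc0 hd.
pose N := (3 * nc)%N; have N0 : (0 < N)%N by rewrite muln_gt0.
have NE : N = (cells s * n)%N by rewrite /N /nc /cells; ring.
pose a : R := (3 * k + 1)%:~R / N%:R; pose b : R := (3 * k + 2)%:~R / N%:R.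
have N0' : 0 < N%:R :> R by rewrite ltr0n.
have ab : a < b by rewrite ltr_pM2r ?invr_gt0 // ltr_int ltrD2l.
have Jv w : a < w < b -> valid alpha u (i0, w).
  by move=> /andP[/ltW h1 /ltW h2]; have [] := visit w; first exact/andP.
have num_bound (m : int) : a <= m%:~R / N%:R <= b -> (absz m <= line_bound s * N)%N.
  move=> hm; have [vm _] := visit _ hm; have := dom_bound alpha0 om_bound vm.
  rewrite /= normrM normfV normr_nat ler_pdivrMr // -natrM -intr_norm -abszE.
  by rewrite ler_nat.
have ca : comb N (line_bound s * N) a.
  by apply: comb_le (comb_rational P alpha _ N0); apply: num_bound; rewrite lexx ltW.
have cb : comb N (line_bound s * N) b.
  by apply: comb_le (comb_rational P alpha _ N0); apply: num_bound; rewrite lexx ltW.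
pose E := [:: a; b] ++ vertex_lines P alpha.
have EC : {subset vertex_lines P alpha <= E} by move=> x h; rewrite mem_cat h orbT.
have aE : a \in E by rewrite mem_cat inE eqxx.
have bE : b \in E by rewrite mem_cat !inE eqxx orbT.
pose Nst := scale s N (4 * s * s + 3).
have rec2 : recurrent2 alpha E i0 Nst u a b.
  split.
    apply: core_recurrent ca cb _ => //.
    - by exists [::]; rewrite /tr_sum big_nil addr0.
    - by exists [::]; rewrite /tr_sum big_nil addr0.
    - by rewrite leq_mul2r leq_addr orbT.
  have dr := direction_rev du.
  have cj x : comb N (line_bound s * N) x -> comb N ((line_bound s + 2) * N) (x - jump alpha i0 u).
    by rewrite mulnDl => cx; apply: combB cx _; exact: comb_tr.
  apply: core_recurrent (cj _ ca) (cj _ cb) _ => //.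
  - by rewrite ltrD2r.
  - move=> w hw; have := @conv_valid R P alpha alpha0 u (i0, w + jump alpha i0 u) du.
    by rewrite /conv /= addrK; apply; apply: Jv; lras.
  - by exists [:: (i0, out_side u i0)]; rewrite /tr_sum big_seq1 subrK.
  - by exists [:: (i0, out_side u i0)]; rewrite /tr_sum big_seq1 subrK.
have hit x : valid alpha u x -> gen P alpha E x.2 ->
    exists k y, [/\ (k <= Nst)%N, path alpha u k x y & target i0 a b y].
  move=> vx gx.
  have [k' [y [py ty]]] := all_hit HP alpha0 alphaK EC du rec2 ab Jv vx gx.
  exact (hit_bound HP alpha0 du rec2 vx gx py ty).
have xX v : vertex P v -> `|v.1| <= (coordinate_bound s)%:R by move=> /vertex_coord [].
have [t0 ht0 At0] := run_geodesic HP alpha0 alphaK du LP xX visit hit.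
exists t0 => //; move/andP: ht0 => [-> h]; apply: le_trans h _.
have Nst0 : (0 < Nst)%N by exact: scale_gt0.
have -> : (time_factor s)%:R * n%:R ^+ time_exponent s =
    (16 * coordinate_bound s * (coordinate_bound s).+1 * Nst)%:R :> R.
  rewrite -natrX -natrM /Nst /scale NE -/(time_exponent s) /time_factor -mulnA.
  by rewrite -expnMn mulnA.
apply: (@le_trans _ _ (2 * Nst.+3%:R * (2 * (coordinate_bound s)%:R *
    (coordinate_bound s).+1%:R))).
  by rewrite ler_wpM2l // ler_wpM2l //; exact: inv_u1.
rewrite -!natrM ler_nat; nia.
Qed.

End Core.

(** * The constants are computable *)

Section Computation.
Local Open Scope nat_scope.

Local Ltac computability := repeat first
  [ exact: computable1_id | exact: computable1_const
  | apply: computable1_add | apply: computable1_mul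
  | apply: computable1_exp | apply: computable1_succ ].

Lemma computable_time_exponent : computable1 time_exponent.
Proof.
rewrite /time_exponent /growth_exponent /degree_bound /generators_bound.
by computability.
Qed.

Lemma computable_time_factor : computable1 time_factor.
Proof.
rewrite /time_factor /time_exponent /growth_exponent /growth_base /cells /gap_factor
  /height_factor /liouville_entry /line_bound /coordinate_bound /degree_bound
  /generators_bound.
by computability.
Qed.

End Computation.

(** * What a code says about the generators *)

Section Codes.
Variables (R : realType).

Lemma acode_poly (c : acode) (x : R) s : acode_of c x -> (pickle c <= s)%N ->
  exists q : {poly int}, [/\ q != 0, root (map_poly intr q) x, (size q <= s.+1)%N &
    forall i, `|q`_i| <= s%:R].
Proof.
move=> [p0 px _ _] cs; exists (Poly c.1); split => //.
- by apply: contra_neq p0 => ->; rewrite rmorph0.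
- have h : (pickle c.1 < pickle c)%N by exact: (leq_pickle_fst (S := seq int) (T := (rat * rat)%type) c).
  have := leq_pickle_size (c.1 : seq int); have := size_Poly c.1.
  by move=> h1 h2; rewrite ltnW // ltnS (leq_trans h1) // (leq_trans h2) // (leq_trans (ltnW h)).
move=> i; rewrite coef_Poly; have [ic|ic] := ltnP i (size c.1); last first.
  by rewrite nth_default // normr0.
have h : (pickle c.1 < pickle c)%N by exact: (leq_pickle_fst (S := seq int) (T := (rat * rat)%type) c).
have h2 := leq_pickle_mem (mem_nth 0 ic); have h3 := leq_pickle_int (nth 0 c.1 i).
rewrite -abszE -natz ler_nat.
exact: leq_trans h3 (leq_trans (ltnW h2) (leq_trans (ltnW h) cs)).
Qed.

Lemma code_size c (P : net R) alpha : net_code_of c P alpha -> (npairs P <= pickle c)%N.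
Proof.
move=> [sc _ _]; rewrite -sc (leq_trans (leq_pickle_size c.1)) // ltnW //.
exact: leq_pickle_fst.
Qed.

Lemma code_generators c (P : net R) alpha : net_code_of c P alpha ->
  forall g, exists q : {poly int}, [/\ q != 0,
    root (map_poly intr q) (@gen_value R P alpha g), (size q <= (pickle c).+1)%N &
    forall i, `|q`_i| <= (pickle c)%:R].
Proof.
move=> [sc Hc ca] [[[[i b] e] d]|]; last first.
  by apply: acode_poly ca _; rewrite ltnW //; exact: leq_pickle_snd.
have [_ sz Hj] := Hc i; set ci := nth _ _ _ in sz Hj.
(* The place of the coordinate: by copy, end and axis, abscissas first. *)
pose j := (4 * b + (2 * e + ~~ d))%N.
have jE : gen_value alpha (Some (i, b, e, d)) = nth 0 (endpoint_coordinates i) j.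
  by rewrite /endpoint_coordinates /gen_value /vtx /j; case: (b); case: (e); case: (d).
have js : (j < size ci.2)%N.
  by rewrite sz /endpoint_coordinates /j; case: (b); case: (e); case: (d).
rewrite jE; apply: acode_poly (Hj j js) _.
have ic : ci \in c.1 by apply: mem_nth; rewrite sc.
have h1 := leq_pickle_mem ic; have h2 := leq_pickle_mem (mem_nth ([::], (0, 0)) js).
have h3 := leq_pickle_snd (S := bool) (T := seq acode) ci.
have h4 := leq_pickle_fst (S := seq (bool * seq acode)) (T := acode) c.
by apply: ltnW; apply: ltn_trans h2 (ltn_trans h3 (ltn_trans h1 h4)).
Qed.

End Codes.

Theorem theorem3 (R : realType) :
  exists c15 c16 : net_code -> nat,
    [/\ computable c15, computable c16 &
      forall (P : net R) (alpha : R),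
        polyrectangle_translation_surface P -> algebraic_net P -> algebraic alpha ->
        ~ field_gen (coordinate P) alpha ->
        forall c : net_code, net_code_of c P alpha ->
        [/\ (0 < c15 c)%N, (0 < c16 c)%N &
          forall L : R -> set (corner R), half_infinite_geodesic P alpha L ->
          forall n : nat, (2 <= n)%N ->
          forall A : set (set (corner R)), aligned_square P n%:R^-1 A ->
          exists t0 : R,
            0 <= t0 <= (c15 c)%:R * n%:R ^+ c16 c /\ A (L t0)]].
Proof.
exists (fun c => time_factor (pickle c)), (fun c => time_exponent (pickle c)).
split; [exact: computable_pickle computable_time_factor
       |exact: computable_pickle computable_time_exponent|].
move=> P alpha HP _ _ alphaK c cP; set s := pickle c.
have s0 : (0 < s)%N.
  exact: leq_ltn_trans (leq0n _) (leq_pickle_fst (S := seq (bool * seq acode)) (T := acode) c).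
have /choice [q qP] := code_generators cP.
have q0 g : q g != 0 by case: (qP g).
have qr g : root (map_poly intr (q g)) (@gen_value R P alpha g) by case: (qP g).
have qs g : (size (q g) <= s.+1)%N by case: (qP g).
have qh g i : `|(q g)`_i| <= s%:R by case: (qP g).
have gs : (#|generator P| <= generators_bound s)%N.
  rewrite card_option !card_prod card_bool card_ord /generators_bound.
  by have := code_size cP; rewrite -/s; lia.
have liou N H z : (0 < N)%N -> (0 < H)%N ->
    @bounded_comb R (generator P) (@gen_value R P alpha) None N H z -> z != 0 ->
    1 <= `|z| * (N * height_factor s * H ^ degree_bound s)%:R.
  move=> N0 H0 cz z0; have := liouville q0 qr qs qh N0 H0 cz z0.
  move=> /le_trans; apply; rewrite ler_wpM2l // ler_nat leq_mul //.
    by rewrite leq_mul // liouville_const_le.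
  by rewrite leq_pexp2l // leq_pexp2l.
have coordX g : `|@gen_value R P alpha g| <= (coordinate_bound s)%:R.
  exact: root_bound (q0 g) (qr g) (qs g) (qh g).
have hf : (0 < height_factor s)%N := height_factor_gt0 liou.
split.
- by rewrite /time_factor muln_gt0 /= expn_gt0 muln_gt0 ltnW ?growth_base_gt1 //=
    /cells /gap_factor 3!muln_gt0 hf expn_gt0 addn_gt0 !orbT.
- by rewrite expn_gt0 ltnW ?growth_exponent_gt1.
move=> L hL n n2 A sqA.
have [t0 ht0 At0] := visit_time HP alphaK liou coordX (code_size cP) hL (ltnW n2) sqA.
by exists t0.
Qed.
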